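(* Let $g(t)=\sum_{k=1}^N \frac{a_k}{t-iw_k}$ with $a_k,w_k\in\mathbb{C}$, $a_k\neq 0$, $\Re w_k\neq 0$, and assume $\Re w_k\neq \Re w_l$ for $k\neq l$ and $$m_0(\xi):=\sum_{k=1}^N a_k e^{2\pi \xi w_k}\neq 0\quad\text{for all }\xi>0.$$ Then the Gabor system $\mathcal{G}(g;\alpha,\beta)$ is a frame in $L^2(\mathbb{R})$ for every $\alpha,\beta>0$ with $\alpha\beta<1$ and $\alpha\beta\notin\mathbb{Q}$.
   Context: For $g\in L^2(\mathbb{R})$ and $\alpha,\beta>0$, $\mathcal{G}(g;\alpha,\beta)=\{e^{2\pi i\beta n t}g(t-\alpha m)\}_{m,n\in\mathbb{Z}}$. It is a frame in $L^2(\mathbb{R})$ if there are $0<A\le B<\infty$ with $A\|f\|^2\le\sum_{m,n}|\langle f, e^{2\pi i\beta n\cdot}g(\cdot-\alpha m)\rangle|^2\le B\|f\|^2$ for all $f\in L^2(\mathbb{R})$. *)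

(* Defs.v *)
(* R : realType, complex numbers R[i] from mathcomp-real-closed. *)
From HB Require Import structures.
From mathcomp Require Import all_boot all_order all_algebra.
From mathcomp Require Import all_classical all_reals all_analysis.
From mathcomp Require Import complex.
Set Implicit Arguments. Unset Strict Implicit. Unset Printing Implicit Defensive.
Import Order.TTheory GRing.Theory Num.Theory.
Import numFieldNormedType.Exports.
Local Open Scope classical_set_scope.
Local Open Scope ring_scope.
Local Open Scope complex_scope.

Section Gabor.
Variable R : realType.

(* e^{i x} for real x *)
Definition cexpi (x : R) : R[i] := cos x +i* sin x.
(* complex exponential e^z = e^{complex.Re z} e^{i complex.Im z} *)
Definition cexp (z : R[i]) : R[i] := (expR (complex.Re z))%:C * cexpi (complex.Im z).
(* squared modulus |z|^2 *)
Definition abs2 (z : R[i]) : R := complex.Re z ^+ 2 + complex.Im z ^+ 2.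

(* f : R -> C belongs to L^2(R) (Lebesgue measure) *)
Definition L2 (f : R -> R[i]) : Prop :=
  measurable_fun setT (fun t => complex.Re (f t)) /\
  measurable_fun setT (fun t => complex.Im (f t)) /\
  (\int[@lebesgue_measure R]_t (abs2 (f t))%:E < +oo)%E.

(* ||f||^2 *)
Definition norm2 (f : R -> R[i]) : R :=
  \int[@lebesgue_measure R]_t abs2 (f t).

(* <f, h> = \int f(t) conj(h(t)) dt *)
Definition inner (f h : R -> R[i]) : R[i] :=
  (\int[@lebesgue_measure R]_t complex.Re (f t * (h t)^*)) +i*
  (\int[@lebesgue_measure R]_t complex.Im (f t * (h t)^*)).

(* t |-> e^{2 pi i beta n t} g(t - alpha m) *)
Definition gabor_atom (g : R -> R[i]) (alpha beta : R) (m n : int) : R -> R[i] :=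
  fun t => cexpi (2 * pi * beta * n%:~R * t) * g (t - alpha * m%:~R).

(* frame property for a family indexed by a type I *)
Definition is_frame (I : choiceType) (F : I -> (R -> R[i])) : Prop :=
  exists A B : R, 0 < A /\ A <= B /\
    forall f, L2 f ->
      ((A * norm2 f)%:E <= \esum_(i in [set: I]) (abs2 (inner f (F i)))%:E
       <= (B * norm2 f)%:E)%E.

(* G(g; alpha, beta) is a frame in L^2(R) *)
Definition gabor_frame (g : R -> R[i]) (alpha beta : R) : Prop :=
  is_frame (fun mn : int * int => gabor_atom g alpha beta mn.1 mn.2).

End Gabor.

(* Main.v *)
(* For bounded compactly supported f, put L = 1/beta and x_k = t + kL. Parseval
   on [0, L] turns the sum over n of |<f, atom_(m,n)>|^2 into the integral over t
   of |sum_k f(x_k) conj g(x_k - alpha m)|^2, so everything reduces to comparing,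
   uniformly in t and for finite sequences c, the sum over m of
   |sum_k c_k g(x_k - alpha m)|^2 with sum_k |c_k|^2.

   Let p = 1/alpha, b = beta < p, q_l = e^{2 pi p w_l}, and set
     C(y) = sum_k c_k e^{2 pi i y x_k},
     H_l(y) = sum_k c_k e^{2 pi i y x_k} / (1 - q_l e^{2 pi i p x_k}),
     S(y) = sum_l a_l e^{2 pi w_l y} H_l(y).
   The samples are, up to a constant, the Fourier coefficients of S on [0, p], so
   their energy is comparable to the integral of |S|^2 over [0, p]. Since |q_l| is
   not 1, this is at most a constant times the integral of |C|^2 over a period,
   hence times sum_k |c_k|^2. For the lower bound |C(y)| must be controlled by
   values of S on ]0, p[. Here H_l(y) - q_l H_l(y + p) = C(y), hence
   S(y) - S(y + p) = m0(y) C(y), and translation by b multiplies C, H and S by a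
   unimodular constant. So the values of S at the points y + jp + mb of ]0, p[ are
   linear forms in the H_l(y) and in C(y), C(y + p), ..., whose coefficients are
   exponential polynomials in y. As p/b is irrational these points become dense,
   and a minimal corank argument shows that finitely many of the forms generically
   determine all the unknowns: otherwise the spans of the forms over neighbouring
   intervals would all coincide, and a common kernel vector would vanish by
   Vandermonde (the Re w_l are distinct). Non-vanishing of m0 on ]0, oo[ then
   propagates the bound on C from one small interval to the whole line.

   General f in L^2 is approximated by cutting off its domain and its range. *)

Require Import Defs.
From HB Require Import structures.
From mathcomp Require Import all_boot all_order all_algebra.
From mathcomp Require Import all_classical all_reals all_analysis.
From mathcomp Require Import measurable_realfun complex.
From mathcomp Require Import ring lra zify.
Import Order.TTheory GRing.Theory Num.Theory.
Import numFieldNormedType.Exports.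
Local Open Scope ring_scope.
Local Open Scope complex_scope.

(** The linear forms depend only on [a], [w], [b] and [p]; the offset t and the sequence c enter
    through the abstract notion [cocycle] alone, so every constant is uniform in them. The obstacle
    is that S is known on ]0, p[ only, while S(x) = m0(x) C(x) + S(x + p) involves a value outside.
    Hence S(x + p) has to be bounded through the H_l at a later point, and bounds travel backwards
    from y + p to y. They start at an interval on which finitely many forms determine all the H_l,
    and the orbit of every y enters it after a bounded number of steps. The unknowns C(y), C(y + p),
    ... are cut off at some n. Admitting one more of them, on either side, adds one unknown and one
    generically independent form, so the corank never grows. The inequality b < p gives the room for
    all this: every line y + bZ meets each open window longer than b, windows ]0, om[ with b < om <
    p can still be widened when base points move, and representatives modulo b can be kept in a
    compact part of ]0, p[, on which |m0| is bounded below. The resulting pointwise bound of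
    |C(y)|^2 by a fixed number of values of |S|^2 is then integrated over one period of |C|. *)

Section ComplexBasics.
Context {R : realType}.
Implicit Types (x y z : R[i]) (t : R).

Lemma Re_add x y : complex.Re (x + y) = complex.Re x + complex.Re y.
Proof. by case: x y => [? ?] [? ?]. Qed.
Lemma Im_add x y : complex.Im (x + y) = complex.Im x + complex.Im y.
Proof. by case: x y => [? ?] [? ?]. Qed.
Lemma Re_opp x : complex.Re (- x) = - complex.Re x.
Proof. by case: x. Qed.
Lemma Im_opp x : complex.Im (- x) = - complex.Im x.
Proof. by case: x. Qed.
Lemma Re_mul x y : complex.Re (x * y) =
  complex.Re x * complex.Re y - complex.Im x * complex.Im y.
Proof. by case: x y => [? ?] [? ?]. Qed.
Lemma Im_mul x y : complex.Im (x * y) =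
  complex.Re x * complex.Im y + complex.Im x * complex.Re y.
Proof. by case: x y => [? ?] [? ?]. Qed.
Lemma ReC_conj x : complex.Re (conjc x) = complex.Re x. Proof. by case: x. Qed.
Lemma ImC_conj x : complex.Im (conjc x) = - complex.Im x. Proof. by case: x. Qed.

Lemma ReC_sum (I : Type) (r : seq I) (P : pred I) (F : I -> R[i]) :
  complex.Re (\sum_(i <- r | P i) F i) = \sum_(i <- r | P i) complex.Re (F i).
Proof. by apply: (big_morph _ Re_add). Qed.
Lemma ImC_sum (I : Type) (r : seq I) (P : pred I) (F : I -> R[i]) :
  complex.Im (\sum_(i <- r | P i) F i) = \sum_(i <- r | P i) complex.Im (F i).
Proof. by apply: (big_morph _ Im_add). Qed.

Lemma complex_ext x y : complex.Re x = complex.Re y ->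
  complex.Im x = complex.Im y -> x = y.
Proof. by case: x y => [? ?] [? ?] /= -> ->. Qed.

Lemma abs2_ge0 x : 0 <= abs2 x.
Proof. by rewrite /abs2 addr_ge0 ?sqr_ge0. Qed.
Lemma abs2_0 : abs2 (0 : R[i]) = 0.
Proof. by rewrite /abs2 /= expr0n /= addr0. Qed.
Lemma abs2_eq0 x : (abs2 x == 0) = (x == 0).
Proof.
by rewrite /abs2 paddr_eq0 ?sqr_ge0// !sqrf_eq0; case: x => a b; rewrite eq_complex.
Qed.
Lemma abs2_gt0 x : (0 < abs2 x) = (x != 0).
Proof. by rewrite lt_def abs2_eq0 abs2_ge0 andbT. Qed.
Lemma abs2M x y : abs2 (x * y) = abs2 x * abs2 y.
Proof. by rewrite /abs2 Re_mul Im_mul; ring. Qed.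
Lemma abs2N x : abs2 (- x) = abs2 x.
Proof. by rewrite /abs2 Re_opp Im_opp !sqrrN. Qed.
Lemma abs2J x : abs2 (conjc x) = abs2 x.
Proof. by rewrite /abs2 ReC_conj ImC_conj sqrrN. Qed.
Lemma abs2_real t : abs2 t%:C = t ^+ 2.
Proof. by rewrite /abs2 /= expr0n addr0. Qed.
Lemma abs2_1 : abs2 (1 : R[i]) = 1.
Proof. by rewrite /abs2 /= expr0n expr1n addr0. Qed.
Lemma abs2V x : abs2 x^-1 = (abs2 x)^-1.
Proof.
have [->|x0] := eqVneq x 0; first by rewrite invr0 abs2_0 invr0.
apply: (mulfI (x := abs2 x)); first by rewrite abs2_eq0.
by rewrite -abs2M !divff ?abs2_eq0// abs2_1.
Qed.
Lemma conjcB x y : conjc (x - y) = conjc x - conjc y.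
Proof. by apply: complex_ext; rewrite ?(Re_add, Im_add, ReC_conj, ImC_conj, Re_opp, Im_opp); ring. Qed.
Lemma conjcM x y : conjc (x * y) = conjc x * conjc y.
Proof. by apply: complex_ext; rewrite ?(Re_mul, Im_mul, ReC_conj, ImC_conj); ring. Qed.
Lemma conjc_sum (I : Type) (r : seq I) (F : I -> R[i]) :
  conjc (\sum_(i <- r) F i) = \sum_(i <- r) conjc (F i).
Proof. exact: (rmorph_sum (@conjc R)). Qed.
Lemma mulJ_abs2 x : x * conjc x = (abs2 x)%:C.
Proof.
apply: complex_ext; rewrite ?Re_mul ?Im_mul ReC_conj ImC_conj /abs2 /=; ring.
Qed.
Lemma abs2D_le x y : abs2 (x + y) <= 2 * abs2 x + 2 * abs2 y.
Proof.
rewrite /abs2 Re_add Im_add.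
have := sqr_ge0 (complex.Re x - complex.Re y).
have := sqr_ge0 (complex.Im x - complex.Im y).
nra.
Qed.
Lemma abs2B_le x y : abs2 (x - y) <= 2 * abs2 x + 2 * abs2 y.
Proof. by rewrite -(abs2N y); exact: abs2D_le. Qed.

(** Cauchy-Schwarz against a constant sequence. In the induction step the cross term 2 F_i s is
    absorbed by expanding (n F_i - s)^2 >= 0 and using s^2 <= n q. *)
Lemma sqr_sum_le (I : Type) (r : seq I) (F : I -> R) :
  (\sum_(i <- r) F i) ^+ 2 <= (size r)%:R * \sum_(i <- r) F i ^+ 2.
Proof.
elim: r => [|i r IH]; first by rewrite !big_nil expr0n mulr0.
rewrite !big_cons /= -natr1; set s := \sum_(j <- r) F j in IH *.
set q := \sum_(j <- r) F j ^+ 2 in IH *.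
have -> : (F i + s) ^+ 2 = F i ^+ 2 + 2 * (F i * s) + s ^+ 2 by ring.
suff : 2 * (F i * s) <= (size r)%:R * F i ^+ 2 + q by lra.
have [r0|r0] := eqVneq (size r) 0%N.
  rewrite /s /q; move/size0nil: r0 => ->; rewrite !big_nil !mulr0 mul0r; lra.
have n0 : 0 < (size r)%:R :> R by rewrite ltr0n lt0n.
rewrite -(ler_pM2l n0).
have := sqr_ge0 ((size r)%:R * F i - s); nra.
Qed.

Lemma abs2_sum_le (I : Type) (r : seq I) (F : I -> R[i]) :
  abs2 (\sum_(i <- r) F i) <= (size r)%:R * \sum_(i <- r) abs2 (F i).
Proof.
rewrite /abs2 ReC_sum ImC_sum big_split /= mulrDr lerD//; exact: sqr_sum_le.
Qed.

Lemma abs2_sum_ord_le n (F : 'I_n -> R[i]) :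
  abs2 (\sum_(i < n) F i) <= n%:R * \sum_(i < n) abs2 (F i).
Proof.
have := abs2_sum_le _ (index_enum 'I_n) F.
by rewrite [X in (size X)%:R]unlock -enumT size_enum_ord.
Qed.

Lemma abs2_cexpi t : abs2 (cexpi t) = 1.
Proof. by rewrite /abs2 /cexpi /= cos2Dsin2. Qed.
Lemma cexpiD s t : cexpi (s + t) = cexpi s * cexpi t :> R[i].
Proof.
rewrite /cexpi cosD sinD; apply: complex_ext; rewrite ?Re_mul ?Im_mul /=; ring.
Qed.
Lemma cexpi0 : cexpi 0 = 1 :> R[i].
Proof. by rewrite /cexpi cos0 sin0. Qed.
Lemma cexpiN t : cexpi (- t) = conjc (cexpi t) :> R[i].
Proof. by rewrite /cexpi cosN sinN. Qed.
Lemma cexpD x y : cexp (x + y) = cexp x * cexp y.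
Proof. by rewrite /cexp Re_add Im_add expRD cexpiD rmorphM mulrACA. Qed.
Lemma cexp0 : cexp 0 = 1 :> R[i].
Proof. by rewrite /cexp /= expR0 cexpi0 mulr1. Qed.
Lemma abs2_cexp x : abs2 (cexp x) = expR (2 * complex.Re x).
Proof. by rewrite /cexp abs2M abs2_real abs2_cexpi mulr1 -expRM_natl. Qed.
Lemma cexp_neq0 x : cexp x != 0.
Proof. by rewrite -abs2_eq0 abs2_cexp gt_eqF// expR_gt0. Qed.
Lemma cexp_imag t : cexp (0 +i* t) = cexpi t.
Proof. by rewrite /cexp /= expR0 mul1r. Qed.

End ComplexBasics.

(** * Exponential polynomials *)

Section ExpPoly.
Local Open Scope classical_set_scope.
Context {R : realType}.
Implicit Types (f g : R -> R[i]).

(** Pairs are (coefficient, exponent). Nothing is normalised: exponents may repeat, so sums are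
    concatenations and products are lists of pairs. *)
Definition ep_of (s : seq (R[i] * R[i])) (y : R) : R[i] :=
  \sum_(x <- s) x.1 * cexp (y%:C * x.2).

Definition ep f := exists s, forall y, f y = ep_of s y.

Lemma ep_cst c : ep (fun=> c).
Proof.
exists [:: (c, 0)] => y.
by rewrite /ep_of big_seq1 /= mulr0 cexp0 mulr1.
Qed.

Lemma ep_exp c l : ep (fun y => c * cexp (y%:C * l)).
Proof. by exists [:: (c, l)] => y; rewrite /ep_of big_seq1. Qed.

Lemma epD f g : ep f -> ep g -> ep (fun y => f y + g y).
Proof.
by move=> [s fs] [r gr]; exists (s ++ r) => y; rewrite /ep_of big_cat /= fs gr.
Qed.

Lemma epM f g : ep f -> ep g -> ep (fun y => f y * g y).
Proof.
move=> [s fs] [r gr].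
exists [seq (u.1 * v.1, u.2 + v.2) | u <- s, v <- r] => y.
rewrite /ep_of big_allpairs_dep /= fs gr /ep_of mulr_suml.
apply: eq_bigr => u _; rewrite mulr_sumr; apply: eq_bigr => v _.
by rewrite mulrDr cexpD mulrACA.
Qed.

Lemma ep_ext f g : f =1 g -> ep f -> ep g.
Proof. by move=> fg [s fs]; exists s => y; rewrite -fg. Qed.

Lemma epN f : ep f -> ep (fun y => - f y).
Proof.
move=> ef; apply: ep_ext (epM _ _ (ep_cst (-1)) ef) => y /=.
by rewrite mulN1r.
Qed.

Lemma ep_sum (I : Type) (r : seq I) (P : pred I) (F : I -> R -> R[i]) :
  (forall i, ep (F i)) -> ep (fun y => \sum_(i <- r | P i) F i y).
Proof.
move=> eF; elim: r => [|i r IH].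
  by apply: ep_ext (ep_cst 0) => y; rewrite big_nil.
case Pi : (P i).
- by apply: ep_ext (epD _ _ (eF i) IH) => y /=; rewrite big_cons Pi.
- by apply: ep_ext IH => y /=; rewrite big_cons Pi.
Qed.

Lemma ep_prod (I : Type) (r : seq I) (P : pred I) (F : I -> R -> R[i]) :
  (forall i, ep (F i)) -> ep (fun y => \prod_(i <- r | P i) F i y).
Proof.
move=> eF; elim: r => [|i r IH].
  by apply: ep_ext (ep_cst 1) => y; rewrite big_nil.
case Pi : (P i).
- by apply: ep_ext (epM _ _ (eF i) IH) => y /=; rewrite big_cons Pi.
- by apply: ep_ext IH => y /=; rewrite big_cons Pi.
Qed.

Lemma ep_det n (F : R -> 'M[R[i]]_n) :
  (forall i j, ep (fun y => F y i j)) -> ep (fun y => \det (F y)).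
Proof.
move=> eF; apply: ep_sum => s; apply: epM; first exact: ep_cst.
by apply: ep_prod => i; exact: eF.
Qed.

Lemma ep_shift f c : ep f -> ep (fun y => f (y + c)).
Proof.
move=> [s fs]; apply: (@ep_ext (fun y => ep_of s (y + c))); first by move=> y; rewrite fs.
apply: ep_sum => x; apply: ep_ext (ep_exp (x.1 * cexp (c%:C * x.2)) x.2) => y /=.
by rewrite rmorphD /= mulrDl cexpD mulrAC mulrA.
Qed.

(* f(y+h) - e^{lambda h} f(y) has one exponential less than f. *)
Lemma ep_of_zero (s : seq (R[i] * R[i])) (u v : R) : u < v ->
  (forall y, u < y < v -> ep_of s y = 0) -> forall y, ep_of s y = 0.
Proof.
have [n] := ubnP (size s); elim: n s u v => // n IH [|[c l] s] u v sn uv s0 y.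
  by rewrite /ep_of big_nil.
pose f := ep_of ((c, l) :: s).
have stp h z : 0 < h -> h < (v - u) / 2 -> f (z + h) = cexp (h%:C * l) * f z.
  move=> h0 hvu.
  pose s' := [seq (x.1 * (cexp (h%:C * x.2) - cexp (h%:C * l)), x.2) | x <- s].
  have H z' : ep_of s' z' = f (z' + h) - cexp (h%:C * l) * f z'.
    rewrite /f /ep_of big_map !big_cons /= rmorphD /= mulrDl mulrDr.
    rewrite cexpD mulr_sumr opprD addrACA.
    rewrite (_ : c * _ - _ = 0); last by ring.
    rewrite add0r -sumrB; apply: eq_bigr => x _.
    by rewrite mulrDl cexpD; ring.
  apply/eqP; rewrite -subr_eq0 -H; apply/eqP.
  apply: (IH s' u ((u + v) / 2)); first by rewrite size_map.
    lra.
  move=> z' /andP[uz zv]; rewrite H /f s0 ?s0 ?mulr0 ?subr0//; apply/andP; split; lra.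
(* Since f(z + h) = e^(lh) f(z) holds for every z and all small h > 0, the zero at the midpoint
   spreads to any y in finitely many small equal steps. *)
have iter k h z : 0 < h -> h < (v - u) / 2 -> (f (z + h *+ k) == 0) = (f z == 0).
  move=> h0 hvu; elim: k => [|k IHk]; first by rewrite mulr0n addr0.
  by rewrite mulrSr addrA stp// mulf_eq0 (negbTE (cexp_neq0 _)).
pose m := (u + v) / 2.
have fm : f m == 0 by rewrite /f s0//; apply/andP; rewrite /m; split; lra.
have [k kh] : exists k : nat, `|y - m| / k.+1%:R < (v - u) / 2.
  exists (Num.truncn (`|y - m| / ((v - u) / 2))); rewrite ltr_pdivrMr// mulrC -ltr_pdivrMr.
    by apply: truncnS_gt.
  by lra.
have k0 : k.+1%:R != 0 :> R by rewrite pnatr_eq0.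
have kp : 0 < k.+1%:R :> R by rewrite ltr0n.
have div (z : R) : z / k.+1%:R *+ k.+1 = z by rewrite -[LHS]mulr_natr divfK.
case: (ltgtP y m) => [ym|my|->]; last exact/eqP.
- have h0 : 0 < (m - y) / k.+1%:R by rewrite divr_gt0// subr_gt0.
  have hv : (m - y) / k.+1%:R < (v - u) / 2.
    by rewrite -[m - y]gtr0_norm ?subr_gt0// distrC.
  apply/eqP; have := iter k.+1 _ y h0 hv.
  by rewrite div addrC subrK fm => /esym.
- have h0 : 0 < (y - m) / k.+1%:R by rewrite divr_gt0// subr_gt0.
  have hv : (y - m) / k.+1%:R < (v - u) / 2.
    by rewrite -[y - m]gtr0_norm ?subr_gt0.
  apply/eqP; have := iter k.+1 _ m h0 hv.
  by rewrite div addrC subrK fm.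
Qed.

Lemma ep_neq0_itv f (u v : R) : ep f -> u < v -> (exists y, f y != 0) ->
  exists2 y, u < y < v & f y != 0.
Proof.
move=> [s fs] uv [z fz]; apply: contrapT => H; move/eqP: fz; apply.
rewrite fs; apply: (ep_of_zero _ _ _ uv) => y yuv; rewrite -fs.
by apply: contrapT => /eqP fy; apply: H; exists y.
Qed.

Lemma continuous_cexp (c l : R[i]) :
  continuous (fun y : R => complex.Re (c * cexp (y%:C * l))) /\
  continuous (fun y : R => complex.Im (c * cexp (y%:C * l))).
Proof.
have cl (a : R) : continuous (fun y : R => y * a).
  by move=> y; apply: cvgMl; exact: cvg_id.
have ce : continuous (fun y : R => expR (y * complex.Re l)).
  by move=> y; exact: (cvg_comp _ _ (cl _ y) (@continuous_expR R _)).
have cc : continuous (fun y : R => cos (y * complex.Im l)).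
  by move=> y; exact: (cvg_comp _ _ (cl _ y) (@continuous_cos R _)).
have cs : continuous (fun y : R => sin (y * complex.Im l)).
  by move=> y; exact: (cvg_comp _ _ (cl _ y) (@continuous_sin R _)).
have E y : cexp (y%:C * l) = (expR (y * complex.Re l) * cos (y * complex.Im l))
    +i* (expR (y * complex.Re l) * sin (y * complex.Im l)).
  rewrite /cexp Re_mul Im_mul /= !mul0r subr0 addr0.
  by apply: complex_ext; rewrite ?Re_mul ?Im_mul /=; ring.
split.
- rewrite (_ : (fun y : R => _) = (fun y => complex.Re c *
    (expR (y * complex.Re l) * cos (y * complex.Im l)) - complex.Im c *
    (expR (y * complex.Re l) * sin (y * complex.Im l)))); last first.
    by apply/funext => y; rewrite Re_mul E.
  move=> y; apply: cvgB; apply: cvgM; try exact: cvg_cst; apply: cvgM;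
    [exact: ce|exact: cc|exact: ce|exact: cs].
- rewrite (_ : (fun y : R => _) = (fun y => complex.Re c *
    (expR (y * complex.Re l) * sin (y * complex.Im l)) + complex.Im c *
    (expR (y * complex.Re l) * cos (y * complex.Im l)))); last first.
    by apply/funext => y; rewrite Im_mul E.
  move=> y; apply: cvgD; apply: cvgM; try exact: cvg_cst; apply: cvgM;
    [exact: ce|exact: cs|exact: ce|exact: cc].
Qed.

Lemma ep_continuous f : ep f ->
  continuous (fun y => complex.Re (f y)) /\ continuous (fun y => complex.Im (f y)).
Proof.
move=> [s fs].
rewrite (_ : f = ep_of s); last exact/funext.
rewrite /ep_of; split.
- rewrite (_ : (fun y => _) = (fun y => \sum_(x <- s) complex.Re (x.1 * cexp (y%:C * x.2)))).
    apply: continuous_big => [z|x _]; first exact: add_continuous.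
    exact: (continuous_cexp x.1 x.2).1.
  by apply/funext => y; rewrite ReC_sum.
- rewrite (_ : (fun y => _) = (fun y => \sum_(x <- s) complex.Im (x.1 * cexp (y%:C * x.2)))).
    apply: continuous_big => [z|x _]; first exact: add_continuous.
    exact: (continuous_cexp x.1 x.2).2.
  by apply/funext => y; rewrite ImC_sum.
Qed.

Lemma ep_abs2_continuous f : ep f -> continuous (fun y => abs2 (f y)).
Proof.
move=> /ep_continuous[cr ci] y; rewrite /abs2.
by apply: cvgD; under eq_fun do rewrite expr2; apply: cvgM; (exact: cr || exact: ci).
Qed.

Lemma ep_ubound f (u v : R) : ep f -> u <= v ->
  exists2 K, 0 < K & forall y, u <= y <= v -> abs2 (f y) <= K.
Proof.
move=> /ep_abs2_continuous cf uv.
have cf' : {within `[u, v], continuous (fun y => abs2 (f y))}.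
  exact: continuous_subspaceT.
have [c _ cM] := EVT_max uv cf'.
exists (abs2 (f c) + 1); first by rewrite ltr_wpDl// abs2_ge0.
by move=> y yuv; rewrite (le_trans (cM y _))// ?in_itv//= ?lerDl.
Qed.

Lemma ep_lbound f (u v : R) : ep f -> u <= v ->
  (forall y, u <= y <= v -> f y != 0) ->
  exists2 d, 0 < d & forall y, u <= y <= v -> d <= abs2 (f y).
Proof.
move=> /ep_abs2_continuous cf uv f0.
have cf' : {within `[u, v], continuous (fun y => abs2 (f y))}.
  exact: continuous_subspaceT.
have [c cuv cM] := EVT_min uv cf'.
exists (abs2 (f c)); first by rewrite abs2_gt0 f0.
by move=> y yuv; apply: cM; rewrite in_itv.
Qed.

Lemma ep_neq0_near f z : ep f -> f z != 0 ->
  exists2 e, 0 < e & forall y, z - e <= y <= z + e -> f y != 0.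
Proof.
move=> /ep_abs2_continuous cf fz.
have : 0 < abs2 (f z) by rewrite abs2_gt0.
move=> /(cvgr_gt (abs2 (f z)) (cf z)).
move=> /nbhs_ballP[e /= e0 eP]; exists (e / 2); first exact: divr_gt0.
move=> y /andP[y1 y2]; rewrite -abs2_gt0; apply: eP; rewrite /ball /= ltr_norml.
by apply/andP; split; lra.
Qed.

Lemma ep_mul_neq0 f g : ep f -> ep g -> (exists y, f y != 0) ->
  (exists y, g y != 0) -> exists y, f y * g y != 0.
Proof.
move=> ef eg [z fz] g0.
have [e e0 eP] := ep_neq0_near _ _ ef fz.
have [|y /andP[y1 y2] gy] := ep_neq0_itv _ (z - e) (z + e) eg _ g0; first by lra.
by exists y; rewrite mulf_neq0// eP// !ltW.
Qed.

Lemma ep_prod_neq0 (I : Type) (r : seq I) (F : I -> R -> R[i]) :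
  (forall i, ep (F i)) -> (forall i, exists y, F i y != 0) ->
  exists y, \prod_(i <- r) F i y != 0.
Proof.
move=> eF F0; elim: r => [|i r IH]; first by exists 0; rewrite big_nil oner_eq0.
have [y h] := ep_mul_neq0 _ _ (eF i) (ep_prod _ r xpredT _ eF) (F0 i) IH.
by exists y; rewrite big_cons.
Qed.
End ExpPoly.

(** * Generic rank of matrices of exponential polynomials *)

Section Rank.

(** A vector x killed by A but not by r witnesses that r lies outside the row space of A. Each
    strict increase of rank below is obtained by exhibiting such an x. *)
Lemma rank_lt (F : fieldType) m1 m2 k (A : 'M[F]_(m1, k)) (B : 'M[F]_(m2, k))
    (r : 'rV_k) (x : 'cV_k) :
  (A <= B)%MS -> (r <= B)%MS -> A *m x = 0 -> r *m x != 0 ->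
  (\rank A < \rank B)%N.
Proof.
move=> AB rB Ax rx; have := mxrank_leqif_eq AB.
rewrite ltn_neqAle mxrankS// andbT => -[_ ->]; apply/negP => /andP[_ BA].
have /submxP[D rD] := submx_trans rB BA.
by move/eqP: rx; apply; rewrite rD -mulmxA Ax mulmx0.
Qed.

Lemma rank_normal_form (F : fieldType) m k r (A : 'M[F]_(m, k)) :
  (r <= \rank A)%N ->
  exists (P : 'M[F]_(r, m)) (Q : 'M[F]_(k, r)), P *m A *m Q = 1%:M.
Proof.
move=> rA.
exists (pid_mx r *m invmx (col_ebase A)), (invmx (row_ebase A) *m pid_mx r).
have rm := leq_trans rA (rank_leq_row A); have rk := leq_trans rA (rank_leq_col A).
rewrite -[X in _ *m X *m _]mulmx_ebase !mulmxA mulmxKV ?col_ebase_unit//.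
rewrite mulmxK ?row_ebase_unit// !mul_pid_mx -pid_mx_1; congr pid_mx.
by lia.
Qed.

Context {R : realType}.

Lemma ep_mulmx m n k (F : R -> 'M[R[i]]_(m, n)) (G : R -> 'M[R[i]]_(n, k)) :
  (forall i j, ep (fun y => F y i j)) -> (forall i j, ep (fun y => G y i j)) ->
  forall i j, ep (fun y => (F y *m G y) i j).
Proof.
move=> eF eG i j.
apply: (@ep_ext _ (fun y => \sum_l F y i l * G y l j)) => [y|]; first by rewrite mxE.
by apply: ep_sum => l; exact: epM.
Qed.

(* A full-rank normal form at one point turns the rank bound into the
   non-vanishing of a single exponential polynomial. *)
Lemma rank_generic m k r (F : R -> 'M[R[i]]_(m, k)) z :
  (forall i j, ep (fun y => F y i j)) -> (r <= \rank (F z))%N ->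
  exists f, [/\ ep f, f z != 0 & forall y, f y != 0 -> (r <= \rank (F y))%N].
Proof.
move=> eF /rank_normal_form[P [Q PQ]].
exists (fun y => \det (P *m F y *m Q)); split.
- by apply: ep_det; apply: ep_mulmx => [|i j]; [apply: ep_mulmx => // i j|]; exact: ep_cst.
- by rewrite PQ det1 oner_eq0.
- move=> y; rewrite -unitfE => fy.
  have /mxrank_unit <- : P *m F y *m Q \in unitmx by rewrite unitmxE.
  by rewrite (leq_trans (mxrankM_maxl _ _))// mxrankM_maxr.
Qed.

End Rank.

Section Vandermonde.
Lemma power_sums_eq0 (F : fieldType) n (z u : 'I_n -> F) :
  injective z -> (forall s : nat, (s < n)%N -> \sum_k u k * z k ^+ s = 0) ->
  forall k, u k = 0.
Proof.
move=> zi us k.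
pose V := Vandermonde n (\row_j z j).
have Vu : V \in unitmx.
  rewrite unitmxE unitfE det_Vandermonde; apply/prodf_neq0 => i _.
  apply/prodf_neq0 => j ij; rewrite !mxE subr_eq0; apply/eqP => /zi E.
  by rewrite E ltnn in ij.
have : V *m (\col_j u j) = 0.
  apply/matrixP => i j; rewrite !mxE -[RHS](us i (ltn_ord i)).
  by apply: eq_bigr => l _; rewrite !mxE mulrC.
move/(congr1 (mulmx (invmx V))); rewrite mulKmx// mulmx0 => /matrixP/(_ k ord0).
by rewrite !mxE.
Qed.
End Vandermonde.

(** * Quantitative density of the points jp + mb *)

Section Orbit.
Context {R : realType}.

Lemma floor_rep (b y u : R) : 0 < b ->
  exists m : int, u <= y + m%:~R * b < u + b.
Proof.
move=> b0; exists (- Num.floor ((y - u) / b)).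
have /andP[] := floor_itv ((y - u) / b); rewrite mulrNz ler_pdivlMr//.
by rewrite ltr_pdivrMr// intrD; lra.
Qed.

(** Pigeonhole: the residues of K + 2 multiples of p modulo b fall into K + 1 boxes of length h. Two
    residues in one box differ by less than h, and the difference is non-zero by irrationality. *)
Lemma small_combination (b p h : R) : 0 < b -> 0 < h ->
  (forall (j : nat) (m : int), (0 < j)%N -> j%:R * p + m%:~R * b != 0) ->
  exists (j : nat) (m : int), (0 < j)%N /\ 0 < `|j%:R * p + m%:~R * b| < h.
Proof.
move=> b0 h0 irr.
have [K bK] : exists K : nat, b / h < K.+1%:R.
  by exists (Num.truncn (b / h)); exact: truncnS_gt.
have mm j := floor_rep b (j%:R * p) 0 b0.
pose m j := sval (cid (mm j)).
pose fr (j : nat) := j%:R * p + (m j)%:~R * b.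
have frP j : 0 <= fr j < b by rewrite -[ltRHS]add0r; exact: svalP (cid (mm j)).
have bx j : (Num.truncn (fr j / h) < K.+1)%N.
  have /andP[f0 fb] := frP j.
  rewrite -(ltr_nat R); apply: le_lt_trans bK.
  apply: (@le_trans _ _ (fr j / h)); first by rewrite truncn_le// divr_ge0// ltW.
  by rewrite ler_pM2r ?invr_gt0// ltW.
pose box (j : 'I_K.+2) : 'I_K.+1 := Ordinal (bx j).
have : ~~ injectiveb box.
  apply/negP => /injectiveP inj; have := leq_card _ inj.
  by rewrite !card_ord ltnn.
move=> /injectivePn[i [j ij E]].
have {E} E : Num.truncn (fr i / h) = Num.truncn (fr j / h) by move/(congr1 val): E.
have cl (x y : R) : 0 <= x -> 0 <= y -> Num.truncn (x / h) = Num.truncn (y / h) ->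
    `|x - y| < h.
  move=> x0 y0 xy.
  have /andP[x1 x2] := truncn_itv (divr_ge0 x0 (ltW h0)).
  have /andP[y1 y2] := truncn_itv (divr_ge0 y0 (ltW h0)).
  move: x1 x2 y1 y2; rewrite xy ler_pdivlMr// ltr_pdivrMr// ler_pdivlMr// ltr_pdivrMr//.
  by rewrite -natr1 mulrDl mul1r => *; rewrite ltr_norml; apply/andP; split; lra.
wlog lij : i j ij E / (i < j)%N.
  move=> W; case: (ltngtP i j) => [|ji|/val_inj eij].
  - exact: W.
  - by apply: (W j i) => //; rewrite eq_sym.
  - by rewrite eij eqxx in ij.
have /andP[fi _] := frP i; have /andP[fj _] := frP j.
exists (j - i)%N, (m j - m i); rewrite subn_gt0 lij; split=> //.
have -> : (j - i)%:R * p + (m j - m i)%:~R * b = fr j - fr i.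
  by rewrite /fr natrB ?(ltnW lij)// intrB; ring.
rewrite cl// andbT normr_gt0.
have -> : fr j - fr i = (j - i)%:R * p + (m j - m i)%:~R * b.
  by rewrite /fr natrB ?(ltnW lij)// intrB; ring.
by rewrite irr// subn_gt0.
Qed.

(** The small combination d = Jp + m'b serves as step. Modulo b the start lies within b of u, so at
    most b/|d| + 1 steps are needed, whatever y and u are. As j must stay non-negative, one starts
    below u if d > 0 and above u if d < 0. *)
Lemma orbit_dense (b p h : R) : 0 < b -> 0 < h ->
  (forall (j : nat) (m : int), (0 < j)%N -> j%:R * p + m%:~R * b != 0) ->
  exists n : nat, forall y u : R, exists (j : nat) (m : int),
    (j <= n)%N /\ u <= y + j%:R * p + m%:~R * b <= u + h.
Proof.
move=> b0 h0 irr.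
have [J [mJ [J0 /andP[d0 dh]]]] := small_combination b p h b0 h0 irr.
set d := J%:R * p + mJ%:~R * b in d0 dh.
exists (J * (Num.truncn (b / `|d|)).+1)%N => y u.
have bnd t : t < b -> (Num.truncn (t / `|d|) <= Num.truncn (b / `|d|))%N.
  move=> tb; apply: le_truncn.
  by rewrite ler_pM2r ?invr_gt0// ltW.
have E (i : nat) (m : int) : y + (J * i)%N%:R * p + (m + mJ * i%:Z)%:~R * b =
   y + m%:~R * b + i%:R * d.
  by rewrite /d natrM intrD intrM /=; ring.
have [m /andP[m1 m2]] := floor_rep b y u b0.
have [dp|dn|dz] := ltgtP 0 d; last by rewrite -dz normr0 ltxx in d0.
- pose t := u - (y + (m - 1)%:~R * b).
  have t0 : 0 <= t by rewrite /t intrB; lra.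
  have tb : t <= b by rewrite /t intrB; lra.
  pose i := (Num.truncn (t / `|d|)).+1.
  exists (J * i)%N, (m - 1 + mJ * i%:Z); split.
    by rewrite leq_mul2l ltnS le_truncn ?orbT// ler_pM2r ?invr_gt0.
  rewrite E.
  have /andP[t1 t2] := truncn_itv (divr_ge0 t0 (ltW d0)).
  move: t1 t2; rewrite -/i gtr0_norm// ler_pdivlMr// ltr_pdivrMr// => t1 t2.
  rewrite gtr0_norm// in dh.
  have : i%:R * d = (Num.truncn (t / d))%:R * d + d.
    by rewrite /i gtr0_norm// -natr1 mulrDl mul1r.
  move: t1 t2; rewrite /t /i gtr0_norm//; set s := _%:R * d; set s' := _%:R * d.
  by move=> *; apply/andP; split; lra.
- pose t := y + m%:~R * b - u.
  have t0 : 0 <= t by rewrite /t; lra.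
  pose i := Num.truncn (t / `|d|).
  exists (J * i)%N, (m + mJ * i%:Z); split.
    rewrite leq_mul2l (leq_trans (bnd t _)) ?orbT//.
    by rewrite /t; lra.
  rewrite E.
  have /andP[t1 t2] := truncn_itv (divr_ge0 t0 (ltW d0)).
  move: t1 t2; rewrite -/i ltr0_norm// ler_pdivlMr ?oppr_gt0// ltr_pdivrMr ?oppr_gt0//.
  rewrite ltr0_norm// in dh; rewrite -natr1 mulrDl mul1r mulrN /t.
  by set s := _%:R * d; move=> *; apply/andP; split; lra.
Qed.
End Orbit.

(** * The cocycle inequality *)

Section Constraints.
Context {R : realType} {N : nat} (a w : 'I_N -> R[i]) (b p : R).
Hypothesis ha : forall k, a k != 0.
Hypothesis hwd : forall k l, k != l -> complex.Re (w k) != complex.Re (w l).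
Hypothesis b0 : 0 < b.
Hypothesis bp : b < p.
Hypothesis irr :
  forall (j : nat) (m : int), (0 < j)%N -> j%:R * p + m%:~R * b != 0.

Definition ev (k : 'I_N) (x : R) : R[i] := cexp ((2 * pi * x)%:C * w k).
Definition m0 (x : R) : R[i] := \sum_k a k * ev k x.

Hypothesis hm0 : forall x, 0 < x -> m0 x != 0.

Lemma evD k x y : ev k (x + y) = ev k x * ev k y.
Proof. by rewrite /ev mulrDr rmorphD mulrDl cexpD. Qed.

Lemma ev_neq0 k x : ev k x != 0. Proof. exact: cexp_neq0. Qed.

Lemma ev0 k : ev k 0 = 1.
Proof. by rewrite /ev mulr0 mul0r cexp0. Qed.

Lemma ev_natr k x s : ev k (s%:R * x) = ev k x ^+ s.
Proof.
elim: s => [|s IH]; first by rewrite mul0r ev0.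
by rewrite -natr1 mulrDl mul1r evD IH exprSr.
Qed.

Lemma ev_inj x : x != 0 -> injective (ev ^~ x).
Proof.
move=> x0 k l /(congr1 (@abs2 R)); rewrite !abs2_cexp => /expR_inj.
rewrite !Re_mul /= !mul0r !subr0 => E.
apply: contrapT => /eqP/hwd/eqP; apply.
have c0 : 2 * (2 * pi * x) != 0 by rewrite !mulf_neq0// gt_eqF// pi_gt0.
by apply: (mulfI c0); rewrite -!(mulrA 2 (2 * pi * x)).
Qed.

Lemma ep_ev k c : ep (fun y => ev k (y + c)).
Proof.
apply: ep_ext (ep_exp (ev k c) ((2 * pi)%:C * w k)) => y /=.
rewrite evD mulrC; congr (_ * _); rewrite /ev; congr cexp.
by rewrite mulrA -rmorphM (mulrC (2 * pi)).
Qed.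

Lemma ep_m0 c : ep (fun y => m0 (y + c)).
Proof. by apply: ep_sum => k; apply: epM; [exact: ep_cst|exact: ep_ev]. Qed.

Lemma m0_generic c : exists y, m0 (y + c) != 0.
Proof. by exists (1 - c); rewrite subrK hm0. Qed.

(* With h = H(y) and c_i = C(y + i p), this is S(y + j p + m b) up to a
   unimodular factor. *)
Definition functional (e : nat * int) (y : R) (h : 'I_N -> R[i]) (c : nat -> R[i]) :=
  \sum_k a k * ev k (y + e.2%:~R * b) * h k -
  \sum_(i < e.1) m0 (y + e.2%:~R * b + i%:R * p) * c i.

(** Coefficients of [functional e y] when only n values of c are kept as unknowns; nothing is lost
    as long as e.1 <= n. *)
Definition rowv n (e : nat * int) (y : R) : 'rV[R[i]]_(N + n) :=
  row_mx (\row_k (a k * ev k (y + e.2%:~R * b)))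
         (\row_(i < n) (if (i < e.1)%N then - m0 (y + e.2%:~R * b + i%:R * p) else 0)).

Definition constr n (E : seq (nat * int)) (y : R) : 'M[R[i]]_(size E, N + n) :=
  \matrix_(i < size E) rowv n (nth (0%N, 0) E i) y.

Definition hpart n (x : 'cV[R[i]]_(N + n)) (k : 'I_N) := x (lshift n k) ord0.
(** The default 0 beyond n extends the finite vector to the infinite sequence that [functional]
    expects. *)
Definition cpart n (x : 'cV[R[i]]_(N + n)) (i : nat) :=
  if insub i is Some j then x (rshift N (j : 'I_n)) ord0 else 0.

Lemma cpart_ord n (x : 'cV[R[i]]_(N + n)) (i : 'I_n) :
  cpart n x i = x (rshift N i) ord0.
Proof. by rewrite /cpart insubT//= => ilt; congr (x (rshift N _) _); exact: val_inj. Qed.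

Lemma rowvE n e y x : (e.1 <= n)%N ->
  (rowv n e y *m x) ord0 ord0 = functional e y (hpart n x) (cpart n x).
Proof.
move=> en; rewrite mxE big_split_ord /= /functional; congr (_ + _).
  by apply: eq_bigr => k _; rewrite row_mxEl mxE.
rewrite -sumrN (big_ord_widen n (fun i : nat =>
  - (m0 (y + e.2%:~R * b + i%:R * p) * cpart n x i)) en) [RHS]big_mkcond /=; apply: eq_bigr => i _.
by rewrite row_mxEr mxE cpart_ord; case: ifP => _; rewrite ?mul0r ?mulNr.
Qed.

Lemma rowv_mul n e y (x : 'cV[R[i]]_(N + n)) : (e.1 <= n)%N ->
  (rowv n e y *m x == 0) = (functional e y (hpart n x) (cpart n x) == 0).
Proof.
move=> en; rewrite -(rowvE _ _ _ _ en); apply/eqP/eqP => [->|E].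
  by rewrite mxE.
by apply/matrixP => i j; rewrite !ord1 E mxE.
Qed.

Lemma ep_rowv n e j : ep (fun y => rowv n e y ord0 j).
Proof.
case: (split_ordP j) => k ->.
- apply: (@ep_ext _ (fun y => a k * ev k (y + e.2%:~R * b))) => [y|].
    by rewrite row_mxEl mxE.
  by apply: epM; [exact: ep_cst|exact: ep_ev].
- apply: (@ep_ext _ (fun y => if (k < e.1)%N
      then - m0 (y + e.2%:~R * b + k%:R * p) else 0)) => [y|].
    by rewrite row_mxEr mxE.
  case: (k < e.1)%N; last exact: ep_cst.
  apply: epN; apply: ep_ext (ep_m0 (e.2%:~R * b + k%:R * p)) => y.
  by rewrite addrA.
Qed.

Lemma ep_constr n E i j : ep (fun y => constr n E y i j).
Proof. by apply: ep_ext (ep_rowv n (nth (0%N, 0) E i) j) => y; rewrite !mxE. Qed.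

Lemma rowv_sub n E e y : e \in E -> (rowv n e y <= constr n E y)%MS.
Proof.
move=> eE; have lt : (index e E < size E)%N by rewrite index_mem.
have <- : row (Ordinal lt) (constr n E y) = rowv n e y.
  by rewrite rowK /= nth_index.
exact: row_sub.
Qed.

Lemma constr_sub n E E' y : {subset E <= E'} -> (constr n E y <= constr n E' y)%MS.
Proof.
move=> EE; apply/row_subP => i; rewrite rowK; apply: rowv_sub; apply: EE.
exact: mem_nth.
Qed.

Lemma constr_mul0 n E y (x : 'cV[R[i]]_(N + n)) :
  (forall e, e \in E -> rowv n e y *m x = 0) <-> constr n E y *m x = 0.
Proof.
split=> [H|H e eE].
  apply/row_matrixP => i; rewrite row_mul rowK row0 H//; exact: mem_nth.
by have /submxP[D ->] := rowv_sub n E e y eE; rewrite -mulmxA H mulmx0.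
Qed.

(* A pair (j, m) in E samples S at y + jp + mb, required to lie in ]0, om[; the
   corank of the constraints is its generic value, at some other point z. *)
Definition adm om n y (E : seq (nat * int)) :=
  forall e, e \in E -> (e.1 <= n)%N /\ 0 < y + e.1%:R * p + e.2%:~R * b < om.

Definition good d om n y :=
  exists2 E, adm om n y E & exists z, (N + n <= \rank (constr n E z) + d)%N.

(** The rank is taken at a free point z, so the base point matters for admissibility only, and a
    small shift to the right is paid for by a wider window. *)
Lemma good_widen d om om' n y s : 0 <= s -> s <= om' - om ->
  good d om n y -> good d om' n (y + s).
Proof.
move=> s0 so [E aE zE]; exists E => // e /aE[en /andP[e0 e1]]; split=> //.
by apply/andP; split; lra.
Qed.

(** A row depends on y and e.2 through y + e.2 b alone, so a shift of the base point by mb is undone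
    by renumbering the constraints. *)
Lemma good_period d om n y (m : int) : good d om n (y + m%:~R * b) -> good d om n y.
Proof.
move=> [E aE [z zE]].
pose E' := [seq (e.1, e.2 + m) | e <- E].
exists E'.
  move=> _ /mapP[e eE ->] /=; have [en] := aE e eE; split=> //.
  by rewrite intrD mulrDl (addrC (e.2%:~R * b)) addrA (addrAC y (e.1%:R * p)).
exists (z - m%:~R * b); rewrite (leq_trans zE)// leq_add2r mxrankS//.
apply/row_subP => i; rewrite rowK; set e := nth _ _ _.
have -> : rowv n e z = rowv n (e.1, e.2 + m) (z - m%:~R * b).
  rewrite /rowv /= intrD (_ : z - m%:~R * b + (e.2%:~R + m%:~R) * b = z + e.2%:~R * b) //.
  ring.
by apply: rowv_sub; apply: map_f; exact: mem_nth.
Qed.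

Lemma line_point om y u : b < om -> exists m : int, u < y + m%:~R * b < u + om.
Proof.
move=> bo; have [m /andP[m1 m2]] := floor_rep b y (u + (om - b) / 2) b0.
by exists m; apply/andP; split; lra.
Qed.

(** The new unknown C(y + np) is invisible to the old constraints, whereas (n + 1, m) contains it
    with coefficient -m0, which is generically non-zero. Rank and number of unknowns both grow by
    one. *)
Lemma good_right d om n y : b < om -> good d om n y -> good d om n.+1 y.
Proof.
move=> bo [E aE [z zE]].
have [m mP] := line_point om (y + n.+1%:R * p) 0 bo; rewrite add0r in mP.
(* Right multiplication by [T] appends a zero column for the new unknown. *)
pose T : 'M[R[i]]_(N + n, N + n.+1) := pid_mx (N + n).
have TE E0 z0 : (forall e, e \in E0 -> (e.1 <= n)%N) ->
    constr n.+1 E0 z0 = constr n E0 z0 *m T.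
  move=> E0n; apply/row_matrixP => i; rewrite row_mul !rowK; set e := nth _ _ _.
  have en : (e.1 <= n)%N by apply: E0n; exact: mem_nth.
  apply/rowP => j; rewrite [RHS]mxE.
  have val_small (l : 'I_(N + n)) : (l < N + n)%N by [].
  case: (split_ordP j) => k ->.
    rewrite (bigD1 (lshift n k))//= big1 => [|l lk].
      by rewrite addr0 !row_mxEl !mxE /= eqxx ltn_addr// mulr1.
    rewrite [T _ _]mxE; case: eqP => [lk'|]; last by rewrite mulr0.
    by move/eqP: lk; case; apply: val_inj; rewrite /= lk'.
  rewrite row_mxEr mxE; case: (ltnP k n) => kn.
    rewrite (bigD1 (rshift N (Ordinal kn)))//= big1 => [|l lk].
      by rewrite addr0 row_mxEr !mxE /= eqxx ltn_add2l kn mulr1.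
    rewrite [T _ _]mxE; case: eqP => [lk'|]; last by rewrite mulr0.
    by move/eqP: lk; case; apply: val_inj; rewrite /= lk'.
  rewrite ltnNge (leq_trans en kn) /= big1// => l _.
  rewrite [T _ _]mxE; case: eqP => [lk'|]; last by rewrite mulr0.
  by have := val_small l; rewrite lk' /= ltn_add2l ltnNge kn.
have Tfree : row_free T by rewrite /row_free rank_pid_mx// ?leq_add2l.
have En e : e \in E -> (e.1 <= n)%N by case/aE.
have [f [ef fz fP]] := rank_generic _ _ _ _ z (ep_constr n E) (leqnn _).
have [u] := ep_mul_neq0 _ _ ef (ep_m0 (m%:~R * b + n%:R * p)) (ex_intro _ z fz) (m0_generic _).
rewrite mulf_eq0 negb_or => /andP[/fP fu mu].
exists ((n.+1, m) :: E).
  move=> e; rewrite inE => /orP[/eqP->|/aE[en eP]]; first by split.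
  by split=> //; rewrite leqW.
exists u.
suff : (\rank (constr n E u) < \rank (constr n.+1 ((n.+1, m) :: E) u))%N.
  move=> lt; apply: leq_trans (_ : (N + n).+1 <= _)%N; first by rewrite addnS.
  by rewrite (leq_ltn_trans zE)// ltn_add2r (leq_ltn_trans fu).
rewrite -(mxrankMfree _ Tfree) -TE//.
pose x : 'cV[R[i]]_(N + n.+1) := delta_mx (rshift N ord_max) ord0.
have xk (i : 'I_N) : hpart _ x i = 0 by rewrite /hpart mxE eq_lrshift.
have xc i : cpart _ x i = (i == n)%:R.
  rewrite /cpart; case: insubP => [j jn <-|].
    by rewrite mxE eq_rshift andbT -val_eqE /=.
  by rewrite ltnS -ltnNge => /gtn_eqF ->.
apply: (@rank_lt _ _ _ _ _ _ (rowv n.+1 (n.+1, m) u) x).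
- by apply: constr_sub => e eE; rewrite inE eE orbT.
- by apply: rowv_sub; rewrite mem_head.
- apply/constr_mul0 => e eE; apply/eqP; rewrite rowv_mul ?leqW ?En// /functional.
  rewrite !big1 ?subr0// => i _; rewrite ?xk ?mulr0// xc ltn_eqF ?mulr0//.
  exact: leq_trans (ltn_ord i) (En _ eE).
- rewrite rowv_mul// /functional /= big1 => [|i _]; last by rewrite xk mulr0.
  rewrite big_ord_recr/= big1 => [|i _]; last by rewrite xc ltn_eqF ?mulr0.
  by rewrite xc eqxx mulr1 !add0r oppr_eq0 -addrA.
Qed.

(** Moving the base point from y + p back to y makes C(y) a new first unknown. The old constraints
    are pulled back along H_k(y + p) = (H_k(y) - C(y)) / q_k; the kernel of this substitution is a
    line, on which a constraint (0, m) takes a multiple of a generically non-zero value of m0. *)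
Lemma good_left d om n y : b < om -> good d om n (y + p) -> good d om n.+1 y.
Proof.
move=> bo [E aE [z zE]].
have [m mP] := line_point om y 0 bo; rewrite add0r in mP.
pose E' := [seq (e.1.+1, e.2) | e <- E].
pose q k := ev k p.
have q0 k : q k != 0 by exact: ev_neq0.
(* [T] sends (H(y), C(y), C(y + p), ...) to (H(y + p), C(y + p), ...), and [T'] is a right
   inverse. *)
pose T : 'M[R[i]]_(N + n, N + n.+1) :=
  block_mx (\matrix_(k < N, l < N) ((q k)^-1 *+ (k == l)))
           (\matrix_(k < N, i < n.+1) (- (q k)^-1 *+ (i == 0 :> nat)))
           0 (\matrix_(i < n, i' < n.+1) ((i' == i.+1 :> nat)%:R)).
pose T' : 'M[R[i]]_(N + n.+1, N + n) :=
  block_mx (\matrix_(k < N, l < N) ((q k) *+ (k == l))) 0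
           0 (\matrix_(i' < n.+1, i < n) ((i' == i.+1 :> nat)%:R)).
have TT : T *m T' = 1%:M.
  rewrite mulmx_block !mulmx0 !mul0mx !addr0 !add0r -[RHS](@submxK _ N n N n).
  congr block_mx; apply/matrixP => i j; rewrite ?mxE.
  - rewrite (bigD1 i)//= !mxE eqxx big1 => [|l li]; last first.
      by rewrite !mxE eq_sym (negbTE li) mul0r.
    rewrite addr0 mulr1n eq_lshift; case: eqP => [->|]; last by rewrite mulr0.
    by rewrite mulVf.
  - by rewrite eq_lrshift big1// => l _; rewrite !mxE; case: (l : nat) => [|l']; rewrite ?mulr0 ?mul0r.
  - by rewrite eq_rlshift.
  - have si : (i.+1 < n.+1)%N by rewrite ltnS.
    rewrite (bigD1 (Ordinal si))//= !mxE eqxx big1 => [|l li]; last first.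
      by rewrite !mxE -val_eqE /= in li *; rewrite (negbTE li) mul0r.
    by rewrite addr0 mul1r eqSS eq_rshift.
have Tfree : row_free T by apply/row_freeP; exists T'.
have Tfun e v (x : 'cV[R[i]]_(N + n.+1)) : (e.1 <= n)%N ->
   rowv n e (v + p) *m (T *m x) = rowv n.+1 (e.1.+1, e.2) v *m x.
  move=> en; apply/matrixP => i j; rewrite !ord1 !rowvE//.
  have hT k : hpart n (T *m x) k = (q k)^-1 * (hpart _ x k - cpart _ x 0).
    rewrite /hpart mxE big_split_ord /= (bigD1 k)//= big1 => [|l lk]; last first.
      by rewrite block_mxEul mxE eq_sym (negbTE lk) mul0r.
    rewrite block_mxEul mxE eqxx mulr1n addr0 mulrBr; congr (_ + _).
    rewrite big_ord_recl big1 => [|l _]; last by rewrite block_mxEur mxE mul0r.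
    by rewrite block_mxEur mxE mulr1n addr0 mulNr (cpart_ord n.+1 x ord0).
  have cT l : (l < n)%N -> cpart n (T *m x) l = cpart _ x l.+1.
    move=> ln; rewrite (cpart_ord n _ (Ordinal ln)).
    have sl : (l.+1 < n.+1)%N by [].
    rewrite mxE big_split_ord /= big1 ?add0r => [|k _]; last first.
      by rewrite block_mxEdl mxE mul0r.
    rewrite (bigD1 (Ordinal sl))//= big1 => [|l' ll]; last first.
      by rewrite block_mxEdr mxE -val_eqE /= in ll *; rewrite (negbTE ll) mul0r.
    by rewrite block_mxEdr mxE eqxx mul1r addr0 (cpart_ord n.+1 x (Ordinal sl)).
  rewrite /functional /= big_ord_recl /= mul0r addr0 opprD addrA; congr (_ - _).
    have -> : m0 (v + e.2%:~R * b) * cpart n.+1 x 0 =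
       \sum_k a k * ev k (v + e.2%:~R * b) * cpart n.+1 x 0 by rewrite mulr_suml.
    rewrite -sumrB; apply: eq_bigr => k _; rewrite hT -mulrBr.
    rewrite (_ : v + p + e.2%:~R * b = v + e.2%:~R * b + p); last by ring.
    have gen (s t u v0 : R[i]) : u != 0 -> s * (t * u) * (u^-1 * v0) = s * t * v0.
      by move=> u0; field.
    by rewrite evD (gen (a k) _ (q k)) ?q0.
  apply: eq_bigr => l _; rewrite cT ?(leq_trans (ltn_ord l) en)//.
  congr (m0 _ * _); rewrite /bump /= natrD; ring.
have TE v (x : 'cV[R[i]]_(N + n.+1)) : constr n E (v + p) *m (T *m x) = 0 ->
    constr n.+1 E' v *m x = 0.
  move/constr_mul0 => H; apply/constr_mul0 => _ /mapP[e eE ->].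
  by rewrite -Tfun ?H//; case: (aE e eE).
have Tsub v : (constr n E (v + p) *m T <= constr n.+1 E' v)%MS.
  apply/row_subP => i; rewrite row_mul rowK; set e := nth _ _ _.
  have eE : e \in E by exact: mem_nth.
  have -> : rowv n e (v + p) *m T = rowv n.+1 (e.1.+1, e.2) v.
    apply/rowP => j; have := Tfun e v (delta_mx j ord0) (aE e eE).1.
    rewrite mulmxA => /matrixP/(_ ord0 ord0).
    by rewrite -!colE !mxE => ->.
  by apply: rowv_sub; apply/mapP; exists e.
have efs : forall i j, ep (fun v => constr n E (v + p) i j).
  by move=> i j; apply: (@ep_shift _ (fun y => constr n E y i j)); exact: ep_constr.
have zz : (\rank (constr n E z) <= \rank (constr n E (z - p + p)))%N by rewrite subrK.
have [f [ef fz fP]] := rank_generic _ _ _ _ _ efs zz.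
have [u] := ep_mul_neq0 _ _ ef (ep_m0 (m%:~R * b)) (ex_intro _ (z - p) fz) (m0_generic _).
rewrite mulf_eq0 negb_or => /andP[/fP fu mu].
exists ((0%N, m) :: E').
  move=> e; rewrite inE => /orP[/eqP->|/mapP[e' /aE[en eP] ->]].
    by rewrite /= mul0r addr0.
  split=> //=; rewrite (_ : y + _ * p = y + p + e'.1%:R * p)//.
  by rewrite -natr1; ring.
exists u.
suff : (\rank (constr n E (u + p)) < \rank (constr n.+1 ((0%N, m) :: E') u))%N.
  move=> lt; apply: leq_trans (_ : (N + n).+1 <= _)%N; first by rewrite addnS.
  by rewrite (leq_ltn_trans zE)// ltn_add2r (leq_ltn_trans fu).
rewrite -(mxrankMfree _ Tfree).
(* All H_k(y) equal to C(y) = 1 and all later C equal to 0: everything vanishes from y + p on. *)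
pose x : 'cV[R[i]]_(N + n.+1) := col_mx (const_mx 1) (delta_mx ord0 ord0).
have Tx : T *m x = 0.
  rewrite mul_block_col mul0mx add0r -[RHS]vsubmxK; congr col_mx.
  - apply/matrixP => i j; rewrite !mxE (bigD1 i)//= big1 => [|l li]; last first.
      by rewrite !mxE eq_sym (negbTE li) mul0r.
    rewrite big_ord_recl big1 => [|l _]; last by rewrite !mxE mul0r.
    by rewrite !mxE !ord1 eqxx /= !mulr1n !mulr1 !addr0 subrr.
  - apply/matrixP => i j; rewrite !mxE big_ord_recl big1 => [|l _].
      by rewrite !mxE mul0r addr0.
    by rewrite !mxE mulr0.
apply: (@rank_lt _ _ _ _ _ _ (rowv n.+1 (0%N, m) u) x).
- apply: submx_trans (Tsub u) _; apply: constr_sub => e eE.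
  by rewrite inE eE orbT.
- by apply: rowv_sub; rewrite mem_head.
- by rewrite -mulmxA Tx mulmx0.
- rewrite rowv_mul// /functional /= big_ord0 subr0.
  have -> : \sum_k a k * ev k (u + m%:~R * b) * hpart n.+1 x k = m0 (u + m%:~R * b).
    by apply: eq_bigr => k _; rewrite /hpart col_mxEu mxE mulr1.
  exact: mu.
Qed.

Lemma good_mono_n d om n n' y : b < om -> (n <= n')%N -> good d om n y -> good d om n' y.
Proof.
move=> bo /subnK <-; elim: (n' - n)%N => // k IH /IH; exact: good_right.
Qed.

Lemma good_left_iter d om n j y : b < om -> good d om n (y + j%:R * p) ->
  good d om (j + n) y.
Proof.
move=> bo; elim: j y => [|j IH] y; first by rewrite mul0r addr0.
rewrite (_ : y + _ = y + p + j%:R * p); last by rewrite -natr1; ring.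
by move=> /IH; rewrite addSn; exact: good_left.
Qed.

(** By density, some y' + jp + mb lies just to the right of y, by at most om' - om, which the wider
    window absorbs. The multiple of b is free and the j steps back to y' increase n by j; j is
    bounded uniformly, so one n' serves every y'. *)
Lemma good_everywhere d om om' n y : b < om -> om < om' -> good d om n y ->
  exists n', forall y', good d om' n' y'.
Proof.
move=> bo oo g; have bo' := lt_trans bo oo.
have [n1 n1P] := orbit_dense b p (om' - om) b0 ltac:(by rewrite subr_gt0) irr.
exists (n1 + n)%N => y'; have [j [m [jn /andP[m1 m2]]]] := n1P y' y.
apply: (@good_mono_n _ _ (j + n)) => //; first by rewrite leq_add2r.
apply: good_left_iter => //; apply: (@good_period _ _ _ _ m).
rewrite (_ : y' + _ + _ = y + (y' + j%:R * p + m%:~R * b - y)); last by ring.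
by apply: good_widen g; lra.
Qed.

(** The forms at y - b, ..., y - Nb contain no C and give a Vandermonde system in the numbers
    ev_k(-b), distinct because the Re w_k are. Once h = 0, the forms (i + 1, m i) are triangular in
    c with non-zero diagonal -m0. *)
Lemma ladder_kernel n y (x : 'cV[R[i]]_(N + n)) (m : nat -> int) :
  (forall s, (s < N)%N -> functional (0%N, - s.+1%:Z) y (hpart n x) (cpart n x) = 0) ->
  (forall i, (i < n)%N -> functional (i.+1, m i) y (hpart n x) (cpart n x) = 0) ->
  (forall i, (i < n)%N -> m0 (y + (m i)%:~R * b + i%:R * p) != 0) -> x = 0.
Proof.
move=> H0 H1 mn0.
have h0 k : hpart n x k = 0.
  have bn0 : - b != 0 by rewrite oppr_eq0 gt_eqF.
  have := @power_sums_eq0 _ N (ev ^~ (- b))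
    (fun k => a k * ev k (y - b) * hpart n x k) (ev_inj (- b) bn0).
  move=> /(_ _ k) E; apply/eqP.
  suff /eqP : a k * ev k (y - b) * hpart n x k = 0.
    by rewrite mulf_eq0 => /orP[|//]; rewrite mulf_eq0 (negbTE (ha k)) (negbTE (ev_neq0 _ _)).
  apply: E => s sN; rewrite -[RHS](H0 s sN) /functional /= big_ord0 subr0.
  apply: eq_bigr => l _.
  have -> : ev l (y + (- s.+1%:Z)%:~R * b) = ev l (y - b) * ev l (- b) ^+ s.
    rewrite -ev_natr -evD; congr ev.
    by rewrite mulrNz -pmulrn -natr1; ring.
  by rewrite [a l * (_ * _)]mulrA mulrAC.
have c0 i : cpart n x i = 0.
  have [k] := ubnP i; elim: k i => // k IH i; rewrite ltnS => ik.
  case: (ltnP i n) => [ilt|ige]; last by rewrite /cpart insubF// ltnNge ige.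
  have := H1 i ilt; rewrite /functional /= big1 => [|l _]; last by rewrite h0 mulr0.
  rewrite big_ord_recr /= big1 => [|l _]; last first.
    by rewrite IH ?mulr0// (leq_trans (ltn_ord l)).
  rewrite !add0r => /eqP; rewrite oppr_eq0 mulf_eq0 (negbTE (mn0 i ilt)).
  by move/eqP.
apply/matrixP => i j; rewrite !ord1 mxE; case: (split_ordP i) => k ->.
  exact: h0.
by rewrite -cpart_ord.
Qed.

(** If the form e did not vanish on x, adding e to E would raise the rank at y, and the enlarged set
    would witness a corank smaller than d. *)
Lemma kernel_extend d om n y0 y E (x : 'cV[R[i]]_(N + n)) e :
  (forall d', (d' < d)%N -> ~ good d' om n y0) ->
  adm om n y0 E -> adm om n y0 [:: e] -> (N + n <= \rank (constr n E y) + d)%N ->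
  constr n E y *m x = 0 -> rowv n e y *m x = 0.
Proof.
move=> md aE ae rE Ex; apply/eqP; apply: contrapT => /negP ex.
have lt : (\rank (constr n E y) < \rank (constr n (e :: E) y))%N.
  apply: (@rank_lt _ _ _ _ _ _ (rowv n e y) x) => //.
    by apply: constr_sub => f fE; rewrite inE fE orbT.
  by apply: rowv_sub; rewrite mem_head.
have aeE : adm om n y0 (e :: E).
  by move=> f; rewrite inE => /orP[/eqP->|/aE//]; apply: ae; rewrite mem_head.
case: d md rE => [|d] md rE.
  by have := rank_leq_col (constr n (e :: E) y); move: rE lt; lia.
apply: (md d) => //; exists (e :: E) => //; exists y.
by move: rE lt; lia.
Qed.

(* Constraint sets of minimal corank span the same row space for neighbouring
   base points; sliding the base point along the line reaches every constraint. *)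
Lemma good0 : exists om n y0, [/\ b < om, om < p & good 0 om n y0].
Proof.
have b_gt0 := b0; have ltbp := bp.
pose P d := `[< exists om n y0, [/\ b < om, om < p & good d om n y0] >].
have exP : exists d, P d.
  exists N; apply/asboolP; exists ((b + p) / 2), 0%N, 0; split; [lra|lra|].
  by exists [::] => //; exists 0; lia.
have [d /asboolP[om1 [n1 [y1 [bo1 o1p g1]]]] dmin] := ex_minnP exP.
have {}dmin d' om n y : b < om -> om < p -> (d' < d)%N -> ~ good d' om n y.
  move=> bo op dd g; have := dmin d'; rewrite leqNgt dd => /(_ _)/negP; apply=> //.
  by apply/asboolP; exists om, n, y.
(* A third of the gap leaves room for two widenings om1 < om2 < om3 below p: one so that every base
   point is good, one for sliding by h. *)
pose h := Num.min b ((p - om1) / 3).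
have h0 : 0 < h by rewrite lt_min b0 /=; lra.
have hb : h <= b by rewrite ge_min lexx.
have hp : h <= (p - om1) / 3 by rewrite ge_min lexx orbT.
pose om2 := om1 + h; pose om3 := om2 + h.
have o12 : om1 < om2 by rewrite /om2; lra.
have o23 : om2 < om3 by rewrite /om3; lra.
have o3p : om3 < p by rewrite /om3 /om2; lra.
have [n nP] := good_everywhere d om1 om2 n1 y1 bo1 o12 g1.
pose yi (i : nat) : R := i%:R * h.
have EP i : exists E, adm om2 n (yi i) E /\ exists z, (N + n <= \rank (constr n E z) + d)%N.
  by have [E aE zE] := nP (yi i); exists E.
pose E i := sval (cid (EP i)).
have aE i : adm om2 n (yi i) (E i) by case: (svalP (cid (EP i))).
have fE i : exists f, [/\ ep f, (exists z, f z != 0) &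
    forall y, f y != 0 -> (N + n <= \rank (constr n (E i) y) + d)%N].
  have [_ [z zE]] := svalP (cid (EP i)).
  rewrite -/(E i) in zE.
  have [f [ef fz fP]] := rank_generic _ _ _ _ z (ep_constr n (E i)) (leqnn _).
  exists f; split; [exact: ef|by exists z|].
  by move=> y /fP; rewrite -(leq_add2r d); exact: leq_trans.
pose f i := sval (cid (fE i)).
have fP i := svalP (cid (fE i)).
have lp i : exists m : int, 0 < h + i.+1%:R * p + m%:~R * b < 0 + om3.
  by apply: line_point; lra.
pose m i := sval (cid (lp i)).
have mP i : 0 < h + i.+1%:R * p + (m i)%:~R * b < om3.
  by have := svalP (cid (lp i)); rewrite -/(m i) add0r.
(* The base points 0, h, ..., Ih reach beyond Nb, as far as the constraints (0, -(s + 1)) with s < N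
   require. *)
pose I := (Num.truncn (N%:R * b / h)).+1.
pose F (s : nat + nat) : R -> R[i] :=
  match s with inl i => f i | inr i => fun y => m0 (y + ((m i)%:~R * b + i%:R * p)) end.
(* A single y that is generic for finitely many conditions at once: the ranks of E 0, ..., E I and
   the diagonal values of m0 in the triangular system. *)
have [y yP] : exists y, \prod_(s <- [seq inl i | i <- iota 0 I.+1] ++
    [seq inr i | i <- iota 0 n]) F s y != 0.
  apply: ep_prod_neq0 => [[i|i]|[i|i]].
  - by have [] := fP i.
  - exact: ep_m0.
  - by have [] := fP i.
  - exact: m0_generic.
move: yP; rewrite prodf_seq_neq0 => /allP yP.
have fy i : (i <= I)%N -> (N + n <= \rank (constr n (E i) y) + d)%N.
  move=> iI; have [_ _] := fP i; apply; apply: (yP (inl i)).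
  by rewrite mem_cat map_f// mem_iota.
have my i : (i < n)%N -> m0 (y + (m i)%:~R * b + i%:R * p) != 0.
  move=> ilt; rewrite -addrA; apply: (yP (inr i)).
  by rewrite mem_cat [X in _ || X]map_f ?orbT// mem_iota.
have yiS i : yi i.+1 = yi i + h by rewrite /yi -natr1 mulrDl mul1r.
have ext i e (x : 'cV_(N + n)) : (i <= I)%N -> adm om3 n (yi i.+1) [:: e] ->
    constr n (E i) y *m x = 0 -> rowv n e y *m x = 0.
  move=> iI ae; apply: (@kernel_extend d om3 n (yi i.+1)) => //.
  - by move=> d'; apply: dmin => //; lra.
  - move=> e' /aE[en /andP[e1 e2]]; rewrite yiS; split=> //.
    by rewrite /om3; apply/andP; split; lra.
  - exact: fy.
(* In the window om3 the sets E i and E (i + 1) are admissible at the common base point (i + 1)h, so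
   by minimality the second adds nothing to the row space of the first. *)
have slide i (x : 'cV_(N + n)) : (i <= I)%N -> constr n (E 0) y *m x = 0 ->
    constr n (E i) y *m x = 0.
  move=> iI Ex; elim: i iI => // i IH iI; apply/constr_mul0 => e eE.
  apply: (ext i) => //; [exact: ltnW| |by apply: IH; exact: ltnW].
  move=> e'; rewrite inE => /eqP ->; have [en /andP[e1 e2]] := aE _ _ eE.
  by split=> //; rewrite /om3; apply/andP; split; lra.
have ker0 (x : 'cV_(N + n)) : constr n (E 0) y *m x = 0 -> x = 0.
  move=> Ex; apply: (@ladder_kernel _ y _ m) => //.
  - move=> s sN; apply/eqP; rewrite -rowv_mul//; apply/eqP.
    pose i := Num.truncn (s.+1%:R * b / h).
    have iI : (i <= I)%N.
      rewrite leqW// le_truncn// ler_pM2r ?invr_gt0// ler_pM2r// ler_nat//.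
    apply: (ext i) => //; last exact: slide.
    move=> e; rewrite inE => /eqP -> /=; split=> //.
    have /andP[] := truncn_itv (divr_ge0 (mulr_ge0 (ler0n R s.+1) (ltW b0)) (ltW h0)).
    rewrite -/i ler_pdivlMr// ltr_pdivrMr// mul0r addr0 mulrNz -pmulrn /yi.
    move=> i1 i2; apply/andP; split; first by lra.
    by move: i1 i2; rewrite -(natr1 i) /om3 /om2; lra.
  - move=> i ilt; apply/eqP; rewrite -rowv_mul//; apply/eqP.
    apply: (ext 0%N) => // e; rewrite inE => /eqP -> /=; split=> //.
    by rewrite yiS {1 2}/yi mul0r add0r; exact: mP.
exists om2, n, (yi 0); split; [lra|lra|].
exists (E 0%N) => //; exists y; rewrite addn0.
rewrite -[X in (_ <= X)%N]mxrank_tr leqNgt; apply/negP => lt.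
have : kermx (constr n (E 0%N) y)^T != 0.
  by rewrite -mxrank_eq0 -lt0n mxrank_ker subn_gt0.
case/rowV0Pn => v /sub_kermxP vE /negP; apply; rewrite -trmx_eq0; apply/eqP.
by apply: ker0; rewrite -[constr _ _ _]trmxK -trmx_mul vE trmx0.
Qed.

Lemma ep_ubound_fin (I : finType) (F : I -> R -> R[i]) u v : (forall i, ep (F i)) ->
  u <= v -> exists2 K, 0 < K & forall i y, u <= y <= v -> abs2 (F i y) <= K.
Proof.
move=> eF uv.
have bK i : exists K, 0 < K /\ forall y, u <= y <= v -> abs2 (F i y) <= K.
  by have [K K0 KP] := ep_ubound _ _ _ (eF i) uv; exists K.
pose K i := sval (cid (bK i)).
have K0 i : 0 < K i by case: (svalP (cid (bK i))).
have KP i y : u <= y <= v -> abs2 (F i y) <= K i.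
  by case: (svalP (cid (bK i))) => _; exact.
exists (1 + \sum_i K i).
  by rewrite ltr_pwDl// sumr_ge0// => i _; exact: ltW.
move=> i y yuv; rewrite (le_trans (KP i y yuv))// (bigD1 i)//= addrCA lerDl.
by rewrite addr_ge0// sumr_ge0// => j _; exact: ltW.
Qed.

Lemma ep_adj m (F : R -> 'M[R[i]]_m) :
  (forall i j, ep (fun y => F y i j)) -> forall i j, ep (fun y => (\adj (F y)) i j).
Proof.
move=> eF i j; apply: (@ep_ext _ (fun y => cofactor (F y) j i)) => [y|]; first by rewrite mxE.
apply: epM; first exact: ep_cst.
by apply: ep_det => k l; apply: ep_ext (eF (lift j k) (lift i l)) => y; rewrite !mxE.
Qed.

(** At one generic point the constraint matrix has a left inverse; in a neighbourhood Cramer's rule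
    expresses h by the values of the forms, with bounded coefficients. *)
Lemma local_bound : exists (u v K : R) (n : nat), [/\ u < v, 0 < K &
  forall y h c B, u <= y <= v -> 0 <= B ->
  (forall e, (e.1 <= n)%N -> 0 < y + e.1%:R * p + e.2%:~R * b < p ->
     abs2 (functional e y h c) <= B) ->
  forall k, abs2 (h k) <= K * B].
Proof.
have [om [n [y0 [bo op [E aE [z]]]]]] := good0; rewrite addn0 => rE.
have [f [ef fz fP]] := rank_generic _ _ _ _ z (ep_constr n E) rE.
(* Between y0 and y0 + (p - om) the samples leave ]0, om[ but remain in ]0, p[, so z0 can serve both
   as base point and as the point where the rank is full. *)
have [|z0 /andP[z1 z2] fz0] := ep_neq0_itv _ y0 (y0 + (p - om)) ef _ (ex_intro _ z fz); first by lra.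
set A := constr n E z0.
have fullA : row_full A by rewrite -col_leq_rank; exact: fP.
(* A square matrix equal to the identity at z0; its determinant stays away from 0 nearby. *)
pose F y := pinvmx A *m constr n E y.
have eF : forall i j, ep (fun y => F y i j).
  by apply: ep_mulmx => [i j|]; [exact: ep_cst|exact: ep_constr].
have Fz0 : \det (F z0) != 0 by rewrite /F mulVpmx// det1 oner_eq0.
have [e e0 eP] := ep_neq0_near _ z0 (ep_det _ _ eF) Fz0.
pose e1 := Num.min e (Num.min (z0 - y0) (y0 + (p - om) - z0)).
have e10 : 0 < e1 by rewrite !lt_min e0 /=; apply/andP; split; lra.
have e1e : e1 <= e by rewrite ge_min lexx.
have e1z : e1 <= z0 - y0 by rewrite !ge_min lexx !orbT.
have e1o : e1 <= y0 + (p - om) - z0 by rewrite !ge_min lexx !orbT.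
have uv : z0 - e1 <= z0 + e1 by lra.
have [d d0 dP] := ep_lbound _ (z0 - e1) (z0 + e1) (ep_det _ _ eF) uv ltac:(
  by move=> y /andP[y1 y2]; apply: eP; apply/andP; split; lra).
pose G y := \adj (F y) *m pinvmx A.
have eG : forall i j, ep (fun y => G y i j).
  by apply: ep_mulmx => [|i j]; [exact: ep_adj|exact: ep_cst].
have [K K0 KP] := ep_ubound_fin ('I_(N + n) * 'I_(size E))%type
  (fun ij y => G y ij.1 ij.2) (z0 - e1) (z0 + e1) (fun ij => eG ij.1 ij.2) uv.
(* The factor 1/d pays for dividing by the determinant. One [size E] comes from Cauchy-Schwarz and
   one counts the terms; the added 1 keeps the constant positive if E is empty. *)
exists (z0 - e1), (z0 + e1), (d^-1 * ((size E)%:R * ((size E)%:R * K) + 1)), n; split.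
- by lra.
- by rewrite mulr_gt0 ?invr_gt0// ltr_wpDl// !mulr_ge0 ?ler0n ?ltW.
move=> y h c B /[dup] yuv /andP[yu yv] B0 HB k.
have mem i : nth (0%N, 0) E (i : 'I_(size E)) \in E by exact: mem_nth.
have Hadm e' : e' \in E -> (e'.1 <= n)%N /\ 0 < y + e'.1%:R * p + e'.2%:~R * b < p.
  by move=> /aE[en /andP[e2 e3]]; split=> //; apply/andP; split; lra.
pose x : 'cV[R[i]]_(N + n) := col_mx (\col_i h i) (\col_(i < n) c i).
have xh : hpart n x = h by apply/funext => i; rewrite /hpart col_mxEu mxE.
have xc i : (i < n)%N -> cpart n x i = c i.
  by move=> ilt; rewrite (cpart_ord n x (Ordinal ilt)) col_mxEd mxE.
pose s := constr n E y *m x.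
have sE i : s i ord0 = functional (nth (0%N, 0) E i) y h c.
  have [en _] := Hadm _ (mem i).
  have -> : s i ord0 = (rowv n (nth (0%N, 0) E i) y *m x) ord0 ord0.
    by rewrite /s [LHS]mxE [RHS]mxE; apply: eq_bigr => l _; rewrite [constr _ _ _ _ _]mxE.
  rewrite rowvE// xh /functional; congr (_ - _); apply: eq_bigr => l _.
  by rewrite xc// (leq_trans (ltn_ord l) en).
have fx : \det (F y) *: x = G y *m s.
  by rewrite /G /s -mulmxA [pinvmx A *m _]mulmxA -/(F y) mulmxA mul_adj_mx mul_scalar_mx.
have hk : h k = x (lshift n k) ord0 by rewrite col_mxEu mxE.
have det0 : \det (F y) != 0 by apply: eP; apply/andP; split; lra.
have dd : d <= abs2 (\det (F y)) by exact: dP.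
have : abs2 (\det (F y) * h k) <= (size E)%:R * ((size E)%:R * K) * B.
  have -> : \det (F y) * h k = \sum_i G y (lshift n k) i * s i ord0.
    by rewrite hk; have /matrixP/(_ (lshift n k) ord0) := fx; rewrite !mxE.
  rewrite (le_trans (abs2_sum_ord_le _ _))// -!mulrA ler_wpM2l//.
  rewrite (@le_trans _ _ (\sum_(i < size E) K * B))//.
    apply: ler_sum => i _; rewrite abs2M ler_pM ?abs2_ge0//.
      exact: (KP (lshift n k, i)).
    by rewrite sE; have [en ep'] := Hadm _ (mem i); apply: HB.
  by rewrite sumr_const card_ord -[X in X <= _]mulr_natl.
rewrite abs2M => H; rewrite -mulrA ler_pdivlMl// (le_trans _ (le_trans H _))//.
  by rewrite ler_wpM2r ?abs2_ge0.
by rewrite mulrDl mul1r lerDl.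
Qed.

(** * Coercivity for abstract cocycles *)

Section Cocycle.
Variables (H : R -> 'I_N -> R[i]) (C : R -> R[i]) (tau : R[i]).

(** All that the estimate uses of H and C. Constants chosen before H, C and tau are automatically
    uniform in the offset t and in the sequence. *)
Definition cocycle := [/\ abs2 tau = 1, forall y k, H (y + b) k = tau * H y k,
  forall y, C (y + b) = tau * C y & forall y k, H y k - ev k p * H (y + p) k = C y].

Definition Ssum (x : R) := \sum_k a k * ev k x * H x k.

Hypothesis HC : cocycle.

Lemma quasi_periodic (m : int) : exists u, [/\ abs2 u = 1,
  forall y k, H (y + m%:~R * b) k = u * H y k & forall y, C (y + m%:~R * b) = u * C y].
Proof.
have [t1 Hb Cb _] := HC.
have t0 : tau != 0 by rewrite -abs2_gt0 t1.
have nat_case (n : nat) : exists u, [/\ abs2 u = 1,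
  forall y k, H (y + n%:R * b) k = u * H y k & forall y, C (y + n%:R * b) = u * C y].
  elim: n => [|n [u [u1 uH uC]]].
    by exists 1; rewrite abs2_1; split=> // y => [k|]; rewrite mul0r addr0 mul1r.
  exists (tau * u); rewrite abs2M t1 u1 mulr1; split=> // y => [k|].
    by rewrite -natr1 mulrDl mul1r addrA Hb uH mulrA.
  by rewrite -natr1 mulrDl mul1r addrA Cb uC mulrA.
case: m => n; first exact: nat_case.
have [u [u1 uH uC]] := nat_case n.+1.
have u0 : u != 0 by rewrite -abs2_gt0 u1.
exists u^-1; rewrite abs2V u1 invr1; split=> // y => [k|].
  apply: (mulfI u0); rewrite -uH mulrA divff// mul1r; congr (H _ k).
  by rewrite NegzE mulrNz -pmulrn; ring.
apply: (mulfI u0); rewrite -uC mulrA divff// mul1r; congr C.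
by rewrite NegzE mulrNz -pmulrn; ring.
Qed.

Lemma H_iter y k j : ev k (j%:R * p) * H (y + j%:R * p) k =
  H y k - \sum_(i < j) ev k (i%:R * p) * C (y + i%:R * p).
Proof.
have [_ _ _ HCp] := HC.
elim: j => [|j IH]; first by rewrite mul0r ev0 mul1r addr0 big_ord0 subr0.
rewrite big_ord_recr /= opprD addrA -IH -natr1 mulrDl mul1r evD.
have -> : y + (j%:R * p + p) = y + j%:R * p + p by rewrite addrA.
rewrite -(HCp (y + j%:R * p) k).
set e1 := ev k (j%:R * p); set e2 := ev k p; ring.
Qed.

Lemma abs2_functional e y : abs2 (functional e y (H y) (fun i => C (y + i%:R * p))) =
  abs2 (Ssum (y + e.1%:R * p + e.2%:~R * b)).
Proof.
have [u [u1 uH _]] := quasi_periodic e.2.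
rewrite -[LHS]mul1r -[X in X * _ = _]u1 -abs2M; congr abs2.
rewrite /functional /Ssum /= mulrBr mulr_sumr.
have -> : \sum_(i < e.1) m0 (y + e.2%:~R * b + i%:R * p) * C (y + i%:R * p) =
  \sum_k a k * ev k (y + e.2%:~R * b) *
    \sum_(i < e.1) ev k (i%:R * p) * C (y + i%:R * p).
  under [RHS]eq_bigr do rewrite mulr_sumr.
  rewrite exchange_big /=; apply: eq_bigr => i _; rewrite mulr_suml.
  by apply: eq_bigr => k _; rewrite evD !mulrA.
rewrite mulr_sumr -sumrB; apply: eq_bigr => k _.
rewrite uH -mulrBr -mulrBr -H_iter.
have -> : y + e.1%:R * p + e.2%:~R * b = y + e.2%:~R * b + e.1%:R * p by ring.
rewrite [ev k (_ + _ * b + _)]evD; set e1 := ev k _; set e2 := ev k (e.1%:R * p); ring.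
Qed.
End Cocycle.

(** Translate y by a multiple of b to a point x of ]0, p[ and solve S(x) = m0(x) C(x) + S(x + p) for
    C(x). The sum S(x + p) is controlled by the bound on H(y + p), and H(y) then follows from the
    cocycle relation. *)
Lemma backward_step : exists2 K, 0 < K & forall H C tau, cocycle H C tau ->
  forall y B, 0 <= B -> (forall k, abs2 (H (y + p) k) <= B) ->
  (forall m : int, 0 < y + m%:~R * b < p -> abs2 (Ssum H (y + m%:~R * b)) <= B) ->
  abs2 (C y) <= K * B /\ forall k, abs2 (H y k) <= K * B.
Proof.
have b_gt0 := b0; have ltbp := bp.
(* This centres a closed interval [eps, eps + b] in ]0, p[: it is long enough to meet every line y +
   bZ, and |m0| has a positive minimum on it. *)
pose eps := (p - b) / 2.
have eps0 : 0 < eps by rewrite /eps; lra.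
have epsb : eps + b < p by rewrite /eps; lra.
have le_eps : eps <= eps + b by lra.
have em0 : ep m0 by apply: ep_ext (ep_m0 0) => y; rewrite addr0.
have [d d0 dP] := ep_lbound _ eps (eps + b) em0 le_eps ltac:(
  by move=> y /andP[y1 _]; apply: hm0; exact: lt_le_trans y1).
have [K K0 KP] := ep_ubound_fin 'I_N (fun k y => a k * ev k (y + p)) eps (eps + b)
  (fun k => epM _ _ (ep_cst (a k)) (ep_ev k p)) le_eps.
have [Q Q0 QP] := ep_ubound_fin 'I_N (fun k y => ev k p) eps (eps + b)
  (fun k => ep_cst (ev k p)) le_eps.
pose K1 := d^-1 * (2 + 2 * (N%:R * (N%:R * K))).
have K10 : 0 < K1.
  by rewrite mulr_gt0 ?invr_gt0// ltr_pwDl// !mulr_ge0 ?ler0n// ltW.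
exists (2 * Q + 2 * K1); first by rewrite addr_gt0// mulr_gt0.
move=> H C tau HC y B B0 HB SB.
have [t1 Hb Cb HCp] := HC.
have [m /andP[m1 m2]] := floor_rep b y eps b0.
have [u [u1 uH uC]] := quasi_periodic _ _ _ HC m.
set x := y + m%:~R * b in m1 m2.
have xI : eps <= x <= eps + b by apply/andP; split; lra.
have E : m0 x * C x = Ssum H x - \sum_k a k * ev k (x + p) * H (x + p) k.
  rewrite /m0 /Ssum mulr_suml -sumrB; apply: eq_bigr => k _.
  by rewrite -(HCp x k) mulrBr evD !mulrA.
have Cy : abs2 (C y) <= K1 * B.
  have -> : abs2 (C y) = abs2 (C x) by rewrite uC abs2M u1 mul1r.
  rewrite -mulrA ler_pdivlMl//.
  apply: (@le_trans _ _ (abs2 (m0 x * C x))).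
    by rewrite abs2M ler_wpM2r ?abs2_ge0// dP.
  rewrite E (le_trans (abs2B_le _ _))// [leRHS]mulrDl lerD//.
    by rewrite ler_wpM2l//; apply: (SB m); apply/andP; split; [exact: lt_le_trans m1|exact: lt_trans m2 _].
  rewrite -mulrA ler_wpM2l// (le_trans (abs2_sum_ord_le _ _))// -!mulrA ler_wpM2l//.
  apply: (@le_trans _ _ (\sum_(i < N) K * B)); last by rewrite sumr_const card_ord -[X in X <= _]mulr_natl.
  apply: ler_sum => k _; rewrite abs2M ler_pM ?abs2_ge0//; first exact: KP.
  by rewrite /x addrAC uH abs2M u1 mul1r.
split=> [|k]; first by rewrite (le_trans Cy)// ler_wpM2r//; lra.
have -> : H y k = ev k p * H (y + p) k + C y by rewrite -(HCp y k) addrC subrK.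
rewrite (le_trans (abs2D_le _ _))// [leRHS]mulrDl -(mulrA 2 Q) -(mulrA 2 K1) lerD// ler_wpM2l//.
by rewrite abs2M ler_pM ?abs2_ge0// (QP k eps)// lexx le_eps.
Qed.

(** The constant depends on n and not on the number j of steps actually made. The factor 1 + K1
    bounds both the values of H after one step and the samples, as the induction needs one common
    B. *)
Lemma backward_iter n : exists2 K, 1 <= K & forall j, (j <= n)%N ->
  forall H C tau, cocycle H C tau ->
  forall y B, 0 <= B -> (forall k, abs2 (H (y + j%:R * p) k) <= B) ->
  (forall (i : nat) (m : int), (i < n)%N -> 0 < y + i%:R * p + m%:~R * b < p ->
     abs2 (Ssum H (y + i%:R * p + m%:~R * b)) <= B) ->
  forall k, abs2 (H y k) <= K * B.
Proof.
have [K1 K10 K1P] := backward_step.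
elim: n => [|n [K K1' IH]].
  exists 1 => // j; rewrite leqn0 => /eqP-> H C tau HC y B B0 HB _ k.
  by rewrite mul1r -[y in H y](addr0 y) -(mul0r p).
have KK : 1 <= K * (1 + K1) by rewrite mulr_ege1// lerDl ltW.
exists (K * (1 + K1)) => // -[|j] jn H C tau HC y B B0 HB SB k.
  rewrite (le_trans _ (ler_wpM2r B0 KK))// mul1r.
  by rewrite -[y in H y](addr0 y) -(mul0r p).
rewrite -mulrA.
have [_ Hj] := K1P H C tau HC (y + j%:R * p) B B0 ltac:(
  by move=> l; rewrite (_ : _ + p = y + j.+1%:R * p); [exact: HB|rewrite -natr1; ring]) ltac:(
  by move=> m; exact: SB).
apply: (IH j jn H C tau HC) => [|l|i m i_n im].
- by rewrite mulr_ge0// addr_ge0// ltW.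
- by rewrite (le_trans (Hj l))// ler_wpM2r// lerDr.
- rewrite (le_trans (SB i m _ im))//; first exact: ltnW.
  by rewrite -[X in X <= _]mul1r ler_wpM2r// lerDl ltW.
Qed.

Lemma cocycle_coercive : exists (K : R) (n : nat), 0 < K /\
  forall H C tau, cocycle H C tau -> forall y B, 0 <= B ->
  (forall (j : nat) (m : int), (j <= n)%N -> 0 < y + j%:R * p + m%:~R * b < p ->
     abs2 (Ssum H (y + j%:R * p + m%:~R * b)) <= B) ->
  abs2 (C y) <= K * B.
Proof.
have [K0 K00 K0P] := backward_step.
have [u [v [K1 [n1 [uv K10 K1P]]]]] := local_bound.
have [n2 n2P] := orbit_dense b p (v - u) b0 ltac:(by rewrite subr_gt0) irr.
have [K2 K21 K2P] := backward_iter n2.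
(* One step to y + p, at most n2 to enter the interval of [local_bound], and n1 for the constraints
   used there. The constants compose in the reverse order, on the way back to y. *)
exists (K0 * (1 + K2 * (1 + K1))), (1 + n2 + n1)%N.
have K20 : 0 <= K2 by rewrite (le_trans _ K21).
split; first by rewrite mulr_gt0// ltr_wpDr// mulr_ge0// addr_ge0// ltW.
move=> H C tau HC y B B0 SB.
have [j [m [jn2 /andP[j1 j2]]]] := n2P (y + p) u.
set y' := y + p + _ + _ in j1 j2.
have Hy' k : abs2 (H y' k) <= K1 * B.
  apply: (K1P y' (H y') (fun i => C (y' + i%:R * p))) => //; first by apply/andP; split; lra.
  move=> e en eP; rewrite (abs2_functional _ _ _ HC).
  have E : y' + e.1%:R * p + e.2%:~R * b = y + (1 + j + e.1)%N%:R * p + (m + e.2)%:~R * b.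
    by rewrite /y' !natrD intrD; ring.
  rewrite E in eP *; apply: SB => //.
  by rewrite leq_add// leq_add2l.
have Hyj k : abs2 (H (y + p + j%:R * p) k) <= (1 + K1) * B.
  have [w' [w1 wH _]] := quasi_periodic _ _ _ HC m.
  have := Hy' k; rewrite /y' wH abs2M w1 mul1r => /le_trans; apply.
  by rewrite ler_wpM2r// lerDr.
have Hyp k : abs2 (H (y + p) k) <= K2 * ((1 + K1) * B).
  apply: (K2P j jn2 H C tau HC) => // [|i m' i_n im].
    by rewrite mulr_ge0// addr_ge0// ltW.
  have E : y + p + i%:R * p + m'%:~R * b = y + (1 + i)%N%:R * p + m'%:~R * b.
    by rewrite natrD; ring.
  rewrite E in im *; rewrite (le_trans (SB _ _ _ im))//.
    by rewrite -addnA leq_add2l (leq_trans (ltnW i_n))// leq_addr.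
  by rewrite -[X in X <= _]mul1r ler_wpM2r// lerDl ltW.
rewrite -mulrA.
have [] // := K0P H C tau HC y ((1 + K2 * (1 + K1)) * B).
- by rewrite mulr_ge0// addr_ge0// mulr_ge0// addr_ge0// ltW.
- by move=> k; rewrite (le_trans (Hyp k))// mulrA ler_wpM2r// lerDr.
- move=> m' mP; have := SB 0%N m' (leq0n _); rewrite mul0r addr0 => /(_ mP)/le_trans; apply.
  by rewrite -[X in X <= _]mul1r ler_wpM2r// lerDl mulr_ge0// addr_ge0// ltW.
Qed.
End Constraints.

(** * Integrals of complex functions *)

Section ComplexIntegral.
Local Open Scope classical_set_scope.
Context {R : realType}.
Local Notation mu := (@lebesgue_measure R).
Implicit Types (F G : R -> R[i]) (D : set R).

Definition cmeas F := measurable_fun setT (fun x => complex.Re (F x)) /\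
  measurable_fun setT (fun x => complex.Im (F x)).
(** A class closed under the algebraic operations and integrable on bounded intervals, which
    discharges the integrability conditions of all later identities. *)
Definition bounded_meas F := cmeas F /\ exists M : R, forall x, abs2 (F x) <= M.
Definition cint D F : R[i] :=
  (\int[mu]_(x in D) complex.Re (F x)) +i* (\int[mu]_(x in D) complex.Im (F x)).
Definition cintegrable D F :=
  mu.-integrable D (EFin \o (fun x => complex.Re (F x))) /\
  mu.-integrable D (EFin \o (fun x => complex.Im (F x))).

Lemma cmeas_cst c : cmeas (fun=> c).
Proof. by split; exact: measurable_cst. Qed.

Lemma cmeasD F G : cmeas F -> cmeas G -> cmeas (fun x => F x + G x).
Proof.
move=> [F1 F2] [G1 G2]; split.
- by under eq_fun do rewrite Re_add; exact: measurable_funD.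
- by under eq_fun do rewrite Im_add; exact: measurable_funD.
Qed.

Lemma cmeasM F G : cmeas F -> cmeas G -> cmeas (fun x => F x * G x).
Proof.
move=> [F1 F2] [G1 G2]; split.
- by under eq_fun do rewrite Re_mul; apply: measurable_funB; exact: measurable_funM.
- by under eq_fun do rewrite Im_mul; apply: measurable_funD; exact: measurable_funM.
Qed.

Lemma cmeasJ F : cmeas F -> cmeas (fun x => conjc (F x)).
Proof.
move=> [F1 F2]; split; first by under eq_fun do rewrite ReC_conj.
by under eq_fun do rewrite ImC_conj; apply: measurableT_comp.
Qed.

Lemma cmeasN F : cmeas F -> cmeas (fun x => - F x).
Proof.
move=> [F1 F2]; split.
- by under eq_fun do rewrite Re_opp; apply: measurableT_comp.
- by under eq_fun do rewrite Im_opp; apply: measurableT_comp.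
Qed.

Lemma cmeasB F G : cmeas F -> cmeas G -> cmeas (fun x => F x - G x).
Proof. by move=> mF mG; apply: cmeasD => //; exact: cmeasN. Qed.

Lemma cmeas_sum (I : Type) (r : seq I) (F : I -> R -> R[i]) :
  (forall i, cmeas (F i)) -> cmeas (fun x => \sum_(i <- r) F i x).
Proof.
move=> mF; elim: r => [|i r IH].
  by under eq_fun do rewrite big_nil; exact: cmeas_cst.
by under eq_fun do rewrite big_cons; exact: cmeasD.
Qed.

Lemma cmeas_continuous F : continuous (fun x => complex.Re (F x)) ->
  continuous (fun x => complex.Im (F x)) -> cmeas F.
Proof. by move=> cR cI; split; exact: continuous_measurable_fun. Qed.

Lemma cmeas_real (f : R -> R) : measurable_fun setT f -> cmeas (fun x => (f x)%:C).
Proof. by move=> mf; split=> //=; exact: measurable_cst. Qed.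

Lemma cmeas_comp F (f : R -> R) : measurable_fun setT f -> cmeas F -> cmeas (F \o f).
Proof.
by move=> mf [F1 F2]; split;
  [exact: (@measurableT_comp _ _ _ _ _ _ (fun x => complex.Re (F x)))
  |exact: (@measurableT_comp _ _ _ _ _ _ (fun x => complex.Im (F x)))].
Qed.

Lemma measurable_abs2 F : cmeas F -> measurable_fun setT (fun x => abs2 (F x)).
Proof.
by move=> [F1 F2]; apply: measurable_funD; exact: measurable_funX.
Qed.

Lemma bm_cst c : bounded_meas (fun=> c).
Proof. by split; [exact: cmeas_cst|exists (abs2 c)]. Qed.

Lemma bmD F G : bounded_meas F -> bounded_meas G -> bounded_meas (fun x => F x + G x).
Proof.
move=> [mF [M1 FM]] [mG [M2 GM]]; split; first exact: cmeasD.
exists (2 * M1 + 2 * M2) => x; rewrite (le_trans (abs2D_le _ _))//.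
by rewrite lerD// ler_wpM2l.
Qed.

Lemma bmM F G : bounded_meas F -> bounded_meas G -> bounded_meas (fun x => F x * G x).
Proof.
move=> [mF [M1 FM]] [mG [M2 GM]]; split; first exact: cmeasM.
by exists (M1 * M2) => x; rewrite abs2M ler_pM ?abs2_ge0.
Qed.

Lemma bmJ F : bounded_meas F -> bounded_meas (fun x => conjc (F x)).
Proof.
move=> [mF [M FM]]; split; first exact: cmeasJ.
by exists M => x; rewrite abs2J.
Qed.

Lemma bmN F : bounded_meas F -> bounded_meas (fun x => - F x).
Proof.
move=> [mF [M FM]]; split; first exact: cmeasN.
by exists M => x; rewrite abs2N.
Qed.

Lemma bmB F G : bounded_meas F -> bounded_meas G -> bounded_meas (fun x => F x - G x).
Proof. by move=> mF mG; apply: bmD => //; exact: bmN. Qed.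

Lemma bm_sum (I : Type) (r : seq I) (F : I -> R -> R[i]) :
  (forall i, bounded_meas (F i)) -> bounded_meas (fun x => \sum_(i <- r) F i x).
Proof.
move=> mF; elim: r => [|i r IH].
  by under eq_fun do rewrite big_nil; exact: bm_cst.
by under eq_fun do rewrite big_cons; exact: bmD.
Qed.

Lemma bm_comp F (f : R -> R) : measurable_fun setT f -> bounded_meas F ->
  bounded_meas (F \o f).
Proof.
move=> mf [mF [M FM]]; split; first exact: cmeas_comp.
by exists M => x; exact: FM.
Qed.

Lemma bounded_integrable D (f : R -> R) (M : R) : measurable D -> (mu D < +oo)%E ->
  measurable_fun setT f -> (forall x, D x -> f x ^+ 2 <= M) -> mu.-integrable D (EFin \o f).
Proof.
move=> mD Dfin mf fM; apply: measurable_bounded_integrable => //.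
  exact: measurable_funTS.
exists (1 + M); split; first exact: num_real.
move=> N MN x Dx; apply: ltW; apply: le_lt_trans MN.
have := fM x Dx; have := sqr_ge0 (`|f x| - 1); rewrite sqrrB1 real_normK ?num_real//.
have := normr_ge0 (f x); nra.
Qed.

Lemma bm_integrable D F : measurable D -> (mu D < +oo)%E -> bounded_meas F ->
  cintegrable D F.
Proof.
move=> mD Dfin [[F1 F2] [M FM]]; split; apply: (@bounded_integrable _ _ M) => // x _;
  apply: le_trans (FM x); rewrite /abs2 ?lerDl ?lerDr ?sqr_ge0//.
Qed.

Lemma bm_abs2_integrable D F : measurable D -> (mu D < +oo)%E -> bounded_meas F ->
  mu.-integrable D (EFin \o (fun x => abs2 (F x))).
Proof.
move=> mD Dfin [mF [M FM]]; apply: (@bounded_integrable _ _ (M ^+ 2)) => //.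
  exact: measurable_abs2.
move=> x _; rewrite ler_sqr ?nnegrE ?abs2_ge0 ?FM//.
exact: le_trans (abs2_ge0 (F x)) (FM x).
Qed.

Lemma eq_cint D F G : {in D, F =1 G} -> cint D F = cint D G.
Proof. by move=> FG; rewrite /cint; congr Complex; apply: eq_Rintegral => x xD; rewrite FG. Qed.

Lemma cintD D F G : measurable D -> cintegrable D F -> cintegrable D G ->
  cint D (fun x => F x + G x) = cint D F + cint D G.
Proof.
move=> mD [F1 F2] [G1 G2]; rewrite /cint; apply: complex_ext.
- rewrite Re_add /= -RintegralD//.
  by apply: eq_Rintegral => x _; rewrite Re_add.
- rewrite Im_add /= -RintegralD//.
  by apply: eq_Rintegral => x _; rewrite Im_add.
Qed.

Lemma integrable_scale D (r : R) (f : R -> R) : measurable D ->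
  mu.-integrable D (EFin \o f) -> mu.-integrable D (EFin \o (fun x => r * f x)).
Proof.
move=> mD fi; have := fun m => @integrableZl _ _ _ mu D m r _ fi.
by apply.
Qed.

Lemma integrable_add D (f g : R -> R) : measurable D ->
  mu.-integrable D (EFin \o f) -> mu.-integrable D (EFin \o g) ->
  mu.-integrable D (EFin \o (fun x => f x + g x)).
Proof.
move=> mD fi gi; have := fun m => @integrableD _ _ _ mu D m _ _ fi gi.
by apply.
Qed.

Lemma integrable_sub D (f g : R -> R) : measurable D ->
  mu.-integrable D (EFin \o f) -> mu.-integrable D (EFin \o g) ->
  mu.-integrable D (EFin \o (fun x => f x - g x)).
Proof.
move=> mD fi gi; have := fun m => @integrableB _ _ _ mu D m _ _ fi gi.
by apply.
Qed.

Lemma cintegrableZ D c F : measurable D -> cintegrable D F ->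
  cintegrable D (fun x => c * F x).
Proof.
move=> mD [F1 F2].
have Z r f := @integrable_scale D r f mD.
split.
- rewrite (_ : (fun x => _) = (fun x => complex.Re c * complex.Re (F x)
      - complex.Im c * complex.Im (F x))); last by apply/funext => x; rewrite Re_mul.
  by apply: integrable_sub => //; exact: Z.
- rewrite (_ : (fun x => _) = (fun x => complex.Re c * complex.Im (F x)
      + complex.Im c * complex.Re (F x))); last by apply/funext => x; rewrite Im_mul.
  by apply: integrable_add => //; exact: Z.
Qed.

Lemma cintZ D c F : measurable D -> cintegrable D F ->
  cint D (fun x => c * F x) = c * cint D F.
Proof.
move=> mD [F1 F2].
have Z r f := @integrable_scale D r f mD.
rewrite /cint; apply: complex_ext.
- rewrite Re_mul /= -!RintegralZl// -RintegralB//; [|exact: Z|exact: Z].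
  by apply: eq_Rintegral => x _; rewrite Re_mul.
- rewrite Im_mul /= -!RintegralZl// -RintegralD//; [|exact: Z|exact: Z].
  by apply: eq_Rintegral => x _; rewrite Im_mul.
Qed.

Lemma cint0 D : cint D (fun=> 0) = 0.
Proof. by rewrite /cint; apply: complex_ext; rewrite /= /Rintegral integral0. Qed.

Lemma cint_sum (I : Type) (r : seq I) D (F : I -> R -> R[i]) :
  measurable D -> (mu D < +oo)%E -> (forall i, bounded_meas (F i)) ->
  cint D (fun x => \sum_(i <- r) F i x) = \sum_(i <- r) cint D (F i).
Proof.
move=> mD Dfin bF; elim: r => [|i r IH].
  by rewrite big_nil -[RHS](cint0 D); apply: eq_cint => x _; rewrite big_nil.
rewrite big_cons -IH -cintD//; last 2 first.
- exact: bm_integrable.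
- by apply: bm_integrable => //; exact: bm_sum.
by apply: eq_cint => x _; rewrite big_cons.
Qed.

Lemma cint_conj D F : measurable D -> cintegrable D F ->
  cint D (fun x => conjc (F x)) = conjc (cint D F).
Proof.
move=> mD [F1 F2]; rewrite /cint; apply: complex_ext; rewrite ?ReC_conj ?ImC_conj /=.
  by apply: eq_Rintegral => x _; rewrite ReC_conj.
rewrite -[RHS]mulN1r -RintegralZl//.
by apply: eq_Rintegral => x _; rewrite ImC_conj mulN1r.
Qed.

Lemma Rintegral_abs2 D F :
  \int[mu]_(x in D) abs2 (F x) = complex.Re (cint D (fun x => F x * conjc (F x))).
Proof. by apply: eq_Rintegral => x _; rewrite mulJ_abs2. Qed.

Lemma measurable_shift (c : R) : measurable_fun [set: R] (fun x : R => x + c).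
Proof. by apply: measurable_funD => //; exact: measurable_cst. Qed.

(** Uniqueness of Lebesgue measure: its image under a translation gives half-open intervals their
    length. *)
Lemma lebesgue_measure_shift (c : R) (A : set R) : measurable A ->
  pushforward mu ((fun x => x + c) : _ -> measurableTypeR R) A = mu A.
Proof.
move=> mA.
have ms := measurable_shift c.
apply/esym/(@lebesgue_measure_unique R (pushforward mu ((fun x => x + c) : _ -> measurableTypeR R))) => //= _ [[a b]] _ <-.
have E : (fun x : R => x + c) @^-1` `]a, b] = `]a - c, b - c].
  by apply/seteqP; split => x /=; rewrite !in_itv /= ltrBlDr lerBrDr.
rewrite /pushforward E.
rewrite !lebesgue_measure_itv /= !lte_fin ltrD2r; case: ifP => // _.
by rewrite -!EFinB; congr EFin; ring.
Qed.

Lemma ge0_integral_shift (f : R -> \bar R) (c : R) D : measurable D ->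
  measurable_fun setT f -> (forall x, 0 <= f x)%E ->
  (\int[mu]_(x in (fun x => (x + c)%R) @^-1` D) f (x + c)%R = \int[mu]_(x in D) f x)%E.
Proof.
move=> mD mf f0.
have ms := measurable_shift c.
rewrite -(@ge0_integral_pushforward _ _ (measurableTypeR R) (measurableTypeR R) R
  (fun x => x + c) ms mu D f)//; last exact: measurable_funTS.
by apply: eq_measure_integral => //= A mA AS; exact: lebesgue_measure_shift.
Qed.

Lemma Rintegral_shift (f : R -> R) (c : R) D : measurable D ->
  measurable_fun setT f ->
  \int[mu]_(x in (fun x => (x + c)%R) @^-1` D) f (x + c) = \int[mu]_(x in D) f x.
Proof.
move=> mD mf; have mF : measurable_fun setT (EFin \o f) by exact/measurable_EFinP.
rewrite /Rintegral integralE [in RHS]integralE; congr (fine (_ - _)%E).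
- rewrite -(@ge0_integral_shift ((EFin \o f)^\+)%E c)//; last exact: measurable_funepos.
  by apply: eq_integral => x _; rewrite !funeposE.
- rewrite -(@ge0_integral_shift ((EFin \o f)^\-)%E c)//; last exact: measurable_funeneg.
  by apply: eq_integral => x _; rewrite !funenegE.
Qed.

Lemma shift_preimage_itv (a b c : R) :
  (fun x => x + c) @^-1` `[a, b[ = `[a - c, b - c[.
Proof.
by apply/seteqP; split => x /=; rewrite !in_itv /= lerBlDr ltrBrDr.
Qed.

Lemma itv_fin (a b : R) : (mu `[a, b[ < +oo)%E.
Proof. by rewrite lebesgue_measure_itv /=; case: ifP => _; rewrite ?ltry// -EFinB ltry. Qed.

End ComplexIntegral.

(** * Fourier series *)

Section ExpIntegral.
Local Open Scope classical_set_scope.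
Context {R : realType}.
Local Notation mu := (@lebesgue_measure R).

Lemma is_derive_cexp_Re (c l : R[i]) (x : R) :
  is_derive x (1 : R) (fun y : R => complex.Re (c * cexp (y%:C * l)))
    (complex.Re (c * l * cexp (x%:C * l))).
Proof.
pose u := complex.Re l; pose v := complex.Im l.
have du (a : R) : is_derive x (1 : R) (fun y : R => y * a) a.
  rewrite (_ : (fun y : R => y * a) = a \*: id); last by apply/funext => y; rewrite /= mulrC.
  by apply: is_derive_eq; rewrite scaler1.
have de : is_derive x (1 : R) (fun y : R => expR (y * u)) (expR (x * u) * u).
  exact: (@is_derive1_comp _ expR (fun y : R => y * u) x).
have dc : is_derive x (1 : R) (fun y : R => cos (y * v)) (- sin (x * v) * v).
  exact: (@is_derive1_comp _ cos (fun y : R => y * v) x).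
have ds : is_derive x (1 : R) (fun y : R => sin (y * v)) (cos (x * v) * v).
  exact: (@is_derive1_comp _ sin (fun y : R => y * v) x).
have E y : cexp (y%:C * l) = (expR (y * u) * cos (y * v)) +i* (expR (y * u) * sin (y * v)).
  rewrite /cexp Re_mul Im_mul /= !mul0r subr0 addr0.
  by apply: complex_ext; rewrite ?Re_mul ?Im_mul /=; ring.
rewrite (_ : (fun y : R => _) =
  complex.Re c \*: ((fun y => expR (y * u)) * (fun y => cos (y * v))) -
  complex.Im c \*: ((fun y => expR (y * u)) * (fun y => sin (y * v)))); last first.
  by apply/funext => y; rewrite Re_mul E.
apply: is_derive_eq; rewrite Re_mul E /= Re_mul Im_mul -/u -/v /GRing.scale /=.
ring.
Qed.

Lemma cint_cexp (p : R) (l : R[i]) : 0 < p -> l != 0 ->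
  cint `[0, p[ (fun x => cexp (x%:C * l)) = (cexp (p%:C * l) - 1) / l.
Proof.
move=> p0 l0.
have main c : \int[mu]_(x in `[0, p[) complex.Re (c * l * cexp (x%:C * l)) =
    complex.Re (c * cexp (p%:C * l)) - complex.Re c.
  have [cR _] := continuous_cexp (c * l) l.
  have [cF _] := continuous_cexp c l.
  rewrite Rintegral_itv_bndo_bndc; last first.
    apply: (@integrableS _ _ _ mu `[0, p]) => //; first exact: subset_itv_co_cc.
    apply: continuous_compact_integrable; first exact: segment_compact.
    exact: continuous_subspaceT.
  rewrite /Rintegral (@continuous_FTC2 _ _ (fun y => complex.Re (c * cexp (y%:C * l))))//.
  - by rewrite /= !mul0r cexp0 mulr1.
  - exact: continuous_subspaceT.
  - split.
    + by move=> x _; case: (is_derive_cexp_Re c l x).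
    + by apply: cvg_at_right_filter; exact: cF.
    + by apply: cvg_at_left_filter; exact: cF.
  - by move=> x _; rewrite derive1E; case: (is_derive_cexp_Re c l x).
rewrite /cint; apply: complex_ext.
- have := main l^-1; rewrite mulVf// => E.
  rewrite [LHS]/= [X in complex.Re X]mulrC mulrBr Re_add Re_opp mulr1 -E.
  by apply: eq_Rintegral => x _; rewrite mul1r.
(* Im z = Re(-iz), so the formula for real parts with an additional factor -i yields the imaginary
   part. *)
- have := main (l^-1 * (0 -i* 1)); rewrite mulrAC mulVf// mul1r => E.
  rewrite [LHS]/= (_ : \int[mu]_(x in _) _ =
    \int[mu]_(x in `[0, p[) complex.Re ((0 -i* 1) * cexp (x%:C * l))); last first.
    by apply: eq_Rintegral => x _; rewrite Re_mul /=; ring.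
  rewrite E [X in complex.Im X]mulrC mulrBr Im_add Im_opp mulr1.
  by rewrite !(Re_mul, Im_mul) /=; ring.
Qed.

Lemma cexpi_neq1 (t : R) : 0 < t < 2 * pi -> cexpi t != 1 :> R[i].
Proof.
move=> /andP[t0 t2]; apply/eqP => /(congr1 (@complex.Re R)) /=.
have -> : t = (t / 2) *+ 2 by rewrite -mulr_natr divfK.
rewrite cos_mulr2n => E.
have s0 : 0 < sin (t / 2) by apply: sin_gt0_pi; apply/andP; split; lra.
have := cos2Dsin2 (t / 2); have : cos (t / 2) ^+ 2 = 1 by lra.
by move=> -> ; have := exprn_gt0 2 s0; lra.
Qed.

Lemma cexpi_2piZ (n : int) : cexpi (2 * pi * n%:~R) = 1 :> R[i].
Proof.
have one : cexpi (2 * pi) = 1 :> R[i].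
  by rewrite /cexpi mulr_natl cos2pi sin2pi.
have nat_case (k : nat) : cexpi (2 * pi * k%:R) = 1 :> R[i].
  elim: k => [|k IH]; first by rewrite mulr0 cexpi0.
  by rewrite -[k.+1%:R]natr1 mulrDr mulr1 cexpiD IH one mulr1.
case: n => n; first exact: nat_case.
by rewrite NegzE mulrNz mulrN cexpiN nat_case conjc1.
Qed.

End ExpIntegral.

Section FourierBasis.
Local Open Scope classical_set_scope.
Context {R : realType} (L : R).
Hypothesis L0 : 0 < L.
Local Notation mu := (@lebesgue_measure R).
Local Notation D := (`[0, L[ : set R).

Definition fbasis (n : int) (x : R) : R[i] := cexpi (2 * pi * n%:~R * x / L).

Lemma fbasisD m n x : fbasis (m + n) x = fbasis m x * fbasis n x.
Proof. by rewrite /fbasis -cexpiD; congr cexpi; rewrite intrD; ring. Qed.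

Lemma fbasisJ n x : conjc (fbasis n x) = fbasis (- n) x.
Proof. by rewrite /fbasis -cexpiN; congr cexpi; rewrite mulrNz; ring. Qed.

Lemma fbasis0 x : fbasis 0 x = 1.
Proof. by rewrite /fbasis mulr0 !mul0r cexpi0. Qed.

Lemma abs2_fbasis n x : abs2 (fbasis n x) = 1.
Proof. exact: abs2_cexpi. Qed.

Lemma fbasis_cexp n x : fbasis n x = cexp (x%:C * (0 +i* (2 * pi * n%:~R / L))).
Proof.
rewrite /fbasis -cexp_imag; congr cexp; apply: complex_ext; rewrite ?Re_mul ?Im_mul /=; ring.
Qed.

Lemma fbasis_bm n : bounded_meas (fbasis n).
Proof.
split; last by exists 1 => x; rewrite abs2_fbasis.
have [cR cI] := continuous_cexp 1 (0 +i* (2 * pi * n%:~R / L)).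
by apply: cmeas_continuous; under eq_fun do rewrite fbasis_cexp -[cexp _]mul1r.
Qed.

Lemma mD : measurable D. Proof. exact: measurable_itv. Qed.

Lemma cint_fbasis n : cint D (fbasis n) = if n == 0 then L%:C else 0.
Proof.
case: eqP => [->|/eqP n0].
  rewrite (@eq_cint _ _ _ (fun=> 1)); last by move=> x _; exact: fbasis0.
  rewrite /cint /= !Rintegral_cst//.
  have muD : fine (mu D) = L by rewrite lebesgue_measure_itv /= lte_fin L0 /= subr0.
  transitivity (Complex (1 * fine (mu D)) (0 * fine (mu D))) => //.
  by rewrite muD mul1r mul0r.
have l0 : 0 +i* (2 * pi * n%:~R / L) != 0 :> R[i].
  rewrite eq_complex /= eqxx /= !mulf_neq0//.
  - by rewrite gt_eqF// pi_gt0.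
  - by rewrite intr_eq0.
  - by rewrite invr_eq0 gt_eqF.
have := cint_cexp L _ L0 l0; under eq_cint do rewrite -fbasis_cexp.
move=> ->; rewrite -fbasis_cexp /fbasis mulfK ?gt_eqF// cexpi_2piZ.
by rewrite subrr mul0r.
Qed.

Definition fcoef (phi : R -> R[i]) (n : int) : R[i] :=
  cint D (fun x => phi x * conjc (fbasis n x)).

Definition norm2D (phi : R -> R[i]) : R := \int[mu]_(x in D) abs2 (phi x).

Lemma norm2D_cint phi : bounded_meas phi ->
  (norm2D phi)%:C = cint D (fun x => phi x * conjc (phi x)).
Proof.
move=> bphi; rewrite /norm2D Rintegral_abs2; apply: complex_ext => //=.
rewrite /Rintegral integral0_eq//= => x _.
by rewrite mulJ_abs2.
Qed.

(** Completing the square in the coefficients. With d_n = [fcoef phi n] / L it is Bessel's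
    inequality; with d from a good approximant it shows that Bessel is nearly an equality; with phi
    = 0 it is orthogonality. *)
Lemma trig_defect phi (s : seq int) (d : int -> R[i]) : bounded_meas phi -> uniq s ->
  norm2D (fun x => phi x - \sum_(n <- s) d n * fbasis n x) =
  norm2D phi - L^-1 * \sum_(n <- s) abs2 (fcoef phi n)
  + L * \sum_(n <- s) abs2 (d n - L^-1%:C * fcoef phi n).
Proof.
move=> bphi us; pose P x := \sum_(n <- s) d n * fbasis n x.
have bt n : bounded_meas (fun x => d n * fbasis n x).
  by apply: bmM; [exact: bm_cst|exact: fbasis_bm].
have bP : bounded_meas P by exact: bm_sum.
have cI F : bounded_meas F -> cintegrable D F.
  by apply: bm_integrable; [exact: mD|exact: itv_fin].
have intP F : bounded_meas F -> cint D (fun x => F x * conjc (P x)) =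
    \sum_(n <- s) conjc (d n) * fcoef F n.
  move=> bF.
  rewrite (@eq_cint _ _ _ (fun x => \sum_(n <- s) conjc (d n) * (F x * conjc (fbasis n x)))).
    rewrite cint_sum; [|exact: mD|exact: itv_fin|].
      apply: eq_bigr => n _; rewrite cintZ//; apply: cI.
      by apply: bmM => //; apply: bmJ; exact: fbasis_bm.
    move=> n; apply: bmM; first exact: bm_cst.
    by apply: bmM => //; apply: bmJ; exact: fbasis_bm.
  move=> x _; rewrite /P conjc_sum mulr_sumr; apply: eq_bigr => n _.
  by rewrite conjcM mulrCA.
have coefP n : n \in s -> fcoef P n = L%:C * d n.
  move=> ns; rewrite /fcoef.
  rewrite (@eq_cint _ _ _ (fun x => \sum_(m <- s) d m * fbasis (m - n) x)); last first.
    move=> x _; rewrite /P mulr_suml; apply: eq_bigr => m _.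
    by rewrite fbasisJ -mulrA fbasisD.
  rewrite cint_sum; [|exact: mD|exact: itv_fin|].
    rewrite (bigD1_seq n)//= cintZ; [|exact: mD|by apply: cI; exact: fbasis_bm].
    rewrite cint_fbasis subrr eqxx big1 ?addr0 1?mulrC// => m mn.
    rewrite cintZ; [|exact: mD|by apply: cI; exact: fbasis_bm].
    by rewrite cint_fbasis subr_eq0 (negbTE mn) mulr0.
  by move=> m; apply: bmM; [exact: bm_cst|exact: fbasis_bm].
apply: complexI; rewrite norm2D_cint; last exact: bmB.
rewrite (@eq_cint _ _ _ (fun x => (phi x * conjc (phi x) - (phi x * conjc (P x))) -
   (conjc (phi x * conjc (P x)) - P x * conjc (P x)))); last first.
  by move=> x _; rewrite -/(P x) conjcB conjcM conjcK; ring.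
have bJ F : bounded_meas F -> bounded_meas (fun x => conjc (F x)) by exact: bmJ.
have subI F G : bounded_meas F -> bounded_meas G ->
    cint D (fun x => F x - G x) = cint D F - cint D G.
  move=> bF bG; rewrite (@eq_cint _ _ _ (fun x => F x + (-1) * G x)).
    rewrite cintD; [|exact: mD|exact: cI|].
      by rewrite cintZ; [rewrite mulN1r|exact: mD|exact: cI].
    by apply: cintegrableZ; [exact: mD|exact: cI].
  by move=> x _; rewrite mulN1r.
have b1 : bounded_meas (fun x => phi x * conjc (phi x)) by apply: bmM => //; exact: bJ.
have b2 : bounded_meas (fun x => phi x * conjc (P x)) by apply: bmM => //; exact: bJ.
have b3 : bounded_meas (fun x => P x * conjc (P x)) by apply: bmM => //; exact: bJ.
rewrite subI; [|exact: bmB|by apply: bmB => //; exact: bJ].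
rewrite subI// subI//; last exact: bJ.
rewrite cint_conj; [|exact: mD|exact: cI].
rewrite -norm2D_cint// intP// intP// conjc_sum /=.
have -> : \sum_(n <- s) conjc (d n) * fcoef P n = \sum_(n <- s) L%:C * (d n * conjc (d n)).
  by rewrite big_seq [RHS]big_seq; apply: eq_bigr => n ns; rewrite coefP//; ring.
rewrite !rmorphD rmorphN !rmorphM /= !(rmorph_sum (real_complex R)) /=.
rewrite mulr_sumr [X in _ = _ + X]mulr_sumr -addrA -[RHS]addrA; congr (_ + _).
rewrite -sumrB -!sumrN -!big_split /=.
apply: eq_bigr => n _.
rewrite -!mulJ_abs2 !(conjcB, conjcM) conjcK conjc_real.
have LV : L%:C * L^-1%:C = 1 by rewrite -rmorphM /= divff ?gt_eqF.
set f := fcoef phi n; set a := d n.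
have -> : L%:C * ((a - L^-1%:C * f) * ((conjc a) - L^-1%:C * conjc f)) =
  L%:C * (a * conjc a) - (L%:C * L^-1%:C) * (f * conjc a) - (L%:C * L^-1%:C) * (a * conjc f)
  + (L%:C * L^-1%:C) * L^-1%:C * (f * conjc f) by ring.
rewrite LV; ring.
Qed.
End FourierBasis.

(** * Discrete Fejer means *)

Section Fejer.
Local Open Scope classical_set_scope.
Context {R : realType} (L : R).
Hypothesis L0 : 0 < L.
Local Notation mu := (@lebesgue_measure R).
Local Notation D := (`[0, L[ : set R).
Local Notation fb := (fbasis L).

Definition trig (F : R -> R[i]) := exists (s : seq int) (d : int -> R[i]),
  uniq s /\ forall x, F x = \sum_(n <- s) d n * fb n x.

Lemma trig_list (r : seq (int * R[i])) (F : R -> R[i]) :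
  (forall x, F x = \sum_(u <- r) u.2 * fb u.1 x) -> trig F.
Proof.
move=> FE; exists (undup [seq u.1 | u <- r]), (fun n => \sum_(u <- r | u.1 == n) u.2).
split=> [|x]; first exact: undup_uniq.
rewrite FE; under [RHS]eq_bigr do rewrite mulr_suml.
rewrite (exchange_big_dep xpredT)//= big_seq [RHS]big_seq; apply: eq_bigr => u ur.
have us : u.1 \in undup [seq u.1 | u <- r] by rewrite mem_undup map_f.
rewrite (eq_bigl (pred1 u.1)) => [|n]; last by rewrite /= eq_sym.
by rewrite -big_filter filter_pred1_uniq ?undup_uniq// big_seq1.
Qed.

Lemma trig_sum (I : Type) (r : seq I) (F : I -> R -> R[i]) :
  (forall i, trig (F i)) -> trig (fun x => \sum_(i <- r) F i x).
Proof.
move=> tF.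
have tl i : exists l : seq (int * R[i]), forall x, F i x = \sum_(u <- l) u.2 * fb u.1 x.
  have [s [d [_ FE]]] := tF i; exists [seq (n, d n) | n <- s] => x.
  by rewrite FE big_map.
pose l i := sval (cid (tl i)).
apply: (@trig_list (flatten [seq l i | i <- r])) => x.
rewrite big_flatten /= big_map; apply: eq_bigr => i _.
exact: (svalP (cid (tl i))).
Qed.

Lemma trigZ c F : trig F -> trig (fun x => c * F x).
Proof.
move=> [s [d [us FE]]]; exists s, (fun n => c * d n); split=> // x.
by rewrite FE mulr_sumr; apply: eq_bigr => n _; rewrite mulrA.
Qed.

Lemma trigD F G : trig F -> trig G -> trig (fun x => F x + G x).
Proof.
move=> tF tG; have := @trig_sum bool [:: true; false] (fun b => if b then F else G).
case=> [[]//|s [d [us FE]]]; exists s, d; split=> // x.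
by rewrite -FE !big_cons big_nil addr0.
Qed.

Lemma trig_shift m c : trig (fun x => fb m (x - c)).
Proof.
apply: (@trig_list [:: (m, fb m (- c))]) => x; rewrite big_seq1 /= /fbasis -cexpiD.
by congr cexpi; ring.
Qed.

Lemma trig_bm F : trig F -> bounded_meas F.
Proof.
move=> [s [d [_ FE]]]; rewrite (_ : F = fun x => \sum_(n <- s) d n * fb n x); last exact/funext.
by apply: bm_sum => n; apply: bmM; [exact: bm_cst|exact: fbasis_bm].
Qed.

Definition dirichlet (n : nat) (z : R) : R[i] := \sum_(k < n) fb k%:Z z.
(** The Fejer kernel |D_n|^2 / n divided once more by n, so that its translates to the n nodes jL/n
    form a partition of unity. Means are then finite sums, with no convolution integral. *)
Definition fejer (n : nat) (z : R) : R := abs2 (dirichlet n z) / n%:R ^+ 2.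
Definition node (n j : nat) : R := j%:R * L / n%:R.

Lemma fejer_ge0 n z : 0 <= fejer n z.
Proof. by rewrite divr_ge0 ?abs2_ge0// sqr_ge0. Qed.

Lemma fejerE n z : (fejer n z)%:C =
  (n%:R ^+ 2)^-1%:C * \sum_(k < n) \sum_(l < n) fb (k%:Z - l%:Z) z.
Proof.
rewrite /fejer mulrC rmorphM /= -mulJ_abs2 /dirichlet conjc_sum mulr_suml; congr (_ * _).
apply: eq_bigr => k _; rewrite mulr_sumr; apply: eq_bigr => l _.
by rewrite fbasisJ fbasisD.
Qed.

(** A geometric sum over powers of an n-th root of unity, which differs from 1 because 0 < |m| <
    n. *)
Lemma node_sum (n : nat) (m : int) x : (0 < n)%N -> (`|m| < n)%N ->
  \sum_(j < n) fb m (x - node n j) = if m == 0 then n%:R else 0.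
Proof.
move=> n0 mn; case: eqP => [->|/eqP m0].
  rewrite (eq_bigr (fun=> 1)) => [|j _]; last exact: fbasis0.
  by rewrite sumr_const card_ord.
have nR : n%:R != 0 :> R by rewrite pnatr_eq0 -lt0n.
pose z : R[i] := cexpi (- (2 * pi * m%:~R / n%:R)).
have zX (j : nat) : cexpi (- (2 * pi * m%:~R * j%:R / n%:R)) = z ^+ j.
  elim: j => [|j IH]; first by rewrite mulr0 mul0r oppr0 cexpi0.
  rewrite exprSr -IH -cexpiD; congr cexpi.
  by rewrite -[j.+1%:R]natr1; ring.
have zn : z ^+ n = 1.
  by rewrite -zX mulfK// cexpiN cexpi_2piZ conjc1.
have z1 : z != 1.
  have n0R : 0 < n%:R :> R by rewrite ltr0n.
  have mb : 0 < 2 * (pi : R) * `|m|%N%:R / n%:R < 2 * pi.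
    apply/andP; split.
      by rewrite divr_gt0// !mulr_gt0 ?pi_gt0// ltr0n absz_gt0.
    by rewrite ltr_pdivrMr// ltr_pM2l ?mulr_gt0 ?pi_gt0// ltr_nat.
  have := cexpi_neq1 _ mb; case: (intP m) m0 mn @z {mb zX zn} => // k _ _ z.
    move=> H; apply: contra H => /eqP; rewrite /z cexpiN => /(congr1 (@conjc R)).
    by rewrite conjcK conjc1 => /eqP.
  by rewrite /z mulrNz mulrN mulNr opprK abszN.
rewrite (eq_bigr (fun j : 'I_n => fb m x * z ^+ j)) => [|j _]; last first.
  rewrite -zX /fbasis -cexpiD; congr cexpi; rewrite /node; field.
  by rewrite nR gt_eqF.
rewrite -mulr_sumr; have := subrX1 z n; rewrite zn subrr => /esym/eqP.
by rewrite mulf_eq0 subr_eq0 (negbTE z1) => /eqP ->; rewrite mulr0.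
Qed.

Lemma fejer_partition n x : (0 < n)%N -> \sum_(j < n) fejer n (x - node n j) = 1.
Proof.
move=> n0; have nR : n%:R != 0 :> R by rewrite pnatr_eq0 -lt0n.
apply: complexI; rewrite rmorph_sum /=.
rewrite (eq_bigr (fun j : 'I_n => (n%:R ^+ 2)^-1%:C *
  \sum_(k < n) \sum_(l < n) fb (k%:Z - l%:Z) (x - node n j))) => [|j _]; last exact: fejerE.
rewrite -mulr_sumr exchange_big /=.
rewrite (eq_bigr (fun=> n%:R)) => [|k _].
  have -> : \sum_(k in 'I_n) n%:R = (n%:R ^+ 2 : R)%:C.
    by rewrite sumr_const card_ord rmorphXn /= rmorph_nat expr2 mulr_natr.
  by rewrite -rmorphM /= mulVf// expf_eq0.
rewrite exchange_big /= (bigD1 k)//= node_sum//; last by rewrite subrr absz0.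
rewrite subrr eqxx big1 ?addr0// => l lk; rewrite node_sum//.
  rewrite subr_eq0; case: eqP => // -[kl]; move/eqP: lk; case.
  by apply: val_inj.
by have := ltn_ord k; have := ltn_ord l; lia.
Qed.

(** Geometric sum: with q = [fb 1 z] of modulus 1, the product is |q^n - 1|^2. *)
Lemma dirichlet_far n z : abs2 (dirichlet n z) * abs2 (1 - fb 1 z) <= 4.
Proof.
have pw k : fb k%:Z z = fb 1 z ^+ k.
  elim: k => [|k IH]; first by rewrite fbasis0.
  by rewrite -addn1 PoszD fbasisD IH exprD.
rewrite -abs2M -abs2N -mulrN opprB mulrC /dirichlet (eq_bigr (fun k : 'I_n => fb 1 z ^+ k)) => [|k _].
  rewrite -subrX1 -pw (le_trans (abs2B_le _ _))// abs2_1 abs2_fbasis.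
  by lra.
exact: pw.
Qed.

Definition fejer_mean (g : R -> R) n x := \sum_(j < n) g (node n j) * fejer n (x - node n j).

Lemma trig_fejer_mean g n : trig (fun x => (fejer_mean g n x)%:C).
Proof.
have E x : (fejer_mean g n x)%:C = \sum_(j < n) (g (node n j))%:C *
   ((n%:R ^+ 2)^-1%:C * \sum_(k < n) \sum_(l < n) fb (k%:Z - l%:Z) (x - node n j)).
  by rewrite rmorph_sum /=; apply: eq_bigr => j _; rewrite rmorphM /= fejerE.
have [s [d [us FE]]] : trig (fun x => \sum_(j < n) (g (node n j))%:C *
   ((n%:R ^+ 2)^-1%:C * \sum_(k < n) \sum_(l < n) fb (k%:Z - l%:Z) (x - node n j))).
  apply: trig_sum => j; apply: trigZ; apply: trigZ.
  by apply: trig_sum => k; apply: trig_sum => l; exact: trig_shift.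
by exists s, d; split=> // x; rewrite E FE.
Qed.

Lemma fejer_mean_bound g M n x : (0 < n)%N -> (forall y, `|g y| <= M) ->
  `|fejer_mean g n x| <= M.
Proof.
move=> n0 gM; rewrite (le_trans (ler_norm_sum _ _ _))//.
apply: (@le_trans _ _ (\sum_(j < n) M * fejer n (x - node n j))).
  by apply: ler_sum => j _; rewrite normrM (ger0_norm (fejer_ge0 _ _)) ler_wpM2r ?fejer_ge0.
by rewrite -mulr_sumr fejer_partition// mulr1.
Qed.

(** Nodes near x are handled by continuity. At far nodes the kernel is O(1/n^2), and there are at
    most n of them. Since g need not be L-periodic, x is kept inside the interval. *)
Lemma fejer_mean_cvg g M x : continuous g -> (forall y, `|g y| <= M) -> 0 < x < L ->
  forall e, 0 < e -> exists n0, forall n, (n0 <= n)%N ->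
    `|g x - fejer_mean g n.+1 x| <= e.
Proof.
move=> cg gM /andP[x0 xL] e e0; have L_gt0 := L0.
have M0 : 0 <= M by exact: le_trans (normr_ge0 _) (gM 0).
have [d1 /= d10 dP] : exists2 d : R, 0 < d & forall y, `|x - y| < d -> `|g x - g y| < e / 2.
  have e20 : 0 < e / 2 by rewrite divr_gt0.
  have /cvgrPdist_lt/(_ _ e20) := cg x.
  by move=> /nbhs_ballP[d /= d0 H]; exists d.
(* The last two bounds give |x - node| <= L - d, away from the ends of the period, where the kernel
   concentrates again. *)
pose d := Num.min d1 (Num.min (x / 2) ((L - x) / 2)).
have d0 : 0 < d by rewrite !lt_min d10 /=; apply/andP; split; lra.
have dd1 : d <= d1 by rewrite ge_min lexx.
have dx : d <= x / 2 by rewrite !ge_min lexx !orbT.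
have dL : d <= (L - x) / 2 by rewrite !ge_min lexx !orbT.
have efb : ep (fun t => 1 - fb 1 t).
  apply: epD; first exact: ep_cst.
  apply: epN; apply: ep_ext (ep_exp 1 (0 +i* (2 * pi * 1%:~R / L))) => y.
  by rewrite fbasis_cexp mul1r.
have dLd : d <= L - d by lra.
have fb_neq1 t : d <= t <= L - d -> 1 - fb 1 t != 0.
  move=> /andP[t1 t2]; have t0 : 0 < t by exact: lt_le_trans t1.
  rewrite subr_eq0 eq_sym /fbasis mulr1; apply: cexpi_neq1; apply/andP; split.
    by rewrite divr_gt0// !mulr_gt0// pi_gt0.
  by rewrite ltr_pdivrMr// ltr_pM2l ?mulr_gt0 ?pi_gt0//; lra.
have [c c0 cP] := ep_lbound _ d (L - d) efb dLd fb_neq1.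
have far y : d <= `|y| <= L - d -> c <= abs2 (1 - fb 1 y).
  case: (ger0P y) => y0 yd; first exact: cP.
  by have := cP _ yd; rewrite -(abs2J (1 - fb 1 y)) conjcB conjc1 fbasisJ /fbasis mulrNz !mulrN !mulNr.
(* At a far node |g x - g node| <= 2M and |D_n|^2 <= 4/c. *)
have K0 : 0 <= 8 * M / c by rewrite divr_ge0// ?mulr_ge0// ltW.
have [n0 n0P] : exists n0 : nat, 8 * M / c / (e / 2) < n0.+1%:R.
  by exists (Num.truncn (8 * M / c / (e / 2))); exact: truncnS_gt.
exists n0 => n nn; set m := n.+1.
have m0 : 0 < m%:R :> R by rewrite ltr0n.
have -> : g x - fejer_mean g m x = \sum_(j < m) (g x - g (node m j)) * fejer m (x - node m j).
  under eq_bigr do rewrite mulrBl.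
  by rewrite sumrB -mulr_sumr fejer_partition// mulr1.
rewrite (le_trans (ler_norm_sum _ _ _))//.
apply: (@le_trans _ _ (\sum_(j < m) (e / 2 * fejer m (x - node m j) + 8 * M / c / m%:R ^+ 2))).
  apply: ler_sum => j _; rewrite normrM (ger0_norm (fejer_ge0 _ _)).
  have xj0 : 0 <= node m j by rewrite /node divr_ge0// mulr_ge0// ltW.
  have xjL : node m j <= L.
    rewrite /node ler_pdivrMr// mulrC ler_wpM2l ?(ltW L_gt0)// ler_nat.
    exact: ltnW (ltn_ord j).
  case: (ltP `|x - node m j| d) => xd.
    apply: (@le_trans _ _ (e / 2 * fejer m (x - node m j))).
      by rewrite ler_wpM2r ?fejer_ge0// ltW// dP//; exact: lt_le_trans xd dd1.
    by rewrite lerDl divr_ge0// sqr_ge0.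
  apply: (@le_trans _ _ (8 * M / c / m%:R ^+ 2)); last first.
    by rewrite lerDr mulr_ge0 ?fejer_ge0// divr_ge0// ltW.
  apply: (@le_trans _ _ (2 * M * fejer m (x - node m j))).
    rewrite ler_wpM2r ?fejer_ge0// (le_trans (ler_normB _ _))// mulr_natl mulr2n.
    by rewrite lerD.
  rewrite /fejer mulrA ler_wpM2r ?invr_ge0 ?sqr_ge0//.
  have xfar : c <= abs2 (1 - fb 1 (x - node m j)).
    apply: far; rewrite xd /=.
    by rewrite ler_norml; apply/andP; split; lra.
  have := dirichlet_far m (x - node m j).
  set A := abs2 (dirichlet _ _); set B := abs2 _ in xfar *; move=> AB.
  have Ac : A * c <= 4 by rewrite (le_trans _ AB)// ler_wpM2l// abs2_ge0.
  rewrite ler_pdivlMr//.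
  have : 0 <= 2 * M * (4 - A * c) by rewrite mulr_ge0 ?subr_ge0// mulr_ge0.
  lra.
rewrite big_split /= -mulr_sumr fejer_partition// mulr1 sumr_const card_ord.
have -> : (8 * M / c / m%:R ^+ 2) *+ m = 8 * M / c / m%:R.
  by rewrite -mulr_natr; field; rewrite (gt_eqF c0) (gt_eqF m0).
have : 8 * M / c / m%:R <= e / 2; last by lra.
have e20 : 0 < e / 2 by rewrite divr_gt0.
rewrite ltr_pdivrMr// in n0P.
rewrite ler_pdivrMr// (le_trans (ltW n0P))// mulrC ler_wpM2l ?(ltW e20)//.
by rewrite ler_nat.
Qed.

End Fejer.

Section EsumSeq.
Local Open Scope classical_set_scope.
Context {R : realType} {I : choiceType} (a : I -> R).

Lemma esum_seq_le (M : \bar R) :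
  (forall s : seq I, uniq s -> ((\sum_(i <- s) a i)%:E <= M)%E) ->
  (\esum_(i in [set: I]) (a i)%:E <= M)%E.
Proof.
move=> H; apply: ge_ereal_sup => _ /= [X [finX _] <-].
by rewrite fsbig_finite//= sumEFin; exact: H.
Qed.

Lemma seq_le_esum (s : seq I) : uniq s ->
  ((\sum_(i <- s) a i)%:E <= \esum_(i in [set: I]) (a i)%:E)%E.
Proof.
move=> us; apply: esum_ge; exists [set` s]; first by split.
by rewrite -fsbig_seq// sumEFin.
Qed.
End EsumSeq.

(** * Density of trigonometric polynomials and Parseval's identity *)

Section Parseval.
Local Open Scope classical_set_scope.
Context {R : realType} (L : R).
Hypothesis L0 : 0 < L.
Local Notation mu := (@lebesgue_measure R).
Local Notation D := (`[0, L[ : set R).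
Local Notation nrm := (norm2D L).
Local Notation trig := (trig L).

Lemma norm2D_ge0 F : 0 <= nrm F.
Proof. by apply: Rintegral_ge0 => x _; exact: abs2_ge0. Qed.

Lemma norm2D_integrable F : bounded_meas F -> mu.-integrable D (EFin \o (fun x => abs2 (F x))).
Proof. by move=> bF; apply: bm_abs2_integrable => //; exact: itv_fin. Qed.

Lemma norm2D_add_le F G : bounded_meas F -> bounded_meas G ->
  nrm (fun x => F x + G x) <= 2 * nrm F + 2 * nrm G.
Proof.
move=> bF bG; have iF := norm2D_integrable _ bF; have iG := norm2D_integrable _ bG.
rewrite -!RintegralZl// -RintegralD//; [|exact: integrable_scale..].
apply: le_Rintegral => //.
- by apply: norm2D_integrable; exact: bmD.
- by apply: integrable_add => //; exact: integrable_scale.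
- by move=> x _; exact: abs2D_le.
Qed.

(** Bounded convergence of the Fejer means. The open interval ]0, L[ is used because convergence is
    known at interior points only. *)
Lemma continuous_trig_approx (g : R -> R) (M e : R) : continuous g -> (forall y, `|g y| <= M) -> 0 < e ->
  exists2 F, trig F & nrm (fun x => (g x)%:C - F x) <= e.
Proof.
move=> cg gM e0.
have M0 : 0 <= M by exact: le_trans (normr_ge0 _) (gM 0).
have bg : bounded_meas (fun x => (g x)%:C).
  split; first by apply: cmeas_real; exact: continuous_measurable_fun.
  by exists (M ^+ 2) => x; rewrite abs2_real -real_normK ?num_real// ler_sqr ?nnegrE.
pose h n x := (fejer_mean L g n.+1 x)%:C.
have tF n : trig (h n) by exact: trig_fejer_mean.
have bd n := bmB _ _ bg (trig_bm _ _ (tF n)).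
pose f_ n x := (abs2 ((g x)%:C - h n x))%:E.
have hM n x : abs2 ((g x)%:C - h n x) <= (2 * M) ^+ 2.
  rewrite -rmorphB /= abs2_real -real_normK ?num_real// ler_sqr ?nnegrE ?mulr_ge0//.
  rewrite (le_trans (ler_normB _ _))// mulr_natl mulr2n lerD//.
  exact: fejer_mean_bound.
have mI : measurable (`]0, L[ : set R) by exact: measurable_itv.
have Ifin : (mu (`]0%R, L[%classic : set R) < +oo)%E.
  by rewrite lebesgue_measure_itv /=; case: ifP => _; rewrite ?ltry// -EFinB ltry.
have [] := @dominated_convergence _ _ _ mu (`]0, L[%classic : set R) mI f_
  (fun=> 0%E : \bar R) (fun=> ((2 * M) ^+ 2)%:E).
- move=> n; apply/measurable_EFinP; apply: measurable_funTS.
  by apply: measurable_abs2; case: (bd n).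
- exact: measurable_cst.
- apply: aeW => x; rewrite /= in_itv /= => xI.
  apply: cvg_EFin; first exact: nearW.
  apply/cvgrPdist_le => eps eps0; rewrite /f_ /=.
  pose e' := Num.min 1 eps.
  have e'0 : 0 < e' by rewrite lt_min ltr01.
  have [n0 n0P] := fejer_mean_cvg _ L0 g M x cg gM xI e' e'0.
  near=> n.
  rewrite sub0r normrN ger0_norm ?abs2_ge0// -rmorphB /= abs2_real -real_normK ?num_real//.
  have ne : `|g x - fejer_mean L g n.+1 x| <= e' by apply: n0P; near: n; exists n0.
  have e'1 : e' <= 1 by rewrite ge_min lexx.
  have e'e : e' <= eps by rewrite ge_min lexx orbT.
  by have := normr_ge0 (g x - fejer_mean L g n.+1 x); nra.
- exact: (@bounded_integrable _ _ (fun=> (2 * M) ^+ 2) (((2 * M) ^+ 2) ^+ 2)).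
- apply: aeW => x n _; rewrite /f_ /= ger0_norm ?abs2_ge0// lee_fin.
  exact: hM.
move=> _ _; rewrite integral0 => /fine_cvg/cvgrPdist_le/(_ e e0)[n0 _ /(_ n0 (leqnn _))].
rewrite sub0r normrN => H; exists (h n0) => //.
apply: le_trans (ler_norm _) (le_trans _ H).
rewrite le_eqVlt; apply/orP; left; apply/eqP; congr `|_|.
rewrite /norm2D -Rintegral_itv_obnd_cbnd//.
apply: bm_abs2_integrable => //.
Unshelve. all: by end_near. Qed.

(** Continuous functions approximate f in L^1 only; after clipping them to [-M, M], |f - h|^2 <= 2M
    |f - h| turns this into approximation in L^2. *)
Lemma real_trig_approx (f : R -> R) (M e : R) : measurable_fun setT f -> (forall y, `|f y| <= M) -> 0 < e ->
  exists2 F, trig F & nrm (fun x => (f x)%:C - F x) <= e.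
Proof.
move=> mf fM e0.
have M0 : 0 <= M by exact: le_trans (normr_ge0 _) (fM 0).
have Dfin : (mu D < +oo)%E by exact: itv_fin.
have fI : mu.-integrable D (EFin \o f).
  apply: (@bounded_integrable _ _ f (M ^+ 2)) => // x _.
  by rewrite -real_normK ?num_real// ler_sqr ?nnegrE.
have [g_ [cg ig cvg]] := approximation_continuous_integrable (measurable_itv _) Dfin fI.
(* Chosen so that 2M e' <= e/4. *)
pose e' := e / (8 * (M + 1)).
have e'0 : 0 < e' by rewrite divr_gt0// mulr_gt0// ltr_wpDl.
have [n nP] : exists n, \int[mu]_(x in D) `|f x - g_ n x| <= e'.
  have /fine_cvg/cvgrPdist_le/(_ e' e'0)[n0 _ /(_ n0 (leqnn _))] := cvg.
  by rewrite sub0r normrN => H; exists n0; apply: le_trans (ler_norm _) H.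
(* This is [g_ n] clipped to [-M, M], in a form whose continuity is immediate. As |f| <= M, clipping
   does not increase the distance to f. *)
pose h x := (`|g_ n x + M| - `|g_ n x - M|) / 2.
have ch : continuous h.
  move=> x; apply: cvgMl; apply: cvgB; apply: cvg_norm.
    by apply: cvgD; [exact: cg|exact: cvg_cst].
  by apply: cvgB; [exact: cg|exact: cvg_cst].
have hfg x : `|h x| <= M /\ `|f x - h x| <= `|f x - g_ n x|.
  have := fM x; rewrite /h !ler_norml => /andP[f1 f2].
  by split; case: (ger0P (g_ n x + M)); case: (ger0P (g_ n x - M));
    case: (ger0P (f x - g_ n x)) => *; apply/andP; split; lra.
have hM x : `|h x| <= M by case: (hfg x).
have e20 : 0 < e / 4 by rewrite divr_gt0.
have [F tF FP] := continuous_trig_approx h M (e / 4) ch hM e20.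
exists F => //.
have bf : bounded_meas (fun x => (f x)%:C).
  split; first exact: cmeas_real.
  by exists (M ^+ 2) => x; rewrite abs2_real -real_normK ?num_real// ler_sqr ?nnegrE.
have bh : bounded_meas (fun x => (h x)%:C).
  split; first by apply: cmeas_real; exact: continuous_measurable_fun.
  by exists (M ^+ 2) => x; rewrite abs2_real -real_normK ?num_real// ler_sqr ?nnegrE.
have bfh := bmB _ _ bf bh.
have -> : (fun x => (f x)%:C - F x) = (fun x => ((f x)%:C - (h x)%:C) + ((h x)%:C - F x)).
  by apply/funext => x; rewrite addrA subrK.
rewrite (le_trans (norm2D_add_le _ _ bfh (bmB _ _ bh (trig_bm _ _ tF))))//.
suff : nrm (fun x => (f x)%:C - (h x)%:C) <= e / 4 by lra.
have ifg : mu.-integrable D (EFin \o (fun x => `|f x - g_ n x|)).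
  have := @integrable_abse _ _ _ mu D _ (integrable_sub D f (g_ n) (measurable_itv _) fI (ig n)).
  by [].
apply: (@le_trans _ _ (\int[mu]_(x in D) (2 * M * `|f x - g_ n x|))).
  apply: le_Rintegral => //; first exact: norm2D_integrable.
    exact: integrable_scale.
  move=> x _; rewrite -rmorphB /= abs2_real -real_normK ?num_real//.
  have [hMx hf] := hfg x; have := normr_ge0 (f x - h x).
  have : `|f x - h x| <= 2 * M.
    by rewrite (le_trans (ler_normB _ _))// mulr_natl mulr2n lerD.
  nra.
rewrite RintegralZl// (@le_trans _ _ (2 * M * e'))//.
  by rewrite ler_wpM2l// mulr_ge0.
rewrite /e' mulrA ler_pdivrMr ?mulr_gt0 ?ltr_wpDl//.
have : 0 <= M * e by rewrite mulr_ge0// ltW.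
lra.
Qed.

Lemma trig_approx phi (e : R) : bounded_meas phi -> 0 < e ->
  exists2 F, trig F & nrm (fun x => phi x - F x) <= e.
Proof.
move=> [[mR mI] [M phiM]] e0.
have bnd (u v : R) : u ^+ 2 + v ^+ 2 <= M -> `|u| <= M + 1.
  move=> uv; have := sqr_ge0 (`|u| - 1); rewrite sqrrB1 real_normK ?num_real//.
  by have := sqr_ge0 v; have := sqr_ge0 u; have := normr_ge0 u; nra.
have e40 : 0 < e / 4 by rewrite divr_gt0.
have [F tF FP] := real_trig_approx _ (M + 1) (e / 4) mR
  (fun y => bnd _ _ (phiM y)) e40.
have [G tG GP] := real_trig_approx _ (M + 1) (e / 4) mI
  (fun y => bnd _ (complex.Re (phi y)) ltac:(by rewrite addrC; exact: phiM)) e40.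
exists (fun x => F x + (0 +i* 1) * G x); first by apply: trigD => //; exact: trigZ.
have bu : bounded_meas (fun x => (complex.Re (phi x))%:C - F x).
  apply: bmB; last exact: trig_bm tF.
  split; first exact: cmeas_real.
  exists M => x; rewrite abs2_real; apply: le_trans (phiM x).
  by rewrite lerDl sqr_ge0.
have bv : bounded_meas (fun x => (complex.Im (phi x))%:C - G x).
  apply: bmB; last exact: trig_bm tG.
  split; first exact: cmeas_real.
  exists M => x; rewrite abs2_real; apply: le_trans (phiM x).
  by rewrite lerDr sqr_ge0.
have -> : (fun x => phi x - (F x + (0 +i* 1) * G x)) =
   (fun x => ((complex.Re (phi x))%:C - F x) + (0 +i* 1) * ((complex.Im (phi x))%:C - G x)).
  apply/funext => x; rewrite opprD addrA mulrBr [RHS]addrACA -opprD -addrA opprD addrA.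
  rewrite [in LHS](_ : phi x = (complex.Re (phi x))%:C + (0 +i* 1) * (complex.Im (phi x))%:C).
    by ring.
  by apply: complex_ext; rewrite ?(Re_add, Im_add, Re_mul, Im_mul) /=; ring.
rewrite (le_trans (norm2D_add_le _ _ bu (bmM _ _ (bm_cst _) bv)))//.
have -> : nrm (fun x => (0 +i* 1) * ((complex.Im (phi x))%:C - G x)) =
   nrm (fun x => (complex.Im (phi x))%:C - G x).
  apply: eq_Rintegral => x _; rewrite abs2M [abs2 (0 +i* 1)](_ : _ = 1) ?mul1r//.
  by rewrite /abs2 /= expr0n expr1n add0r.
lra.
Qed.

Lemma parseval phi : bounded_meas phi ->
  (\esum_(n in [set: int]) (abs2 (fcoef L phi n))%:E = (L * nrm phi)%:E)%E.
Proof.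
move=> bphi; have Lge0 := ltW L0; apply/eqP; rewrite eq_le; apply/andP; split.
  apply: esum_seq_le => s us; rewrite lee_fin -ler_pdivrMl//.
  have := norm2D_ge0 (fun x => phi x - \sum_(n <- s) (L^-1%:C * fcoef L phi n) * fbasis L n x).
  rewrite trig_defect// [X in L * X]big1 => [|n _]; last by rewrite subrr abs2_0.
  by rewrite mulr0 addr0 subr_ge0.
apply/lee_addgt0Pr => e e0.
have [F [s [d [us FE]]] Fe] := trig_approx phi (e / L) bphi (divr_gt0 e0 L0).
apply: (@le_trans _ _ ((\sum_(n <- s) abs2 (fcoef L phi n))%:E + e%:E)%E); last first.
  by rewrite leeD2r// seq_le_esum.
rewrite -EFinD lee_fin.
have E : (fun x => phi x - F x) = (fun x => phi x - \sum_(n <- s) d n * fbasis L n x).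
  by apply/funext => x; rewrite FE.
move: Fe; rewrite E trig_defect// => Fe.
set S := \sum_(n <- s) abs2 (fcoef L phi n) in Fe *.
have : 0 <= L * \sum_(n <- s) abs2 (d n - L^-1%:C * fcoef L phi n).
  by rewrite mulr_ge0// sumr_ge0// => n _; exact: abs2_ge0.
move: Fe; set T := L * _ => Fe T0.
have H : nrm phi - L^-1 * S <= e / L by lra.
have := ler_wpM2l Lge0 H; rewrite mulrBr mulrA divff ?gt_eqF// mul1r mulrCA divff ?gt_eqF// mulr1.
by lra.
Qed.
End Parseval.

(** * Lattice samples of the window *)

Section Truncation.
Local Open Scope classical_set_scope.
Context {R : realType}.
Local Notation mu := (@lebesgue_measure R).

Lemma norm2D_trig (L : R) s d : 0 < L -> uniq s ->
  norm2D L (fun x => \sum_(n <- s) d n * fbasis L n x) = L * \sum_(n <- s) abs2 (d n).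
Proof.
move=> L0 us; have := trig_defect L L0 (fun=> 0) s d (bm_cst 0) us.
have -> : norm2D L (fun x => 0 - \sum_(n <- s) d n * fbasis L n x) =
    norm2D L (fun x => \sum_(n <- s) d n * fbasis L n x).
  by apply: eq_Rintegral => x _; rewrite sub0r abs2N.
have f0 n : fcoef L (fun=> 0) n = 0.
  by rewrite /fcoef -[RHS](cint0 (`[0, L[ : set R)); apply: eq_cint => x _; rewrite mul0r.
have -> : norm2D L (fun=> 0) = 0 :> R.
  by rewrite /norm2D; under eq_Rintegral do rewrite abs2_0; rewrite /Rintegral integral0.
move=> ->; rewrite big1 => [|n _]; last by rewrite f0 abs2_0.
rewrite mulr0 subr0 add0r; congr (_ * _); apply: eq_bigr => n _.
by rewrite f0 mulr0 subr0.
Qed.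

(** Exponential polynomials are in general unbounded on the line. The cut puts them in
    [bounded_meas], and the value 0 discards shifted sample points that leave the period. *)
Definition trunc (p : R) (F : R -> R[i]) (y : R) : R[i] :=
  if 0 <= y < p then F y else 0.

Lemma trunc_bm p F : 0 < p -> ep F -> bounded_meas (trunc p F).
Proof.
move=> p0 eF; split.
  have -> : trunc p F = fun y => (\1_(`[0, p[ : set R) y)%:C * F y.
    apply/funext => y; rewrite /trunc indicE.
    rewrite (_ : (y \in _) = (0 <= y < p)); first by case: ifP; rewrite ?mul1r ?mul0r.
    by apply/idP/idP; rewrite inE /= in_itv.
  apply: cmeasM; last by have [cR cI] := ep_continuous _ eF; exact: cmeas_continuous.
  by apply: cmeas_real; apply: measurable_indic; exact: measurable_itv.
have [K K0 KP] := ep_ubound _ 0 p eF (ltW p0).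
exists K => y; rewrite /trunc; case: ifP => [/andP[y0 yp]|_].
  by apply: KP; rewrite y0 ltW.
by rewrite abs2_0 ltW.
Qed.

Lemma norm2D_shift_le (b p c : R) F : bounded_meas F ->
  (forall y, ~~ (0 <= y < p) -> F y = 0) ->
  \int[mu]_(y in `[0, b[) abs2 (F (y + c)) <= norm2D p F.
Proof.
move=> bF F0.
have mF : measurable_fun setT (fun y => abs2 (F y)) by apply: measurable_abs2; case: bF.
have E : (fun y => y + c) @^-1` `[c, b + c[ = `[0, b[.
  by rewrite shift_preimage_itv subrr addrK.
rewrite -E (@Rintegral_shift _ (fun y => abs2 (F y)))//.
have fin p' q' : (\int[mu]_(y in `[p', q'[) (abs2 (F y))%:E)%E \is a fin_num.
  apply: integrable_fin_num => //.
  by apply: bm_abs2_integrable => //; exact: itv_fin.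
apply: fine_le => //.
have -> : (\int[mu]_(y in `[0%R, p[) (abs2 (F y))%:E = \int[mu]_y (abs2 (F y))%:E)%E.
  rewrite integral_mkcond; apply: eq_integral => y _; rewrite patchE.
  case: ifPn => // yp; rewrite F0 ?abs2_0//.
  by apply: contra yp => H; rewrite inE /= in_itv.
apply: ge0_subset_integral => //; first exact/measurable_EFinP.
by move=> y _; rewrite lee_fin abs2_ge0.
Qed.

Lemma norm2D_mono_le (p q : R) F : p <= q -> bounded_meas F -> norm2D p F <= norm2D q F.
Proof.
move=> pq bF.
have mF : measurable_fun setT (fun y => abs2 (F y)) by apply: measurable_abs2; case: bF.
have fin p' q' : (\int[mu]_(y in `[p', q'[) (abs2 (F y))%:E)%E \is a fin_num.
  apply: integrable_fin_num => //.
  by apply: bm_abs2_integrable => //; exact: itv_fin.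
apply: fine_le => //; apply: ge0_subset_integral => //.
- exact/measurable_funTS/measurable_EFinP.
- by move=> y _; rewrite lee_fin abs2_ge0.
- by apply: subset_itvl; rewrite bnd_simp.
Qed.
End Truncation.

Section LatticeSum.
Local Open Scope classical_set_scope.
Context {R : realType} {N : nat} (a w : 'I_N -> R[i]) (alpha beta : R).
Hypothesis ha : forall k, a k != 0.
Hypothesis hw : forall k, complex.Re (w k) != 0.
Hypothesis hwd : forall k l, k != l -> complex.Re (w k) != complex.Re (w l).
Hypothesis hm0 : forall xi : R, 0 < xi -> m0 a w xi != 0.
Hypothesis alpha0 : 0 < alpha.
Hypothesis beta0 : 0 < beta.
Hypothesis alphabeta : alpha * beta < 1.
Hypothesis irrational : forall q : rat, alpha * beta != ratr q.
Local Notation mu := (@lebesgue_measure R).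
Local Notation p := (alpha^-1).

Definition window (x : R) : R[i] := \sum_l a l / (x%:C - (0 +i* 1) * w l).
Definition lattice_point (t : R) (k : int) : R := t + k%:~R / beta.
Definition period_factor t l k : R[i] := ev w l p * cexpi (2 * pi * p * lattice_point t k).
Definition Cfun t (s : seq int) (c : int -> R[i]) (y : R) : R[i] :=
  \sum_(k <- s) c k * cexpi (2 * pi * y * lattice_point t k).
Definition Hfun t (s : seq int) (c : int -> R[i]) (y : R) (l : 'I_N) : R[i] :=
  \sum_(k <- s) c k / (1 - period_factor t l k) * cexpi (2 * pi * y * lattice_point t k).
Definition Sfun t s c : R -> R[i] := Ssum a w (Hfun t s c).

Lemma p_gt0 : 0 < p. Proof. by rewrite invr_gt0. Qed.
Lemma beta_lt_p : beta < p.
Proof. by rewrite -[p]mul1r ltr_pdivlMr// mulrC. Qed.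

Lemma irr_lattice (j : nat) (m : int) : (0 < j)%N -> j%:R * p + m%:~R * beta != 0.
Proof.
move=> j0; apply/eqP => E.
have m0 : m%:~R != 0 :> R.
  apply/eqP => m0; move: E; rewrite m0 mul0r addr0 => /eqP.
  by rewrite mulf_eq0 pnatr_eq0 (gtn_eqF j0)/= invr_eq0 (gt_eqF alpha0).
have := irrational (- (j%:R / m%:~R)); rewrite rmorphN fmorph_div /= ratr_nat ratr_int.
move/eqP; apply.
have an0 : alpha != 0 by rewrite gt_eqF.
have -> : beta = - (j%:R * p) / m%:~R.
  by apply: (mulIf m0); rewrite mulfVK// mulrC; apply/eqP; rewrite -subr_eq0 opprK addrC E.
by field; rewrite an0 m0.
Qed.

(* The modulus e^{2 pi p Re w_l} of the period factor depends on l only and is not 1. *)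
Lemma period_factor_bound : exists2 d : R, 0 < d &
  forall t l k, d <= abs2 (1 - period_factor t l k).
Proof.
pose r l := expR (2 * pi * p * complex.Re (w l)).
have Q2 t l k : abs2 (period_factor t l k) = r l ^+ 2.
  rewrite /period_factor abs2M abs2_cexpi mulr1 abs2_cexp Re_mul /= mul0r subr0.
  by rewrite /r -expRM_natl; congr expR; ring.
have bnd t l k : (1 - r l) ^+ 2 <= abs2 (1 - period_factor t l k).
  have := Q2 t l k; set Q := period_factor t l k; move=> QE.
  have r0 : 0 <= r l by exact: expR_ge0.
  have ReQ : complex.Re Q <= r l.
    rewrite (le_trans (ler_norm _))// -(ler_pXn2r (n := 2))// ?nnegrE// real_normK ?num_real//.
    by rewrite -QE /abs2 lerDl sqr_ge0.
  have -> : abs2 (1 - Q) = 1 - 2 * complex.Re Q + abs2 Q.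
    by rewrite /abs2 Re_add Im_add Re_opp Im_opp /=; ring.
  by rewrite QE; lra.
have rpos l : 0 < (1 - r l) ^+ 2.
  rewrite exprn_even_gt0//= subr_eq0 eq_sym; apply/eqP => H.
  have : 2 * pi * p * complex.Re (w l) = 0.
    by apply: expR_inj; rewrite expR0.
  apply/eqP; rewrite !mulf_neq0 ?invr_eq0 ?(gt_eqF alpha0)//.
  by rewrite gt_eqF// pi_gt0.
exists (\big[Num.min/1]_l (1 - r l) ^+ 2).
  by elim/big_ind : _ => // x y x0 y0; rewrite lt_min x0.
move=> t l k; apply: le_trans (bnd t l k).
exact: bigmin_le_cond.
Qed.

Lemma period_factor_neq1 t l k : 1 - period_factor t l k != 0.
Proof.
have [d d0 dP] := period_factor_bound.
by rewrite -abs2_gt0 (lt_le_trans d0).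
Qed.

(** Since beta x_k = beta t + k, translation by beta multiplies every exponential by the same e^(2
    pi i beta t). The relation between H and C is 1/(1 - z) - z/(1 - z) = 1, term by term. *)
Lemma cocycle_fun t s c :
  cocycle w beta p (Hfun t s c) (Cfun t s c) (cexpi (2 * pi * beta * t)).
Proof.
have bn0 : beta != 0 by rewrite gt_eqF.
have E y k : cexpi (2 * pi * (y + beta) * lattice_point t k) =
    cexpi (2 * pi * beta * t) * cexpi (2 * pi * y * lattice_point t k) :> R[i].
  rewrite -[RHS]mul1r -(cexpi_2piZ k) -!cexpiD; congr cexpi.
  by rewrite /lattice_point; field.
split.
- exact: abs2_cexpi.
- move=> y l; rewrite /Hfun mulr_sumr; apply: eq_bigr => k _.
  by rewrite E mulrCA.
- move=> y; rewrite /Cfun mulr_sumr; apply: eq_bigr => k _.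
  by rewrite E mulrCA.
- move=> y l; rewrite /Hfun /Cfun mulr_sumr -sumrB; apply: eq_bigr => k _.
  have -> : cexpi (2 * pi * (y + p) * lattice_point t k) =
      cexpi (2 * pi * y * lattice_point t k) * cexpi (2 * pi * p * lattice_point t k) :> R[i].
    by rewrite -cexpiD; congr cexpi; ring.
  have := period_factor_neq1 t l k; rewrite /period_factor.
  set q := ev w l p; set z := cexpi (2 * pi * p * _); set z' := cexpi _ => qz.
  have -> : q * (c k / (1 - q * z) * (z' * z)) = c k / (1 - q * z) * z' * (q * z) by ring.
  by rewrite -[X in X - _]mulr1 -mulrBr mulrAC divfK.
Qed.

Lemma point_basis t k y : cexpi (2 * pi * y * lattice_point t k) =
  cexpi (2 * pi * y * t) * fbasis beta k y :> R[i].
Proof. by rewrite /fbasis -cexpiD; congr cexpi; rewrite /lattice_point; ring. Qed.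

Lemma norm2D_Cfun t s c : uniq s ->
  norm2D beta (Cfun t s c) = beta * \sum_(k <- s) abs2 (c k).
Proof.
move=> us; rewrite -norm2D_trig//; apply: eq_Rintegral => y _.
rewrite /Cfun; under eq_bigr do rewrite point_basis mulrCA.
by rewrite -mulr_sumr abs2M abs2_cexpi mul1r.
Qed.

(** Frequency k for the period beta is frequency Mk for the period M beta. Several periods are
    needed because [0, p[ is longer than beta. *)
Lemma norm2D_Hfun t s c l (M : nat) : (0 < M)%N -> uniq s ->
  norm2D (M%:R * beta) (Hfun t s c ^~ l) =
  M%:R * beta * \sum_(k <- s) abs2 (c k / (1 - period_factor t l k)).
Proof.
move=> M0 us; have MR : M%:R != 0 :> R by rewrite pnatr_eq0 -lt0n.
have Mz : M%:Z != 0 by rewrite eqz_nat -lt0n.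
have bn0 : beta != 0 by rewrite gt_eqF.
pose d k := c k / (1 - period_factor t l k).
have us' : uniq [seq M%:Z * k | k <- s].
  by rewrite map_inj_uniq// => x y; apply: mulfI.
have := norm2D_trig (M%:R * beta) _ (fun m => d (m %/ M%:Z)%Z) _ us'.
rewrite big_map mulr_gt0 ?ltr0n// => /(_ isT).
under [X in _ = _ * X]eq_bigr do rewrite mulKz//.
move=> <-; apply: eq_Rintegral => y _.
rewrite big_map /Hfun (eq_bigr (fun k => cexpi (2 * pi * y * t) *
  (d k * fbasis beta k y))) => [|k _]; last by rewrite point_basis mulrCA.
rewrite -mulr_sumr abs2M abs2_cexpi mul1r; congr abs2; apply: eq_bigr => k _.
rewrite mulKz//; congr (_ * _); rewrite /fbasis; congr cexpi.
by rewrite intrM /=; field; rewrite MR bn0.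
Qed.

Lemma ep_Sfun t s c : ep (Sfun t s c).
Proof.
apply: ep_sum => l; apply: epM.
  apply: epM; first exact: ep_cst.
  by apply: ep_ext (ep_ev w l 0) => y; rewrite addr0.
apply: ep_sum => k; apply: ep_ext (ep_exp (c k / (1 - period_factor t l k))
  (0 +i* (2 * pi * lattice_point t k))) => y /=.
rewrite -cexp_imag; congr (_ * cexp _).
by apply: complex_ext; rewrite ?Re_mul ?Im_mul /=; ring.
Qed.

(** Each term integrates to (e^(lam p) - 1) / lam. Since e^(lam p) is the period factor, the
    denominator built into H_l cancels, and 1/lam is the wanted pole up to the factor 2 pi i; this
    is the origin of H_l. *)
Lemma fcoef_Sfun t s c m :
  fcoef p (fun y => (0 -i* (2 * pi)) * trunc p (Sfun t s c) y) m =
  \sum_(k <- s) c k * window (lattice_point t k - alpha * m%:~R).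
Proof.
have p0 := p_gt0; have an0 : alpha != 0 by rewrite gt_eqF.
pose lam (l : 'I_N) (k : int) : R[i] :=
  (2 * pi)%:C * (w l + (0 +i* 1) * (lattice_point t k - alpha * m%:~R)%:C).
pose coef (l : 'I_N) k : R[i] := (0 -i* (2 * pi)) * (a l * (c k / (1 - period_factor t l k))).
pose F l k y := coef l k * trunc p (fun y => cexp (y%:C * lam l k)) y.
have bF l k : bounded_meas (F l k).
  apply: bmM; first exact: bm_cst.
  apply: trunc_bm => //; apply: ep_ext (ep_exp 1 (lam l k)) => y; exact: mul1r.
have mDp : measurable (`[0, p[ : set R) by exact: measurable_itv.
rewrite /fcoef (@eq_cint _ _ _ (fun y => \sum_l \sum_(k <- s) F l k y)); last first.
  move=> y yD; have yp : 0 <= y < p by have := set_mem yD; rewrite /= in_itv.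
  rewrite /F /trunc yp /Sfun /Ssum -mulrA mulr_suml mulr_sumr; apply: eq_bigr => l _.
  rewrite /Hfun mulr_sumr mulr_suml mulr_sumr; apply: eq_bigr => k _.
  have -> : cexp (y%:C * lam l k) = ev w l y * cexpi (2 * pi * y * lattice_point t k) *
      conjc (fbasis p m y).
    rewrite fbasisJ /fbasis -mulrA -cexpiD /ev -cexp_imag -cexpD; congr cexp.
    rewrite /lam; apply: complex_ext; rewrite ?(Re_mul, Im_mul, Re_add, Im_add) /=;
      rewrite ?mulrNz ?invrK; ring.
  by rewrite /coef; ring.
rewrite cint_sum//; [|exact: itv_fin|by move=> l; exact: bm_sum].
under eq_bigr => l _ do rewrite (cint_sum _ _ _ _ mDp (itv_fin _ _))//.
rewrite exchange_big /=; apply: eq_bigr => k _.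
rewrite /window mulr_sumr; apply: eq_bigr => l _.
have ReLam : complex.Re (lam l k) = 2 * pi * complex.Re (w l).
  by rewrite /lam !(Re_mul, Im_mul, Re_add, Im_add) /=; ring.
have lam0 : lam l k != 0.
  apply/eqP => /(congr1 (@complex.Re R)); rewrite ReLam /= => /eqP.
  by rewrite !mulf_eq0 (negbTE (hw l)) (gt_eqF (pi_gt0 R)) pnatr_eq0.
have -> : cint `[0, p[ (F l k) = coef l k * ((cexp (p%:C * lam l k) - 1) / lam l k).
  rewrite -cint_cexp// -cintZ//.
    by apply: eq_cint => y; rewrite inE /= in_itv /= => yp; rewrite /F /trunc yp.
  have [cR cI] := continuous_cexp 1 (lam l k).
  have cc : {within `[0, p], continuous (fun y : R => complex.Re (cexp (y%:C * lam l k)))}.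
    by apply: continuous_subspaceT; under eq_fun do rewrite -[cexp _]mul1r.
  have cc' : {within `[0, p], continuous (fun y : R => complex.Im (cexp (y%:C * lam l k)))}.
    by apply: continuous_subspaceT; under eq_fun do rewrite -[cexp _]mul1r.
  by split; apply: (@integrableS _ _ _ mu `[0, p]) => //;
    [exact: subset_itv_co_cc|apply: continuous_compact_integrable => //; exact: segment_compact
    |exact: subset_itv_co_cc|apply: continuous_compact_integrable => //; exact: segment_compact].
have -> : cexp (p%:C * lam l k) = period_factor t l k.
  rewrite /period_factor /ev -[RHS]mulr1 -(cexpi_2piZ (- m)) -!cexp_imag -!cexpD; congr cexp.
  rewrite /lam; apply: complex_ext; rewrite ?(Re_mul, Im_mul, Re_add, Im_add) /=;
    rewrite ?mulrNz; field; exact: an0.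
have Qn := period_factor_neq1 t l k.
pose D := ((lattice_point t k - alpha * m%:~R)%:C - (0 +i* 1) * w l).
have lamE : lam l k = (0 +i* (2 * pi)) * D.
  by rewrite /lam /D; apply: complex_ext; rewrite ?(Re_mul, Im_mul, Re_add, Im_add, Re_opp, Im_opp) /=; ring.
have D0 : D != 0 by apply: contraNneq lam0 => D0; rewrite lamE D0 mulr0.
have i0 : 0 +i* (2 * pi) != 0 :> R[i].
  by apply: contraNneq lam0 => i0; rewrite lamE i0 mul0r.
rewrite -/D lamE /coef.
have -> : (0 -i* (2 * pi)) = - (0 +i* (2 * pi)) :> R[i] by apply: complex_ext; rewrite ?Re_opp ?Im_opp /= ?oppr0.
set I := 0 +i* (2 * pi) in i0 *; set Q := period_factor t l k in Qn *.
by field; rewrite Qn i0 D0.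
Qed.
End LatticeSum.

(** Moves the integers with |m| <= M to the ordinals below 2M + 1, so that they can index a finite
    sum. *)
Lemma shift_index (m : int) (M : nat) : (`|m| <= M)%N ->
  (`|(m + M%:Z)%R| < (2 * M).+1)%N /\
  forall R : pzRingType, `|(m + M%:Z)%R|%N%:R = m%:~R + M%:R :> R.
Proof.
move=> mM; split; first by lia.
have E : `|(m + M%:Z)%R|%N%:Z = m + M%:Z by rewrite gez0_abs//; lia.
by move=> R; rewrite pmulrn E intrD -pmulrn.
Qed.

Section RintegralSum.
Local Open Scope classical_set_scope.
Context {R : realType}.
Local Notation mu := (@lebesgue_measure R).

Lemma integrable_bigsum (I : Type) (r : seq I) (D : set R) (f : I -> R -> R) : measurable D ->
  (forall i, mu.-integrable D (EFin \o f i)) ->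
  mu.-integrable D (EFin \o (fun x => \sum_(i <- r) f i x)).
Proof.
move=> mD fi; elim: r => [|i r IH].
  rewrite (_ : (fun x => _) = (fun=> 0)); last by apply/funext => x; rewrite big_nil.
  exact: integrable0.
rewrite (_ : (fun x => _) = (fun x => f i x + \sum_(j <- r) f j x)).
  exact: integrable_add.
by apply/funext => x; rewrite big_cons.
Qed.

Lemma Rintegral_sum (I : Type) (r : seq I) (D : set R) (f : I -> R -> R) : measurable D ->
  (forall i, mu.-integrable D (EFin \o f i)) ->
  \int[mu]_(x in D) (\sum_(i <- r) f i x) = \sum_(i <- r) \int[mu]_(x in D) f i x.
Proof.
move=> mD fi; elim: r => [|i r IH].
  by rewrite big_nil; under eq_Rintegral do rewrite big_nil; rewrite /Rintegral integral0.
rewrite big_cons -IH -RintegralD//; last exact: integrable_bigsum.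
by apply: eq_Rintegral => x _; rewrite big_cons.
Qed.
End RintegralSum.

(** * Two-sided bounds for the lattice samples *)

Section LatticeBounds.
Local Open Scope classical_set_scope.
Context {R : realType} {N : nat} (a w : 'I_N -> R[i]) (alpha beta : R).
Hypothesis ha : forall k, a k != 0.
Hypothesis hw : forall k, complex.Re (w k) != 0.
Hypothesis hwd : forall k l, k != l -> complex.Re (w k) != complex.Re (w l).
Hypothesis hm0 : forall xi : R, 0 < xi -> m0 a w xi != 0.
Hypothesis alpha0 : 0 < alpha.
Hypothesis beta0 : 0 < beta.
Hypothesis alphabeta : alpha * beta < 1.
Hypothesis irrational : forall q : rat, alpha * beta != ratr q.
Local Notation mu := (@lebesgue_measure R).
Local Notation p := (alpha^-1).
Local Notation Sf := (Sfun a w alpha beta).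
Local Notation Hf := (Hfun w alpha beta).
Local Notation Cf := (Cfun beta).
Local Notation St t s c := (trunc p (Sf t s c)).

Lemma St_bm t s c : bounded_meas (St t s c).
Proof. by apply: trunc_bm; [exact: p_gt0|exact: ep_Sfun]. Qed.

Lemma cexpi_bm (x : R) : bounded_meas (fun y => cexpi (2 * pi * y * x)).
Proof.
split; last by exists 1 => y; rewrite abs2_cexpi.
have E y : cexpi (2 * pi * y * x) = 1 * cexp (y%:C * (0 +i* (2 * pi * x))).
  rewrite mul1r -cexp_imag; congr cexp.
  by apply: complex_ext; rewrite ?Re_mul ?Im_mul /=; ring.
have [cR cI] := continuous_cexp 1 (0 +i* (2 * pi * x)).
by apply: cmeas_continuous; under eq_fun do rewrite E.
Qed.

Lemma Cf_bm t s c : bounded_meas (Cf t s c).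
Proof. by apply: bm_sum => k; apply: bmM; [exact: bm_cst|exact: cexpi_bm]. Qed.

Lemma Hf_bm t s c l : bounded_meas (Hf t s c ^~ l).
Proof. by apply: bm_sum => k; apply: bmM; [exact: bm_cst|exact: cexpi_bm]. Qed.

Definition sample (t : R) (s : seq int) (c : int -> R[i]) (m : int) : R[i] :=
  \sum_(k <- s) c k * window a w (lattice_point beta t k - alpha * m%:~R).

Lemma lattice_parseval t s c :
  \esum_(m in [set: int]) (abs2 (sample t s c m))%:E =
   (p * (2 * pi) ^+ 2 * norm2D p (St t s c))%:E.
Proof.
have p0 : 0 < p by exact: p_gt0.
pose F y := (0 -i* (2 * pi)) * St t s c y.
have bF : bounded_meas F by apply: bmM; [exact: bm_cst|exact: St_bm].
rewrite -mulrA (_ : _ * norm2D p _ = norm2D p F); last first.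
  rewrite /norm2D -RintegralZl; [|exact: measurable_itv|]; last first.
    by apply: bm_abs2_integrable; [exact: measurable_itv|exact: itv_fin|exact: St_bm].
  apply: eq_Rintegral => y _; rewrite abs2M; congr (_ * _).
  by rewrite /abs2 /= expr0n add0r sqrrN.
rewrite -parseval//; apply: eq_esum => m _.
by rewrite /F fcoef_Sfun.
Qed.

Lemma norm2D_St_upper : exists2 B : R, 0 < B & forall t s c, uniq s ->
  norm2D p (St t s c) <= B * \sum_(k <- s) abs2 (c k).
Proof.
have p0 : 0 < p by exact: p_gt0.
have [d d0 dP] := period_factor_bound w alpha beta hw alpha0.
have [K K0 KP] := ep_ubound_fin 'I_N (fun l y => a l * ev w l (y + 0)) 0 p
  (fun l => epM _ _ (ep_cst (a l)) (ep_ev w l 0)) (ltW p0).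
(* M periods of length beta cover [0, p[. In [B] one factor N comes from Cauchy-Schwarz and the
   other counts the terms of the sum over l. *)
pose M := (Num.truncn (p / beta)).+1.
have pM : p <= M%:R * beta by rewrite -ler_pdivrMr// ltW// truncnS_gt.
pose B := N%:R * (K * (N%:R * (M%:R * beta * d^-1))).
have B0 : 0 <= B.
  by rewrite !mulr_ge0// ?ltW// invr_gt0.
exists (1 + B); first by rewrite ltr_pwDl.
move=> t s c us; set E := \sum_(k <- s) abs2 (c k).
have E0 : 0 <= E by rewrite sumr_ge0// => k _; exact: abs2_ge0.
rewrite mulrDl mul1r ler_wpDl// /B -!mulrA.
have mDp : measurable (`[0, p[ : set R) by exact: measurable_itv.
have Hint l : mu.-integrable `[0, p[ (EFin \o (fun y => K * abs2 (Hf t s c y l))).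
  apply: integrable_scale => //; apply: bm_abs2_integrable => //; first exact: itv_fin.
  exact: Hf_bm.
apply: (@le_trans _ _ (\int[mu]_(y in `[0, p[)
   (N%:R * \sum_(l < N) K * abs2 (Hf t s c y l)))).
  apply: le_Rintegral => //.
  - by apply: bm_abs2_integrable => //; [exact: itv_fin|exact: St_bm].
  - by apply: integrable_scale => //; exact: integrable_bigsum.
  move=> y; rewrite /= in_itv /= => yp; rewrite /trunc yp /Sfun /Ssum.
  rewrite (le_trans (abs2_sum_ord_le _ _))// ler_wpM2l//; apply: ler_sum => l _.
  rewrite abs2M ler_wpM2r ?abs2_ge0//; have := KP l y; rewrite addr0; apply.
  by case/andP: yp => y0 /ltW yp; rewrite y0.
rewrite RintegralZl//; last exact: integrable_bigsum.
rewrite ler_wpM2l// Rintegral_sum//.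
apply: (@le_trans _ _ (\sum_(l < N) K * (M%:R * (beta * (d^-1 * E))))); last first.
  by rewrite sumr_const card_ord -[X in X <= _]mulr_natl mulrCA.
apply: ler_sum => l _; rewrite RintegralZl//; last first.
  by apply: bm_abs2_integrable => //; [exact: itv_fin|exact: Hf_bm].
rewrite ler_wpM2l ?(ltW K0)//.
apply: (@le_trans _ _ (norm2D (M%:R * beta) (Hf t s c ^~ l))).
  exact: norm2D_mono_le pM (Hf_bm t s c l).
rewrite norm2D_Hfun// -!mulrA ler_wpM2l// ler_wpM2l ?(ltW beta0)//.
rewrite /E mulr_sumr; apply: ler_sum => k _.
rewrite abs2M abs2V mulrC ler_wpM2r ?abs2_ge0//.
by rewrite lef_pV2 ?posrE// (lt_le_trans d0).
Qed.

(** The coercivity estimate is integrated over y in [0, beta[, with B the sum of all candidate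
    samples. Each of these finitely many shifted integrals is at most the integral over the period
    p. *)
Lemma norm2D_St_lower : exists2 A : R, 0 < A & forall t s c, uniq s ->
  A * \sum_(k <- s) abs2 (c k) <= norm2D p (St t s c).
Proof.
have p0 : 0 < p by exact: p_gt0.
have bp : beta < p by exact: beta_lt_p.
have [K [n [K0 KP]]] := cocycle_coercive a w beta p ha hwd beta0 bp
  (irr_lattice alpha beta alpha0 irrational) hm0.
(* For 0 <= y < beta and j <= n, a point y + jp + m beta of ]0, p[ forces |m| < M. *)
have [M MP] : exists M : nat, n.+1%:R * p < M%:R * beta.
  exists (Num.truncn (n.+1%:R * p / beta)).+1.
  by rewrite -ltr_pdivrMr// truncnS_gt.
pose sh (ji : 'I_n.+1 * 'I_(2 * M).+1) : R := ji.1%:R * p + (ji.2%:R - M%:R) * beta.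
pose Q : R := #|{: 'I_n.+1 * 'I_(2 * M).+1}|%:R.
have Q0 : 0 < Q by rewrite ltr0n card_prod !card_ord muln_gt0.
exists (beta / (K * Q)); first by rewrite divr_gt0// mulr_gt0.
move=> t s c us; set E := \sum_(k <- s) abs2 (c k).
rewrite mulrAC ler_pdivrMr ?mulr_gt0// -(norm2D_Cfun beta beta0 t s c us) [X in _ <= X]mulrC.
pose T y := \sum_ji abs2 (St t s c (y + sh ji)).
have mb : measurable (`[0, beta[ : set R) by exact: measurable_itv.
have Sint ji : mu.-integrable `[0, beta[ (EFin \o (fun y => abs2 (St t s c (y + sh ji)))).
  apply: bm_abs2_integrable => //; first exact: itv_fin.
  by have := bm_comp _ _ (measurable_shift (sh ji)) (St_bm t s c).
have Tint : mu.-integrable `[0, beta[ (EFin \o T) by exact: integrable_bigsum.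
apply: (@le_trans _ _ (\int[mu]_(y in `[0, beta[) (K * T y))).
  apply: le_Rintegral => //.
  - by apply: bm_abs2_integrable => //; [exact: itv_fin|exact: Cf_bm].
  - exact: integrable_scale.
  move=> y; rewrite /= in_itv /= => /andP[y0 yb].
  apply: (KP _ _ _ (cocycle_fun w alpha beta hw alpha0 beta0 t s c)).
    by rewrite sumr_ge0// => ji _; exact: abs2_ge0.
  move=> j m jn /andP[x0 xp].
  have mM : (`|m| <= M)%N.
    have mRb : `|m|%N%:R * beta < M%:R * beta.
      have jR : j%:R * p <= n%:R * p by rewrite ler_wpM2r ?ler_nat// ltW.
      have jR0 : 0 <= j%:R * p by rewrite mulr_ge0// ltW.
      have np : n.+1%:R * p = n%:R * p + p by rewrite -natr1 mulrDl mul1r.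
      have : `|m%:~R * beta| < M%:R * beta by rewrite ltr_norml; apply/andP; split; lra.
      by rewrite normrM (gtr0_norm beta0) -intr_norm natr_absz.
    by rewrite ltr_pM2r// ltr_nat in mRb; exact: ltnW.
  have [iM iE] := shift_index m M mM.
  have jn' : (j < n.+1)%N by [].
  pose ji := (Ordinal jn', Ordinal iM).
  have shE : y + sh ji = y + j%:R * p + m%:~R * beta.
    rewrite /sh /= -addrA; congr (_ + (_ + _ * _)).
    by rewrite (iE R) addrK.
  rewrite /T (bigD1 ji)//= shE {1}/trunc (ltW x0) xp /= lerDl.
  by rewrite sumr_ge0// => ji' _; exact: abs2_ge0.
rewrite RintegralZl// -mulrA ler_wpM2l ?(ltW K0)//.
rewrite Rintegral_sum//.
apply: (@le_trans _ _ (\sum_(ji : 'I_n.+1 * 'I_(2 * M).+1) norm2D p (St t s c))).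
  apply: ler_sum => ji _; apply: norm2D_shift_le; first exact: St_bm.
  by move=> y /negbTE yp; rewrite /trunc yp.
by rewrite sumr_const -[X in X <= _]mulr_natl.
Qed.

Lemma lattice_bounds : exists A B : R, [/\ 0 < A, 0 < B & forall t s c, uniq s ->
  let E := \sum_(k <- s) abs2 (c k) in
  ((A * E)%:E <= \esum_(m in [set: int]) (abs2 (sample t s c m))%:E <= (B * E)%:E)%E].
Proof.
have p0 : 0 < p by exact: p_gt0.
have [A A0 AP] := norm2D_St_lower; have [B B0 BP] := norm2D_St_upper.
have q0 : 0 < p * (2 * pi) ^+ 2 by rewrite mulr_gt0// exprn_gt0// mulr_gt0// pi_gt0.
exists (p * (2 * pi) ^+ 2 * A), (p * (2 * pi) ^+ 2 * B); split; [exact: mulr_gt0|exact: mulr_gt0|].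
move=> t s c us /=; rewrite lattice_parseval !lee_fin.
move: q0; set q := p * _ => q0.
by rewrite -!(mulrA q) !ler_pM2l// AP ?BP.
Qed.
End LatticeBounds.

(** * From samples to the Gabor system *)

Section Periodization.
Local Open Scope classical_set_scope.
Context {R : realType}.
Local Notation mu := (@lebesgue_measure R).

(** The integers -K, ..., K - 1: the translates by kL of [0, L[ tile [-KL, KL[ exactly. *)
Definition zrange (K : nat) : seq int := [seq i%:Z - K%:Z | i <- iota 0 (2 * K)].

Lemma zrange_uniq K : uniq (zrange K).
Proof. by rewrite map_inj_uniq ?iota_uniq// => i j /addIr []. Qed.

Lemma Rintegral_itv_split (f : R -> R) (a L : R) n : 0 < L ->
  (forall u v : R, mu.-integrable `[u, v[ (EFin \o f)) ->
  \int[mu]_(x in `[a, a + n%:R * L[) f x =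
  \sum_(i < n) \int[mu]_(x in `[a + i%:R * L, a + i.+1%:R * L[) f x.
Proof.
move=> L0 fi; elim: n => [|n IH].
  by rewrite big_ord0 mul0r addr0 set_itvco0 Rintegral_set0.
rewrite big_ord_recr /= -IH (@itv_bndbnd_setU _ _ _ (BLeft (a + n%:R * L))).
- rewrite Rintegral_setU//.
    rewrite -(@itv_bndbnd_setU _ _ _ (BLeft (a + n%:R * L)))// bnd_simp.
      by rewrite lerDl mulr_ge0// ltW.
    by rewrite lerD2l ler_pM2r// ler_nat.
  apply/disj_set2P; rewrite -subset0 => x [] /=; rewrite !in_itv /= => /andP[_ x1] /andP[x2 _].
  by move: (lt_le_trans x1 x2); rewrite ltxx.
- by rewrite bnd_simp lerDl mulr_ge0// ltW.
- by rewrite bnd_simp lerD2l ler_pM2r// ler_nat.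
Qed.

Lemma periodize (f : R -> R) (L M : R) (K : nat) : 0 < L ->
  measurable_fun setT f -> (forall x, f x ^+ 2 <= M) ->
  (forall x, ~~ (- (K%:R * L) <= x < K%:R * L) -> f x = 0) ->
  \int[mu]_x f x = \int[mu]_(t in `[0, L[) \sum_(k <- zrange K) f (t + k%:~R * L).
Proof.
move=> L0 mf fM f0.
have fi u v : mu.-integrable `[u, v[ (EFin \o f).
  by apply: (@bounded_integrable _ _ _ M) => //; exact: itv_fin.
have mS (c : R) : measurable_fun setT (fun t : R => f (t + c)).
  exact: (measurableT_comp mf (measurable_shift c)).
have fiS (c u v : R) : mu.-integrable `[u, v[ (EFin \o (fun t : R => f (t + c))).
  by apply: (@bounded_integrable _ _ _ M) => //; exact: itv_fin.
rewrite Rintegral_sum//.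
have -> : \int[mu]_x f x = \int[mu]_(x in `[- (K%:R * L), - (K%:R * L) + (2 * K)%:R * L[) f x.
  rewrite [RHS]Rintegral_mkcond; apply: eq_Rintegral => x _; rewrite patchE.
  case: ifPn => // xK; apply: f0; apply: contra xK => H.
  rewrite inE /= in_itv /=; move: H; rewrite natrM => /andP[-> H] /=.
  by lra.
rewrite Rintegral_itv_split// big_map.
rewrite -(big_mkord xpredT (fun i => \int[mu]_(x in `[- (K%:R * L) + i%:R * L,
    - (K%:R * L) + i.+1%:R * L[) f x)) /index_iota subn0.
apply: eq_bigr => i _.
have E : (fun x => x + (i%:Z - K%:Z)%:~R * L) @^-1`
    `[- (K%:R * L) + i%:R * L, - (K%:R * L) + i.+1%:R * L[ = `[0, L[.
  rewrite shift_preimage_itv intrB -!pmulrn.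
  have -> : - (K%:R * L) + i%:R * L - (i%:R - K%:R) * L = 0 by ring.
  by have -> : - (K%:R * L) + i.+1%:R * L - (i%:R - K%:R) * L = L by rewrite -[i.+1%:R]natr1; ring.
by rewrite -[in RHS]E Rintegral_shift.
Qed.

(** The enumeration 0, -1, 1, -2, ..., through which results on series over [nat] apply to sums over
    [int]. *)
Definition zenum (n : nat) : int := if odd n then Negz n./2 else Posz n./2.

Lemma zenum_bij : set_bij [set: nat] [set: int] zenum.
Proof.
split=> //.
- move=> m n _ _; rewrite /zenum => E.
  rewrite -(odd_double_half m) -(odd_double_half n).
  by move: E; case: (odd m); case: (odd n) => // -[->].
- move=> [n|n] _ /=.
    by exists n.*2 => //; rewrite /zenum odd_double doubleK.
  by exists n.*2.+1 => //; rewrite /zenum /= odd_double /= uphalf_double.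
Qed.

Lemma esum_int (u : int -> \bar R) : (forall n, 0 <= u n)%E ->
  (\esum_(n in [set: int]) u n = \sum_(i <oo) u (zenum i))%E.
Proof. by move=> u0; rewrite (reindex_esum _ _ _ _ zenum_bij) nneseries_esumT. Qed.

Lemma esum_intZ (c : R) (u : int -> \bar R) : 0 <= c -> (forall n, 0 <= u n)%E ->
  (\esum_(n in [set: int]) (c%:E * u n) = c%:E * \esum_(n in [set: int]) u n)%E.
Proof.
move=> c0 u0; rewrite !esum_int// => [|n]; last by rewrite mule_ge0// lee_fin.
by rewrite nneseriesZl// => n _.
Qed.

Lemma measurable_esum_int (f : int -> R -> R) : (forall n x, 0 <= f n x) ->
  (forall n, measurable_fun setT (f n)) ->
  measurable_fun setT (fun x => \esum_(n in [set: int]) (f n x)%:E)%E.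
Proof.
move=> f0 mf; have -> : (fun x => \esum_(n in [set: int]) (f n x)%:E)%E =
    (fun x => \sum_(0 <= i <oo | i \in xpredT) (f (zenum i) x)%:E)%E.
  apply/funext => x; rewrite esum_int//; first by move=> n; rewrite lee_fin.
apply: ge0_emeasurable_sum => [k x _ _|k _]; first by rewrite lee_fin.
exact/measurable_EFinP.
Qed.

Lemma integral_esum_int (D : set R) (f : int -> R -> R) : measurable D ->
  (forall n x, 0 <= f n x) -> (forall n, measurable_fun setT (f n)) ->
  (\int[mu]_(x in D) (\esum_(n in [set: int]) (f n x)%:E) =
   \esum_(n in [set: int]) \int[mu]_(x in D) (f n x)%:E)%E.
Proof.
move=> mD f0 mf.
rewrite esum_int => [|n]; last by apply: integral_ge0 => x _; rewrite lee_fin.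
under eq_integral do (rewrite esum_int; last by move=> n; rewrite lee_fin).
rewrite integral_nneseries// => [n|n x _]; last by rewrite lee_fin.
by apply: measurable_funTS; apply/measurable_EFinP; exact: mf.
Qed.
End Periodization.

(** * Frame bounds for bounded functions of bounded support *)

Section TruncatedFrame.
Local Open Scope classical_set_scope.
Context {R : realType} {N : nat} (a w : 'I_N -> R[i]) (alpha beta : R).
Hypothesis ha : forall k, a k != 0.
Hypothesis hw : forall k, complex.Re (w k) != 0.
Hypothesis hwd : forall k l, k != l -> complex.Re (w k) != complex.Re (w l).
Hypothesis hm0 : forall xi : R, 0 < xi -> m0 a w xi != 0.
Hypothesis alpha0 : 0 < alpha.
Hypothesis beta0 : 0 < beta.
Hypothesis alphabeta : alpha * beta < 1.
Hypothesis irrational : forall q : rat, alpha * beta != ratr q.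
Local Notation mu := (@lebesgue_measure R).
Local Notation L := (beta^-1).
Local Notation g := (window a w).
Local Notation atom := (gabor_atom g alpha beta).

Lemma abs2_pole (x : R) l : abs2 (x%:C - (0 +i* 1) * w l) =
  (x + complex.Im (w l)) ^+ 2 + complex.Re (w l) ^+ 2.
Proof.
by rewrite /abs2 !(Re_add, Im_add, Re_opp, Im_opp, Re_mul, Im_mul) /=; ring.
Qed.

Lemma sqr_Re_gt0 l : 0 < complex.Re (w l) ^+ 2.
Proof. by rewrite exprn_even_gt0//= hw. Qed.

Lemma abs2_pole_ge (x : R) l :
  complex.Re (w l) ^+ 2 <= abs2 (x%:C - (0 +i* 1) * w l).
Proof. by rewrite abs2_pole lerDr sqr_ge0. Qed.

Lemma abs2_pole_gt0 (x : R) l : 0 < abs2 (x%:C - (0 +i* 1) * w l).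
Proof. exact: lt_le_trans (sqr_Re_gt0 l) (abs2_pole_ge x l). Qed.

Lemma inv_pole_bm l : bounded_meas (fun x : R => (x%:C - (0 +i* 1) * w l)^-1).
Proof.
split; last first.
  exists (complex.Re (w l) ^+ 2)^-1 => x.
  by rewrite abs2V lef_pV2 ?posrE ?abs2_pole_ge ?abs2_pole_gt0 ?sqr_Re_gt0.
have E (x : R) : (x%:C - (0 +i* 1) * w l)^-1 =
    ((abs2 (x%:C - (0 +i* 1) * w l))^-1)%:C * conjc (x%:C - (0 +i* 1) * w l).
  have n0 : x%:C - (0 +i* 1) * w l != 0 by rewrite -abs2_gt0 abs2_pole_gt0.
  apply: (mulfI n0); rewrite divff//.
  by rewrite mulrCA mulJ_abs2 -rmorphM /= mulVf// abs2_eq0.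
under eq_fun do rewrite E.
apply: cmeasM; last first.
  by apply: cmeasJ; apply: cmeasB; [exact: cmeas_real|exact: cmeas_cst].
apply: cmeas_real; apply: continuous_measurable_fun => x.
apply: cvgV; first by rewrite gt_eqF ?abs2_pole_gt0.
rewrite abs2_pole; under eq_fun do rewrite abs2_pole !expr2.
rewrite !expr2; apply: cvgD; last exact: cvg_cst.
by apply: cvgM; apply: cvgD; (exact: cvg_id || exact: cvg_cst).
Qed.

Lemma window_bm : bounded_meas g.
Proof. by apply: bm_sum => l; apply: bmM; [exact: bm_cst|exact: inv_pole_bm]. Qed.

Lemma atom_bm m n : bounded_meas (atom m n).
Proof.
apply: bmM.
  have := cexpi_bm (beta * n%:~R); congr bounded_meas.
  by apply/funext => t; congr cexpi; ring.
have := bm_comp _ _ (measurable_shift (- (alpha * m%:~R))) window_bm.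
by [].
Qed.

Lemma atom_shift m n t k : atom m n (t + k%:~R * L) =
  fbasis L n t * g (t + k%:~R * L - alpha * m%:~R).
Proof.
have bn0 : beta != 0 by rewrite gt_eqF.
rewrite /gabor_atom; congr (_ * _); rewrite -[RHS]mulr1 -(cexpi_2piZ (k * n)).
rewrite /fbasis -cexpiD; congr cexpi; rewrite intrM invrK.
by field.
Qed.

Section FixedF.
Variables (f : R -> R[i]) (K : nat).
Hypothesis bf : bounded_meas f.
Hypothesis fK : forall x, ~~ (- (K%:R * L) <= x < K%:R * L) -> f x = 0.

(** The L-periodisation of f times the conjugate of the translated window. [zrange K] suffices
    because f vanishes outside [-KL, KL[. *)
Definition phi (m : int) (t : R) : R[i] :=
  \sum_(k <- zrange K) f (t + k%:~R * L) * conjc (g (t + k%:~R * L - alpha * m%:~R)).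

Lemma L_gt0 : 0 < L. Proof. by rewrite invr_gt0. Qed.

Lemma phi_bm m : bounded_meas (phi m).
Proof.
apply: bm_sum => k; apply: bmM; first exact: (bm_comp _ _ (measurable_shift _) bf).
apply: bmJ; have := bm_comp _ _ (measurable_shift (k%:~R * L - alpha * m%:~R)) window_bm.
by congr bounded_meas; apply/funext => t /=; rewrite addrA.
Qed.

Lemma cint_periodize (F : R -> R[i]) : bounded_meas F ->
  (forall x, ~~ (- (K%:R * L) <= x < K%:R * L) -> F x = 0) ->
  cint setT F = cint `[0, L[ (fun t => \sum_(k <- zrange K) F (t + k%:~R * L)).
Proof.
move=> [[mR mI] [M FM]] F0; rewrite /cint; congr Complex.
- rewrite (@periodize _ (fun x => complex.Re (F x)) L M K L_gt0 mR).
  + by apply: eq_Rintegral => t _; rewrite ReC_sum.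
  + by move=> x; apply: le_trans (FM x); rewrite lerDl sqr_ge0.
  + by move=> x /F0 ->.
- rewrite (@periodize _ (fun x => complex.Im (F x)) L M K L_gt0 mI).
  + by apply: eq_Rintegral => t _; rewrite ImC_sum.
  + by move=> x; apply: le_trans (FM x); rewrite lerDr sqr_ge0.
  + by move=> x /F0 ->.
Qed.

Lemma inner_atom m n : inner f (atom m n) = fcoef L (phi m) n.
Proof.
have -> : inner f (atom m n) = cint setT (fun t => f t * conjc (atom m n t)) by [].
rewrite cint_periodize.
- apply: eq_cint => t _; rewrite /phi mulr_suml; apply: eq_bigr => k _.
  by rewrite atom_shift conjcM mulrA mulrAC.
- by apply: bmM => //; apply: bmJ; exact: atom_bm.
- by move=> x /fK ->; rewrite mul0r.
Qed.

Definition fibre_norm (t : R) : R := \sum_(k <- zrange K) abs2 (f (t + k%:~R * L)).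

Lemma fibre_norm_ge0 t : 0 <= fibre_norm t.
Proof. by rewrite sumr_ge0// => k _; exact: abs2_ge0. Qed.

Lemma measurable_fibre_norm : measurable_fun setT fibre_norm.
Proof.
apply: measurable_sum => k.
by have [+ _] := bm_comp _ _ (measurable_shift (k%:~R * L)) bf; move/measurable_abs2.
Qed.

Lemma norm2_fibre : norm2 f = \int[mu]_(t in `[0, L[) fibre_norm t.
Proof.
have [mf [M fM]] := bf.
rewrite /norm2 (@periodize _ (fun x => abs2 (f x)) L (M ^+ 2) K L_gt0)//.
- exact: measurable_abs2.
- move=> x; rewrite ler_sqr ?nnegrE ?abs2_ge0//.
  exact: le_trans (abs2_ge0 (f x)) (fM x).
- by move=> x /fK ->; rewrite abs2_0.
Qed.

Lemma fibre_norm_integrable : mu.-integrable `[0, L[ (EFin \o fibre_norm).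
Proof.
apply: integrable_bigsum; first exact: measurable_itv.
move=> k; apply: bm_abs2_integrable; [exact: measurable_itv|exact: itv_fin|].
exact: (bm_comp _ _ (measurable_shift (k%:~R * L)) bf).
Qed.

(** The samples do not conjugate the window, so the sequence is taken to be the conjugate of f at
    the lattice points; the modulus is unchanged. *)
Lemma sample_phi t m : abs2 (sample a w alpha beta t (zrange K)
   (fun k => conjc (f (lattice_point beta t k))) m) = abs2 (phi m t).
Proof.
rewrite -[RHS]abs2J /phi conjc_sum; congr abs2; apply: eq_bigr => k _.
by rewrite conjcM conjcK.
Qed.

Lemma esum_atoms :
  (\esum_(i in [set: int * int]) (abs2 (inner f (atom i.1 i.2)))%:E =
   L%:E * \int[mu]_(t in `[0%R, L[) \esum_(m in [set: int]) (abs2 (phi m t))%:E)%E.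
Proof.
have mI : measurable (`[0, L[ : set R) by exact: measurable_itv.
rewrite integral_esum_int//; last 2 first.
- by move=> m x; exact: abs2_ge0.
- by move=> m; apply: measurable_abs2; case: (phi_bm m).
rewrite -esum_intZ; last 2 first.
- exact/ltW/L_gt0.
- by move=> m; apply: integral_ge0 => x _; rewrite lee_fin abs2_ge0.
have -> : [set: int * int] = [set: int] `*`` (fun=> [set: int]).
  by apply/seteqP; split.
rewrite -(esum_esum (a := fun m n => (abs2 (inner f (atom m n)))%:E))//; last first.
  by move=> m n _ _; rewrite lee_fin abs2_ge0.
apply: eq_esum => m _; under eq_esum do rewrite inner_atom.
rewrite parseval ?L_gt0//; last exact: phi_bm.
rewrite EFinM /norm2D /Rintegral fineK//.
apply: integrable_fin_num => //.
by apply: bm_abs2_integrable => //; [exact: itv_fin|exact: phi_bm].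
Qed.
End FixedF.

Lemma truncated_frame : exists A B : R, [/\ 0 < A, 0 < B & forall f (K : nat),
  bounded_meas f -> (forall x, ~~ (- (K%:R * L) <= x < K%:R * L) -> f x = 0) ->
  ((A * norm2 f)%:E <= \esum_(i in [set: int * int]) (abs2 (inner f (atom i.1 i.2)))%:E
    <= (B * norm2 f)%:E)%E].
Proof.
have [A [B [A0 B0 AB]]] := lattice_bounds a w alpha beta ha hw hwd hm0 alpha0 beta0
  alphabeta irrational.
have Lpos := L_gt0.
exists (L * A), (L * B); split; [exact: mulr_gt0|exact: mulr_gt0|].
move=> f K bf fK; rewrite (esum_atoms f K bf fK).
have mI : measurable (`[0, L[ : set R) by exact: measurable_itv.
have mfib (c : R) : measurable_fun setT (fun t => (c * fibre_norm f K t)%:E).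
  apply/measurable_EFinP; apply: measurable_funM; first exact: measurable_cst.
  exact: measurable_fibre_norm.
have bnd t : ((A * fibre_norm f K t)%:E <= \esum_(m in [set: int]) (abs2 (phi f K m t))%:E
    <= (B * fibre_norm f K t)%:E)%E.
  have := AB t (zrange K) (fun k => conjc (f (lattice_point beta t k))) (zrange_uniq K).
  rewrite /= (eq_esum (b := fun m => (abs2 (phi f K m t))%:E)) => [|m _]; last first.
    by rewrite sample_phi.
  rewrite (eq_bigr (fun k => abs2 (f (t + k%:~R * L)))) // => k _.
  by rewrite abs2J.
have int_fib (c : R) : 0 <= c -> (L%:E * \int[mu]_(t in `[0%R, L[) (c * fibre_norm f K t)%:E =
    (L * c * norm2 f)%:E)%E.
  move=> c0; rewrite (norm2_fibre f K bf fK) -!mulrA EFinM -RintegralZl//; last first.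
    exact: fibre_norm_integrable.
  rewrite /Rintegral fineK//; apply: integrable_fin_num => //.
  by apply: integrable_scale => //; exact: fibre_norm_integrable.
have mes : measurable_fun setT (fun t => \esum_(m in [set: int]) (abs2 (phi f K m t))%:E)%E.
  apply: measurable_esum_int => [n x|n]; first exact: abs2_ge0.
  by apply: measurable_abs2; case: (phi_bm f K bf n).
rewrite -(int_fib A (ltW A0)) -(int_fib B (ltW B0)).
apply/andP; split; rewrite lee_pmul2l// ge0_le_integral//.
- by move=> t _; rewrite lee_fin mulr_ge0 ?fibre_norm_ge0// ltW.
- by apply: measurable_funTS; exact: mfib.
- by apply: measurable_funTS; exact: mes.
- by move=> t _; case/andP: (bnd t).
- by move=> t _; apply: esum_ge0 => m _; rewrite lee_fin abs2_ge0.
- by apply: measurable_funTS; exact: mes.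
- by apply: measurable_funTS; exact: mfib.
- by move=> t _; case/andP: (bnd t).
Qed.
End TruncatedFrame.

(** * Square-integrable functions and passage to the limit *)

Section SquareIntegrable.
Local Open Scope classical_set_scope.
Context {R : realType}.
Local Notation mu := (@lebesgue_measure R).
Implicit Types f h : R -> R[i].

Lemma L2_cmeas f : L2 f -> cmeas f.
Proof. by case=> mR [mI _]; split. Qed.

Lemma L2_integrable f : L2 f -> mu.-integrable setT (EFin \o (fun x => abs2 (f x))).
Proof.
move=> L2f; have mf := L2_cmeas _ L2f; have [_ [_ fin]] := L2f.
apply/integrableP; split.
  by apply/measurable_EFinP; apply: measurable_abs2.
under eq_integral do rewrite /= ger0_norm ?abs2_ge0//.
exact: fin.
Qed.

Lemma L2_of_le f h (c : R) : cmeas f -> L2 h ->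
  (forall x, abs2 (f x) <= c * abs2 (h x)) -> L2 f.
Proof.
move=> [mR mI] L2h fh; split => //; split => //.
have mh := L2_cmeas _ L2h.
have /integrableP[_ fin] := @integrable_scale _ setT c _ measurableT (L2_integrable _ L2h).
apply: le_lt_trans fin; apply: ge0_le_integral => //.
- by move=> x _; rewrite lee_fin abs2_ge0.
- by apply/measurable_EFinP; apply: measurable_abs2.
- apply/measurable_EFinP; apply: measurableT_comp => //.
  by apply: measurable_funM; [exact: measurable_cst|exact: measurable_abs2].
- by move=> x _; rewrite /= lee_fin (le_trans (fh x))// ler_norm.
Qed.

Lemma L2_mul_integrable f h : L2 f -> L2 h -> cintegrable setT (fun x => f x * conjc (h x)).
Proof.
move=> L2f L2h.
have [mR mI] := cmeasM _ _ (L2_cmeas _ L2f) (cmeasJ _ (L2_cmeas _ L2h)).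
have fin := @integrable_add _ setT _ _ measurableT (L2_integrable _ L2f) (L2_integrable _ L2h).
have bnd (u v : R) z z' : u ^+ 2 + v ^+ 2 = abs2 (z * conjc z' : R[i]) -> `|u| <= abs2 z + abs2 z'.
  rewrite abs2M abs2J => E.
  rewrite -ler_sqr ?nnegrE ?(addr_ge0 (abs2_ge0 z) (abs2_ge0 z')) ?normr_ge0// real_normK ?num_real//.
  have z0 := abs2_ge0 z; have z'0 := abs2_ge0 z'.
  have := sqr_ge0 v.
  by rewrite sqrrD; nra.
have dom (u : R -> R) : measurable_fun setT u -> (forall x, `|u x| <= abs2 (f x) + abs2 (h x)) ->
    mu.-integrable setT (EFin \o u).
  move=> mu_ ub; apply: le_integrable fin => //; first exact/measurable_EFinP.
  move=> x _; rewrite /= lee_fin (le_trans (ub x))// ler_norm//.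
split; apply: dom => // x.
- exact: bnd (erefl _).
- by apply: (bnd _ (complex.Re (f x * conjc (h x)))); rewrite addrC.
Qed.

Lemma oneDsqr_integrable : (\int[mu]_x ((1 + x ^+ 2)^-1)%:E < +oo)%E.
Proof.
have m1 : measurable_fun setT (fun x : R => ((1 + x ^+ 2)^-1)%:E).
  apply/measurable_EFinP; apply: continuous_measurable_fun.
  exact: continuous_oneDsqrV.
have p0 (x : R) : (0 <= ((1 + x ^+ 2)^-1)%:E)%E.
  by rewrite lee_fin invr_ge0 addr_ge0// sqr_ge0.
have E : [set: R] = `]-oo, 0%R] `|` `[0%R, +oo[.
  apply/seteqP; split => // x _ /=; rewrite !in_itv /= andbT.
  by apply/orP; exact: le_total.
have half : (\int[mu]_(x in `[0%R, +oo[) ((1 + x ^+ 2)^-1)%:E < +oo)%E.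
  by have := integral0y_oneDsqr R; rewrite /oneDsqr => ->; exact: ltry.
have half' : (\int[mu]_(x in `]-oo, 0%R]) ((1 + x ^+ 2)^-1)%:E < +oo)%E.
  have := @ge0_integration_by_substitution0 R (fun x : R => ((1 + x ^+ 2)^-1)%:E) m1 p0.
  by under [RHS]eq_integral do rewrite sqrrN; move=> <-.
have Eo : [set: R] = `]-oo, 0%R[ `|` `[0%R, +oo[.
  apply/seteqP; split => // x _ /=; rewrite !in_itv /= andbT.
  by case: (ltP x 0); [left|right].
rewrite Eo ge0_integral_setU//=.
- rewrite lte_add_pinfty//; apply: le_lt_trans half'.
  apply: ge0_subset_integral => //; first exact: measurable_funTS.
  by move=> x /=; rewrite !in_itv /= => /ltW.
- exact: measurable_funTS.
- apply/disj_set2P; rewrite -subset0 => x [] /=; rewrite !in_itv /= => x0.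
  by rewrite andbT leNgt x0.
Qed.

Lemma L2_sum (I : Type) (r : seq I) (F : I -> R -> R[i]) : (forall i, L2 (F i)) ->
  L2 (fun x => \sum_(i <- r) F i x).
Proof.
move=> L2F; have [mR mI] := @cmeas_sum _ _ r F (fun i => L2_cmeas _ (L2F i)).
split=> //; split=> //.
have := @integrable_scale _ setT (size r)%:R _ measurableT
  (@integrable_bigsum R _ r setT _ measurableT (fun i => L2_integrable _ (L2F i))).
move=> /integrableP[_]; apply: le_lt_trans; apply: ge0_le_integral => //.
- by move=> x _; rewrite lee_fin abs2_ge0.
- by apply/measurable_EFinP; apply: measurable_abs2.
- apply/measurable_EFinP; apply: measurableT_comp => //.
  apply: measurable_funM; first exact: measurable_cst.
  by apply: measurable_sum => i; apply: measurable_abs2; exact: L2_cmeas.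
- move=> x _; rewrite /= lee_fin; apply: le_trans (ler_norm _).
  exact: abs2_sum_le.
Qed.

Lemma L2_shift f c : L2 f -> L2 (fun x => f (x + c)).
Proof.
move=> L2f; have mf := L2_cmeas _ L2f; have [_ [_ fin]] := L2f.
have [mR mI] := cmeas_comp _ _ (measurable_shift c) mf; split=> //; split=> //.
have := @ge0_integral_shift R (fun x => (abs2 (f x))%:E) c setT measurableT.
rewrite preimage_setT => -> //; first by apply/measurable_EFinP; apply: measurable_abs2.
by move=> x; rewrite lee_fin abs2_ge0.
Qed.

Lemma abs2_inner_le2 f h F : L2 f -> L2 h -> L2 F ->
  abs2 (inner (fun x => f x - h x) F) <= 2 * abs2 (inner f F) + 2 * abs2 (inner h F).
Proof.
move=> L2f L2h L2F.
have If := L2_mul_integrable _ _ L2f L2F; have Ih := L2_mul_integrable _ _ L2h L2F.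
have -> : inner (fun x => f x - h x) F = inner f F - inner h F.
  have -> : inner (fun x => f x - h x) F =
      cint setT (fun x => f x * conjc (F x) + (-1) * (h x * conjc (F x))).
    by rewrite -[LHS]/(cint setT (fun x => (f x - h x) * conjc (F x)));
      apply: eq_cint => x _; ring.
  rewrite cintD//; last exact: cintegrableZ.
  by rewrite cintZ// mulN1r.
exact: abs2B_le.
Qed.
End SquareIntegrable.

Section Cutoff.
Local Open Scope classical_set_scope.
Context {R : realType} (L : R) (f : R -> R[i]).
Hypothesis L0 : 0 < L.
Hypothesis L2f : L2 f.
Local Notation mu := (@lebesgue_measure R).

Definition cutoff_dom (K : nat) (x : R) : bool :=
  ((- (K%:R * L) <= x) && (x < K%:R * L)) && (abs2 (f x) <= K%:R).
Definition cutoff (K : nat) (x : R) : R[i] := if cutoff_dom K x then f x else 0.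

Lemma measurable_cutoff_dom K : measurable_fun setT (cutoff_dom K).
Proof.
have mx : measurable_fun setT (@id R) by exact: measurable_id.
apply: measurable_and; last first.
  by apply: measurable_fun_ler => //; apply: measurable_abs2; exact: L2_cmeas.
apply: measurable_and; first exact: measurable_fun_ler.
exact: measurable_fun_ltr.
Qed.

Lemma cutoff_bm K : bounded_meas (cutoff K).
Proof.
have [mR mI] := L2_cmeas _ L2f; have mG := measurable_cutoff_dom K.
split; last first.
  exists K%:R => x; rewrite /cutoff; case: ifP => [/andP[]//|_].
  by rewrite abs2_0.
split.
- under eq_fun do rewrite /cutoff (fun_if (@complex.Re R)).
  by apply: measurable_fun_ifT.
- under eq_fun do rewrite /cutoff (fun_if (@complex.Im R)).
  by apply: measurable_fun_ifT.
Qed.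

Lemma cutoff_out K x : ~~ (- (K%:R * L) <= x < K%:R * L) -> cutoff K x = 0.
Proof. by rewrite /cutoff /cutoff_dom => /negbTE ->. Qed.

Lemma cutoff_dom_near x : \forall K \near \oo, cutoff_dom K x.
Proof.
near=> K.
have xK : `|x| / L < K%:R by near: K; exact: nbhs_infty_gtr.
have fK : abs2 (f x) < K%:R by near: K; exact: nbhs_infty_gtr.
rewrite /cutoff_dom (ltW fK) andbT; move: xK; rewrite ltr_pdivrMr// ltr_norml.
by case/andP => /ltW -> ->.
Unshelve. all: by end_near.
Qed.

Lemma Rintegral_cutoff_cvg (h : R -> R) : mu.-integrable setT (EFin \o h) ->
  (\int[mu]_x (if cutoff_dom K x then h x else 0)) @[K --> \oo] --> \int[mu]_x h x.
Proof.
move=> ih; have /integrableP[/measurable_EFinP mh _] := ih.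
have [] := @dominated_convergence _ _ _ mu (setT : set R) measurableT
  (fun K x => (if cutoff_dom K x then h x else 0)%:E) (EFin \o h) (fun x => `|h x|%:E).
- move=> K; apply/measurable_EFinP; apply: measurable_fun_ifT => //.
  exact: measurable_cutoff_dom.
- exact/measurable_EFinP.
- apply: aeW => x _; apply: cvg_near_cst; near=> K.
  have -> : cutoff_dom K x by near: K; exact: cutoff_dom_near.
  by [].
- exact: integrable_norm.
- apply: aeW => x K _; rewrite /= lee_fin; case: ifP => // _.
  by rewrite normr0.
move=> _ _ H; apply: fine_cvg; rewrite fineK; last exact: integrable_fin_num.
exact: H.
Unshelve. all: by end_near.
Qed.

Lemma cutoff_L2 K : L2 (cutoff K).
Proof.
apply: (@L2_of_le _ _ f 1); [by case: (cutoff_bm K)|exact: L2f|move=> x].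
rewrite mul1r /cutoff; case: ifP => // _; rewrite abs2_0; exact: abs2_ge0.
Qed.

Lemma cutoff_rem_L2 K : L2 (fun x => f x - cutoff K x).
Proof.
apply: (@L2_of_le _ _ f 1); last 2 first.
- exact: L2f.
- move=> x; rewrite mul1r /cutoff; case: ifP => _; last by rewrite subr0.
  by rewrite subrr abs2_0 abs2_ge0.
by apply: cmeasB; [exact: L2_cmeas|case: (cutoff_bm K)].
Qed.

Lemma norm2_cutoff_cvg : norm2 (cutoff K) @[K --> \oo] --> norm2 f.
Proof.
have E K : norm2 (cutoff K) = \int[mu]_x (if cutoff_dom K x then abs2 (f x) else 0).
  by apply: eq_Rintegral => x _; rewrite /cutoff; case: ifP => // _; rewrite abs2_0.
by under eq_fun do rewrite E; exact/Rintegral_cutoff_cvg/L2_integrable.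
Qed.

(** Pythagoras: at each point either the cutoff or the remainder is zero. *)
Lemma norm2_cutoff_rem K : norm2 (fun x => f x - cutoff K x) = norm2 f - norm2 (cutoff K).
Proof.
rewrite /norm2 -RintegralB//; [|exact: L2_integrable|exact/L2_integrable/cutoff_L2].
apply: eq_Rintegral => x _; rewrite /cutoff; case: ifP => _.
  by rewrite !subrr abs2_0.
by rewrite abs2_0 !subr0.
Qed.

Lemma abs2_inner_cutoff_cvg F : L2 F ->
  abs2 (inner (cutoff K) F) @[K --> \oo] --> abs2 (inner f F).
Proof.
move=> L2F; have [iR iI] := L2_mul_integrable _ _ L2f L2F.
have cR := Rintegral_cutoff_cvg _ iR; have cI := Rintegral_cutoff_cvg _ iI.
have E K : abs2 (inner (cutoff K) F) =
    (\int[mu]_x (if cutoff_dom K x then complex.Re (f x * conjc (F x)) else 0)) ^+ 2 +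
    (\int[mu]_x (if cutoff_dom K x then complex.Im (f x * conjc (F x)) else 0)) ^+ 2.
  rewrite /abs2 /inner /=; congr (_ ^+ 2 + _ ^+ 2); apply: eq_Rintegral => x _;
    by rewrite /cutoff; case: ifP => // _; rewrite mul0r.
under eq_fun do rewrite E.
by apply: cvgD; (rewrite expr2; under eq_fun do rewrite expr2; exact: cvgM).
Qed.
End Cutoff.

Section FrameOfCutoff.
Local Open Scope classical_set_scope.
Context {R : realType} {I : choiceType} (F : I -> R -> R[i]) (L A B : R).
Hypothesis L2F : forall i, L2 (F i).
Hypothesis L0 : 0 < L.
Hypothesis A0 : 0 < A.
Hypothesis bounds : forall f (K : nat), bounded_meas f ->
  (forall x, ~~ (- (K%:R * L) <= x < K%:R * L) -> f x = 0) ->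
  ((A * norm2 f)%:E <= \esum_(i in [set: I]) (abs2 (inner f (F i)))%:E
    <= (B * norm2 f)%:E)%E.

(** For finitely many indices both sides converge along the cutoffs, so no interchange of limit and
    infinite sum is needed. *)
Lemma bessel_bound f (s : seq I) : L2 f -> uniq s ->
  \sum_(i <- s) abs2 (inner f (F i)) <= B * norm2 f.
Proof.
move=> L2f us.
have cl : \sum_(i <- s) abs2 (inner (cutoff L f K) (F i)) @[K --> \oo]
    --> \sum_(i <- s) abs2 (inner f (F i)).
  apply: cvg_big => [|i _]; first exact: add_continuous.
  exact: abs2_inner_cutoff_cvg.
have cr : B * norm2 (cutoff L f K) @[K --> \oo] --> B * norm2 f.
  by apply: cvgM; [exact: cvg_cst|exact: norm2_cutoff_cvg].
rewrite -(cvg_lim _ cl)// -(cvg_lim _ cr)//.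
apply: ler_lim; [by apply/cvg_ex; eexists; exact: cl|by apply/cvg_ex; eexists; exact: cr|].
apply: nearW => K; rewrite -lee_fin.
have /andP[_] := bounds (cutoff L f K) K (cutoff_bm _ _ L2f _) (cutoff_out _ _ _).
exact/le_trans/seq_le_esum.
Qed.

(** The Bessel bound applied to the remainder f - f_K gives A |f_K|^2 <= 2S + 2B |f - f_K|^2, with
    L^2 norms and S the frame sum of f; then K tends to infinity. The 2 of |u - v|^2 <= 2|u|^2 +
    2|v|^2 turns A into A/2, and the maximum secures the order of the two constants. *)
Lemma frame_of_cutoff : is_frame F.
Proof.
exists (A / 2), (Num.max (A / 2) B); split; first by rewrite divr_gt0.
split; first by rewrite le_max lexx.
move=> f L2f.
have n0 : 0 <= norm2 f by apply: Rintegral_ge0 => x _; exact: abs2_ge0.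
apply/andP; split; last first.
  apply: esum_seq_le => s us; rewrite lee_fin (le_trans (bessel_bound f s L2f us))//.
  by rewrite ler_wpM2r// le_max lexx orbT.
set S := (\esum_(i in _) _)%E.
have S_fin : S \is a fin_num.
  rewrite ge0_fin_numE; last by apply: esum_ge0 => i _; rewrite lee_fin abs2_ge0.
  apply: (@le_lt_trans _ _ (B * norm2 f)%:E); last exact: ltry.
  by apply: esum_seq_le => s us; rewrite lee_fin bessel_bound.
rewrite -(fineK S_fin) lee_fin.
have sS s : uniq s -> \sum_(i <- s) abs2 (inner f (F i)) <= fine S.
  by move=> us; rewrite -lee_fin fineK//; exact: seq_le_esum.
have step K : A * norm2 (cutoff L f K) <=
    2 * fine S + 2 * (B * (norm2 f - norm2 (cutoff L f K))).
  rewrite -lee_fin.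
  have /andP[+ _] := bounds (cutoff L f K) K (cutoff_bm _ _ L2f _) (cutoff_out _ _ _).
  move/le_trans; apply; apply: esum_seq_le => s us; rewrite lee_fin.
  have L2r := cutoff_rem_L2 L f L2f K.
  have := bessel_bound _ s L2r us; rewrite norm2_cutoff_rem// => rem.
  apply: (@le_trans _ _ (\sum_(i <- s) (2 * abs2 (inner f (F i)) +
      2 * abs2 (inner (fun x => f x - cutoff L f K x) (F i))))).
    apply: ler_sum => i _.
    have := abs2_inner_le2 f _ (F i) L2f L2r (L2F i).
    rewrite (_ : (fun x => f x - (f x - cutoff L f K x)) = cutoff L f K)//.
    by apply/funext => x; rewrite opprB addrC subrK.
  by rewrite big_split /= -!mulr_sumr lerD// ler_wpM2l// sS.
have cl : A * norm2 (cutoff L f K) @[K --> \oo] --> A * norm2 f.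
  by apply: cvgM; [exact: cvg_cst|exact: norm2_cutoff_cvg].
have cr : 2 * fine S + 2 * (B * (norm2 f - norm2 (cutoff L f K))) @[K --> \oo]
    --> 2 * fine S + 2 * (B * (norm2 f - norm2 f)).
  apply: cvgD; first exact: cvg_cst.
  apply: cvgM; first exact: cvg_cst.
  apply: cvgM; first exact: cvg_cst.
  by apply: cvgB; [exact: cvg_cst|exact: norm2_cutoff_cvg].
have : A * norm2 f <= 2 * fine S + 2 * (B * (norm2 f - norm2 f)).
  rewrite -[leLHS](cvg_lim _ cl)// -[leRHS](cvg_lim _ cr)//.
  apply: ler_lim; [by apply/cvg_ex; eexists; exact: cl|by apply/cvg_ex; eexists; exact: cr|].
  exact: nearW.
rewrite subrr mulr0 mulr0 addr0; set n := norm2 f; set s := fine S.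
by lra.
Qed.
End FrameOfCutoff.

Section AtomL2.
Local Open Scope classical_set_scope.
Context {R : realType}.
Local Notation mu := (@lebesgue_measure R).

(** The function is 1/(1 - ix), with squared modulus 1/(1 + x^2). *)
Lemma cauchy_kernel_L2 : L2 (fun x : R => ((1 + x ^+ 2)^-1)%:C * (1 +i* x)).
Proof.
have [mR mI] : cmeas (fun x : R => ((1 + x ^+ 2)^-1)%:C * (1 +i* x)).
  apply: cmeasM; last by split=> //=; exact: measurable_id.
  apply: cmeas_real; apply: continuous_measurable_fun.
  exact: continuous_oneDsqrV.
split=> //; split=> //; apply: le_lt_trans oneDsqr_integrable.
apply: ge0_le_integral => //.
- by move=> x _; rewrite lee_fin abs2_ge0.
- by apply/measurable_EFinP; apply: measurable_abs2.
- by apply/measurable_EFinP; apply: continuous_measurable_fun; exact: continuous_oneDsqrV.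
- move=> x _; rewrite lee_fin abs2M abs2_real.
  have -> : abs2 (1 +i* x) = 1 + x ^+ 2 by rewrite /abs2 /= expr1n.
  by rewrite expr2 -mulrA mulVf ?mulr1// gt_eqF// ltr_pwDl// sqr_ge0.
Qed.

Context {N : nat} (a w : 'I_N -> R[i]).
Hypothesis hw : forall k, complex.Re (w k) != 0.

(** Comparison with the kernel shifted by Im w_l: with r = (Re w_l)^2 > 0, (u^2 + r)(1 + 1/r) >= 1 +
    u^2. *)
Lemma inv_pole_L2 l : L2 (fun x : R => (x%:C - (0 +i* 1) * w l)^-1).
Proof.
have [mP _] := inv_pole_bm w hw l.
apply: (@L2_of_le _ _ _ (1 + (complex.Re (w l) ^+ 2)^-1) mP
  (L2_shift _ (complex.Im (w l)) cauchy_kernel_L2)) => x.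
have r0 := sqr_Re_gt0 w hw l.
rewrite abs2V abs2_pole abs2M abs2_real; set u := x + _; set r := complex.Re (w l) ^+ 2.
have -> : abs2 (1 +i* u) = 1 + u ^+ 2 by rewrite /abs2 /= expr1n.
have r0' : 0 < r := r0.
move: (u) (r) r0' => {r0}{}u {}r r0.
have u0 := sqr_ge0 u; have u1 : 0 < 1 + u ^+ 2 by rewrite ltr_pwDl.
rewrite [_^-1 ^+ 2]expr2 -[X in _ * X]mulrA mulVf ?gt_eqF// mulr1.
have ur0 : 0 < u ^+ 2 + r by rewrite ltr_wpDl.
rewrite ler_pdivlMr// ler_pdivrMl//.
have -> : (u ^+ 2 + r) * (1 + r^-1) = 1 + u ^+ 2 + (r + u ^+ 2 * r^-1).
  by field; rewrite gt_eqF.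
have r0w := ltW r0; by rewrite lerDl (addr_ge0 r0w)// (mulr_ge0 u0)// invr_ge0.
Qed.

Lemma window_L2 : L2 (window a w).
Proof.
apply: L2_sum => l; have L2p := inv_pole_L2 l.
apply: (@L2_of_le _ _ _ (abs2 (a l)) _ L2p); last by move=> x; rewrite abs2M.
by apply: cmeasM; [exact: cmeas_cst|exact: L2_cmeas].
Qed.

Lemma atom_L2 alpha beta m n : L2 (gabor_atom (window a w) alpha beta m n).
Proof.
have [mA _] := atom_bm a w alpha beta hw m n.
apply: (@L2_of_le _ _ _ 1 mA (L2_shift _ (- (alpha * m%:~R)) window_L2)) => x.
by rewrite /gabor_atom abs2M abs2_cexpi.
Qed.
End AtomL2.

Theorem theorem1p2 (R : realType) (N : nat) (a w : 'I_N -> R[i])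
  (ha : forall k, a k != 0)
  (hw : forall k, complex.Re (w k) != 0)
  (hwd : forall k l, k != l -> complex.Re (w k) != complex.Re (w l))
  (hm0 : forall xi : R, 0 < xi ->
     \sum_(k < N) a k * cexp ((2 * pi * xi)%:C * w k) != 0) :
  forall alpha beta : R, 0 < alpha -> 0 < beta -> alpha * beta < 1 ->
    (forall q : rat, alpha * beta != ratr q) ->
    gabor_frame (fun t : R => \sum_(k < N) a k / (t%:C - (0 +i* 1) * w k)) alpha beta.
Proof.
move=> alpha beta alpha0 beta0 alphabeta irrational.
have [A [B [A0 B0 AB]]] := truncated_frame a w alpha beta ha hw hwd hm0 alpha0 beta0
  alphabeta irrational.
apply: (frame_of_cutoff _ beta^-1 A B _ _ A0 AB); last by rewrite invr_gt0.
by move=> [m n]; exact: (atom_L2 a w hw).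
Qed.
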